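(* There exist $p\in\mathrm{poly}$, a constant $\alpha>0$, and a classical two-prover one-round interactive proof system for the Succinct Circuit Value problem such that: (completeness) for every yes-instance $x$ there is a no-signaling strategy making the verifier accept with probability $1$; (soundness) for every no-instance $x$, every no-signaling strategy makes the verifier accept with probability at most $1-2^{-2^{p(|x|)}}$. In particular $\text{Succinct Circuit Value}\in\mathrm{MIP}^{\mathrm{ns}}_{1,1-2^{-2^{\mathrm{poly}}}}(2,1)$. Moreover, for infinitely many input strings $x$, the soundness error of this proof system on $x$ (the maximum acceptance probability over no-signaling strategies) is at least $1-2^{-2^{|x|^\alpha}}$.
   Context: $\mathrm{poly}$ is the set of functions $p\colon\mathbb{N}\to\mathbb{N}$ such that some polynomial-time deterministic Turing machine outputs $1^{p(n)}$ on input $1^n$. Succinct Circuit Value: for a Boolean circuit $C$ with gates $g_0,\dots,g_{N-1}$ of fan-in at most two, where $g_j$ is an input to $g_i$ only if $j<i$, a succinct representation is a pair $(N,D)$ where $D$ is a Boolean circuit that on input $0\le i\le N-1$ returns the kind of gate $g_i$ (ZERO, ONE, AND, OR, or NOT) and the indices of the gates feeding $g_i$. An instance is a succinct representation $(N,D)$ together with an integer $0\le k\le N-1$; the question is whether gate $g_k$ has value $1$. In a two-prover one-round interactive proof system, a randomized polynomial-time verifier, on input $x$, sends polynomial-length questions $s$ to prover Alice and $t$ to prover Bob (drawn from some distribution), receives polynomial-length answers $y$ from Alice and $z$ from Bob, and accepts with some probability $R(y,z\mid s,t)$. A strategy is a family of probability distributions $p(\cdot,\cdot\mid s,t)$ over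 answer pairs $(y,z)$ indexed by question pairs; it is no-signaling if $\sum_y p(y,z\mid s,t)=\sum_y p(y,z\mid s',t)$ for all $s,s',t,z$ and $\sum_z p(y,z\mid s,t)=\sum_z p(y,z\mid s,t')$ for all $s,t,t',y$. For $a,b\colon\mathbb{N}\to[0,1]$, $\mathrm{MIP}^{\mathrm{ns}}_{a,b}(2,1)$ is the class of promise problems $A=(A_{\mathrm{yes}},A_{\mathrm{no}})$ having such a system where for each $x\in A_{\mathrm{yes}}$ some no-signaling strategy gives acceptance probability at least $a(|x|)$, and for each $x\in A_{\mathrm{no}}$ every no-signaling strategy gives acceptance probability at most $b(|x|)$; $\mathrm{MIP}^{\mathrm{ns}}_{1,1-2^{-2^{\mathrm{poly}}}}(2,1)=\bigcup_{p\in\mathrm{poly}}\mathrm{MIP}^{\mathrm{ns}}_{1,1-2^{-2^{p}}}(2,1)$. *)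

(* Defs.v *)
From HB Require Import structures.
From mathcomp Require Import all_boot all_order all_algebra.
From mathcomp Require Import classical_sets boolp reals Rstruct exp.
From Stdlib Require Rdefinitions.
Notation R := Rdefinitions.R.
Set Implicit Arguments. Unset Strict Implicit. Unset Printing Implicit Defensive.
Import Order.TTheory GRing.Theory Num.Theory.

Definition tsym := option bool.  (* None = blank *)

Inductive move := mvLeft | mvRight | mvStay.

(* A machine with n.+2 states; state 0 is the start state, state 1 halts. *)
Record TM := mkTM {
  tm_n : nat;
  tm_delta : 'I_tm_n.+2 -> tsym -> 'I_tm_n.+2 * tsym * move }.

Record config (M : TM) := mkConfig {
  c_state : 'I_(tm_n M).+2;
  c_left : seq tsym;   (* cells left of the head, nearest first *)
  c_cur : tsym;
  c_right : seq tsym }. (* cells right of the head, nearest first *)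

Definition tm_start (M : TM) : 'I_(tm_n M).+2 := ord0.
Definition tm_halt (M : TM) : 'I_(tm_n M).+2 := inord 1.

Definition init_config (M : TM) (w : seq bool) : config M :=
  match w with
  | [::] => mkConfig (tm_start M) [::] None [::]
  | b :: w' => mkConfig (tm_start M) [::] (Some b) (map Some w')
  end.

Definition halted (M : TM) (c : config M) : bool := c_state c == tm_halt M.

Definition step (M : TM) (c : config M) : config M :=
  if halted c then c else
  let: (q', s, mv) := tm_delta (c_state c) (c_cur c) in
  match mv with
  | mvStay => mkConfig q' (c_left c) s (c_right c)
  | mvRight =>
      match c_right c with
      | [::] => mkConfig q' (s :: c_left c) None [::]
      | a :: r => mkConfig q' (s :: c_left c) a r
      end
  | mvLeft =>
      match c_left c with
      | [::] => mkConfig q' [::] None (s :: c_right c)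
      | a :: l => mkConfig q' l a (s :: c_right c)
      end
  end.

Definition run (M : TM) (t : nat) (w : seq bool) : config M :=
  iter t (@step M) (init_config M w).

Fixpoint read_word (s : seq tsym) : seq bool :=
  match s with
  | Some b :: s' => b :: read_word s'
  | _ => [::]
  end.

Definition output (M : TM) (c : config M) : seq bool :=
  read_word (c_cur c :: c_right c).

Record ptm := mkPtm {
  ptm_tm : TM;
  ptm_c : nat;
  ptm_halts : forall w : seq bool,
      halted (run ptm_tm (ptm_c * (size w) ^ ptm_c + ptm_c) w) }.

Definition ptm_eval (P : ptm) (w : seq bool) : seq bool :=
  output (run (ptm_tm P) (ptm_c P * (size w) ^ ptm_c P + ptm_c P) w).

Definition is_poly (p : nat -> nat) : Prop :=
  exists P : ptm, forall n, ptm_eval P (nseq n true) = nseq (p n) true.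

(* each bit b becomes "1 b", each component is terminated by "0 0" *)
Definition enc_list (ss : seq (seq bool)) : seq bool :=
  flatten [seq flatten [seq [:: true; b] | b <- s] ++ [:: false; false] | s <- ss].

(* binary, least significant bit first *)
Definition bin (n : nat) : seq bool :=
  mkseq (fun i => odd (n %/ 2 ^ i)) (trunc_log 2 n).+1.

Definition num_of_bits (s : seq bool) : nat :=
  \sum_(i < size s) (nth false s i) * 2 ^ i.

Inductive dgate :=
  | DIn of nat
  | DConst of bool
  | DAnd of nat & nat     (* indices of earlier gates *)
  | DOr of nat & nat
  | DNot of nat.

Record dcircuit := mkDC {
  dc_nin : nat;
  dc_gates : seq dgate;
  dc_outs : seq nat }.

Definition dgate_wf (nin j : nat) (g : dgate) : bool :=
  match g with
  | DIn i => i < nin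
  | DConst _ => true
  | DAnd a b | DOr a b => (a < j) && (b < j)
  | DNot a => a < j
  end.

Definition dc_wf (D : dcircuit) : bool :=
  [forall j : 'I_(size (dc_gates D)),
      dgate_wf (dc_nin D) j (nth (DConst false) (dc_gates D) j)]
  && all (fun o => o < size (dc_gates D)) (dc_outs D).

Definition dgate_val (inp : nat -> bool) (vs : seq bool) (g : dgate) : bool :=
  match g with
  | DIn i => inp i
  | DConst b => b
  | DAnd a b => nth false vs a && nth false vs b
  | DOr a b => nth false vs a || nth false vs b
  | DNot a => ~~ nth false vs a
  end.

Definition dc_eval (D : dcircuit) (inp : nat -> bool) : seq bool :=
  let vs := foldl (fun vs g => rcons vs (dgate_val inp vs g)) [::] (dc_gates D) in
  [seq nth false vs o | o <- dc_outs D].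

(*    With w := dc_nin D, D takes i in w-bit binary (lsb first) and outputs *)
(*    3 + 2w bits: a 3-bit kind code (lsb first: 0 ZERO, 1 ONE, 2 AND,      *)
(*    3 OR, 4 NOT, other codes invalid), then the w-bit indices of the      *)
(*    first and second input gates.                                         *)

Inductive gkind := GZero | GOne | GAnd | GOr | GNot.

Definition succ_gate (D : dcircuit) (i : nat) : option (gkind * nat * nat) :=
  let w := dc_nin D in
  let o := dc_eval D (fun j => odd (i %/ 2 ^ j)) in
  let code := num_of_bits (take 3 o) in
  let a := num_of_bits (take w (drop 3 o)) in
  let b := num_of_bits (take w (drop (3 + w) o)) in
  match code with
  | 0 => Some (GZero, a, b)
  | 1 => Some (GOne, a, b)
  | 2 => Some (GAnd, a, b)
  | 3 => Some (GOr, a, b)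
  | 4 => Some (GNot, a, b)
  | _ => None
  end.

Definition succ_gate_ok (D : dcircuit) (i : nat) : bool :=
  match succ_gate D i with
  | Some (GAnd, a, b) | Some (GOr, a, b) => (a < i) && (b < i)
  | Some (GNot, a, _) => a < i
  | Some _ => true
  | None => false
  end.

Definition succ_valid (N : nat) (D : dcircuit) (k : nat) : Prop :=
  [/\ dc_wf D, size (dc_outs D) = 3 + 2 * dc_nin D, N <= 2 ^ dc_nin D,
      k < N & forall i, i < N -> succ_gate_ok D i].

Definition sgate_val (vs : seq bool) (g : option (gkind * nat * nat)) : bool :=
  match g with
  | Some (GZero, _, _) => false
  | Some (GOne, _, _) => true
  | Some (GAnd, a, b) => nth false vs a && nth false vs b
  | Some (GOr, a, b) => nth false vs a || nth false vs b
  | Some (GNot, a, _) => ~~ nth false vs a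
  | None => false
  end.

Definition succ_vals (D : dcircuit) (n : nat) : seq bool :=
  foldl (fun vs i => rcons vs (sgate_val vs (succ_gate D i))) [::] (iota 0 n).

Definition succ_value (D : dcircuit) (k : nat) : bool :=
  nth false (succ_vals D k.+1) k.

Definition enc_dgate (g : dgate) : seq bool :=
  match g with
  | DIn i => enc_list [:: [:: false; false; false]; bin i]
  | DConst b => enc_list [:: [:: true; false; false]; [:: b]]
  | DAnd a b => enc_list [:: [:: false; true; false]; bin a; bin b]
  | DOr a b => enc_list [:: [:: true; true; false]; bin a; bin b]
  | DNot a => enc_list [:: [:: false; false; true]; bin a]
  end.

Definition enc_dc (D : dcircuit) : seq bool :=
  enc_list [:: bin (dc_nin D); enc_list (map enc_dgate (dc_gates D));
               enc_list (map bin (dc_outs D))].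

Definition enc_inst (N : nat) (D : dcircuit) (k : nat) : seq bool :=
  enc_list [:: bin N; enc_dc D; bin k].

Definition SCV_yes (x : seq bool) : Prop :=
  exists N D k, [/\ x = enc_inst N D k, succ_valid N D k & succ_value D k = true].

Definition SCV_no (x : seq bool) : Prop :=
  exists N D k, [/\ x = enc_inst N D k, succ_valid N D k & succ_value D k = false].

(*    The verifier draws r uniformly from {0,1}^(m |x|), computes Alice's   *)
(*    question Qa(x,r) and Bob's question Qb(x,r), receives answers         *)
(*    y in {0,1}^(la |x|), z in {0,1}^(lb |x|) and accepts iff              *)
(*    Dec(x,r,y,z) outputs "1".                                             *)

Record verifier := mkVerifier {
  v_m : nat -> nat;
  v_la : nat -> nat;
  v_lb : nat -> nat;
  v_Qa : ptm;
  v_Qb : ptm;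
  v_Dec : ptm }.

Definition good_verifier (V : verifier) : Prop :=
  [/\ is_poly (v_m V), is_poly (v_la V) & is_poly (v_lb V)].

Definition qA (V : verifier) (x r : seq bool) : seq bool :=
  ptm_eval (v_Qa V) (enc_list [:: x; r]).
Definition qB (V : verifier) (x r : seq bool) : seq bool :=
  ptm_eval (v_Qb V) (enc_list [:: x; r]).
Definition v_accepts (V : verifier) (x r y z : seq bool) : bool :=
  ptm_eval (v_Dec V) (enc_list [:: x; r; y; z]) == [:: true].

Local Open Scope ring_scope.

(* p s t y z = p(y, z | s, t) *)
Definition strategy (la lb : nat) :=
  seq bool -> seq bool -> la.-tuple bool -> lb.-tuple bool -> R.

Definition no_signaling (la lb : nat) (p : strategy la lb) : Prop :=
  [/\ (forall s t y z, 0 <= p s t y z),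
      (forall s t, \sum_(y : la.-tuple bool) \sum_(z : lb.-tuple bool) p s t y z = 1),
      (forall s s' t (z : lb.-tuple bool),
          \sum_(y : la.-tuple bool) p s t y z = \sum_(y : la.-tuple bool) p s' t y z)
    & (forall s t t' (y : la.-tuple bool),
          \sum_(z : lb.-tuple bool) p s t y z = \sum_(z : lb.-tuple bool) p s t' y z)].

Definition acc_prob (V : verifier) (x : seq bool)
    (p : strategy (v_la V (size x)) (v_lb V (size x))) : R :=
  (2 ^+ v_m V (size x))^-1 *
  \sum_(r : (v_m V (size x)).-tuple bool)
    \sum_(y : (v_la V (size x)).-tuple bool)
      \sum_(z : (v_lb V (size x)).-tuple bool)
        p (qA V x r) (qB V x r) y z * (v_accepts V x r y z)%:R.

Arguments acc_prob : clear implicits.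

Definition ns_value (V : verifier) (x : seq bool) : R :=
  sup [set a : R | exists p : strategy (v_la V (size x)) (v_lb V (size x)),
                     no_signaling p /\ a = acc_prob V x p].

(* Main.v *)
Require Import Defs.
From mathcomp Require Import all_boot all_order all_algebra.
From mathcomp Require Import classical_sets boolp reals Rstruct exp.
From mathcomp Require Import zify ring lra.
Set Implicit Arguments. Unset Strict Implicit. Unset Printing Implicit Defensive.
Import Order.TTheory GRing.Theory Num.Theory.

(* The verifier draws two gate indices i and j independently, asks Alice for the
   values of the two inputs a, b of gate i and Bob for the value of gate j, and
   rejects only if these answers visibly disagree: j = i and Bob's bit is not the
   gate function of Alice's bits, j = a or j = b and Bob's bit differs from
   Alice's, or j = k and Bob's bit is 0.  All useful question pairs have
   probability at least 2^-|x|, which is harmless at this error scale.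

   Soundness: if every question pair fails with probability at most d, then by
   no-signaling Bob's error e(i) on gate i is well defined and satisfies
   e(i) <= 3 d + e(a) + e(b), hence e(i) <= 3 (2^(i+1) - 1) d; since Bob must err
   on gate k, d >= 2^-(N+2).

   Tightness: take gates 2h and 2h+1 both equal to the OR of gates 2h-2 and 2h-1,
   above two ZERO gates.  Alice answers (1,0), (0,1) or (0,0), so that the
   probability of claiming 1 can double at each of the 2^(w-1) layers; the only
   detectable error is at the bottom and has probability 2^-(2^(w-1) - 1).

   The verifier's three machines are programs acting on finitely many bit queues.
   On the single tape, all queues live in one log of blocks to the right of a
   blank cell, each block holding a bit and its queue memberships; programs may
   only loop |input| times, which makes every one of them polynomial-time. *)

(** * Turing machines with finite registers *)

(** The loss of a factor two per gate is inherent. Alice's two answers are compared with Bob's one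
    at a time, so only a union bound controls the chance that one of them is wrong, and no-signaling
    correlations can make the two errors disjoint; the tightness strategy saturates exactly this. A
    succinct circuit may be exponentially deep in the input length, whence the double exponent. In 3
    d, two terms pay for the comparisons on the inputs and one for the gate check at j = i. A
    verifier is three concrete machines with a time bound on every word, so all programs are
    specified on arbitrary coin strings. A string whose first component is no proper gate index is
    accepted: soundness needs just one coin string for each pair of gates, and 2^-n times 2^-(N+2)
    is at least 2^-(2^n) because n + N + 2 <= 2^n. Hence p can be the identity. Validity of the
    instance is never tested, as the problem is a promise problem. *)

Definition tape := (seq tsym * tsym * seq tsym)%type.
Definition tcur (t : tape) := t.1.2.
Definition tmove (t : tape) (s : tsym) (m : move) : tape :=
  let: (l, _, r) := t in
  match m with
  | mvStay => (l, s, r)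
  | mvRight => (s :: l, head None r, behead r)
  | mvLeft => (behead l, head None l, s :: r)
  end.

Section Machines.
Variable S : Type.

(** Registers are kept apart from control states, and halting is the absence of a next state; a
    combinator can thus redirect the exit of one machine into another. *)
Record mach := Mach {
  mQ : finType;
  mq0 : mQ;
  md : mQ -> S -> tsym -> option mQ * S * tsym * move }.

Definition mconf (M : mach) := (option (mQ M) * S * tape)%type.

Definition mstep (M : mach) (c : mconf M) : mconf M :=
  let: (q, s, t) := c in
  if q is Some q then
    let: (q', s', a, m) := md q s (tcur t) in (q', s', tmove t a m)
  else c.

(* A halted machine idles, so [k] is an upper bound on the running time. *)
Definition runs (M : mach) (k : nat) (a b : S * tape) : Prop :=
  iter k (@mstep M) (Some (mq0 M), a.1, a.2) = (None, b.1, b.2).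

Lemma iter_mstep_halted (M : mach) k s t :
  iter k (@mstep M) (None, s, t) = (None, s, t).
Proof. by elim: k => //= k ->. Qed.

Lemma runs_leq (M : mach) k k' a b : k <= k' -> runs M k a b -> runs M k' a b.
Proof.
move=> le; rewrite /runs -(subnK le) iterD => ->.
exact: iter_mstep_halted.
Qed.

Definition mact (f : S -> tsym -> S * tsym * move) : mach :=
  @Mach unit tt (fun _ s a => let: (s', a', m) := f s a in (None, s', a', m)).

Definition mseq (M1 M2 : mach) : mach :=
  @Mach (mQ M1 + mQ M2)%type (inl (mq0 M1))
    (fun q s a => match q with
     | inl q => let: (q', s', a', m) := md q s a in
                (Some (if q' is Some q' then inl q' else inr (mq0 M2)), s', a', m)
     | inr q => let: (q', s', a', m) := md q s a in (omap inr q', s', a', m)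
     end).

Definition mif (b : S -> tsym -> bool) (M1 M2 : mach) : mach :=
  @Mach (option (mQ M1 + mQ M2)%type) None
    (fun q s a => match q with
     | None => (Some (Some (if b s a then inl (mq0 M1) else inr (mq0 M2))),
                s, a, mvStay)
     | Some (inl q) => let: (q', s', a', m) := md q s a in
                       (omap (Some \o inl) q', s', a', m)
     | Some (inr q) => let: (q', s', a', m) := md q s a in
                       (omap (Some \o inr) q', s', a', m)
     end).

(** When the body halts, its next state [None] becomes [Some None], which is the test state; this
    closes the loop without an explicit jump. *)
Definition mwhile (b : S -> tsym -> bool) (M : mach) : mach :=
  @Mach (option (mQ M)) None
    (fun q s a => match q with
     | None => (if b s a then Some (Some (mq0 M)) else None, s, a, mvStay)
     | Some q => let: (q', s', a', m) := md q s a in (Some q', s', a', m)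
     end).

Lemma tmove_stay t : tmove t (tcur t) mvStay = t.
Proof. by case: t => [[]]. Qed.

Lemma runs_act f s t s' t' :
  (let: (s1, a, m) := f s (tcur t) in (s1, tmove t a m)) = (s', t') ->
  runs (mact f) 1 (s, t) (s', t').
Proof. by rewrite /runs /=; case: (f _ _) => [[s1 a] m] [-> ->]. Qed.

Lemma runs_act_to f s t :
  runs (mact f) 1 (s, t)
    ((f s (tcur t)).1.1, tmove t (f s (tcur t)).1.2 (f s (tcur t)).2).
Proof. by apply: runs_act; case: (f _ _) => [[]]. Qed.

Lemma runs_seq M1 M2 k1 k2 a b c :
  runs M1 k1 a b -> runs M2 k2 b c -> runs (mseq M1 M2) (k1 + k2) a c.
Proof.
case: a b c => [s t] [s' t'] [s2 t2]; rewrite /runs /= => H1 H2.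
have sim2 : forall k q s t, iter k (@mstep (mseq M1 M2)) (omap inr q, s, t) =
  let: (q', s', t') := iter k (@mstep M2) (q, s, t) in (omap inr q', s', t').
  elim=> [//|k IH] q s0 t0; rewrite !iterSr.
  case: q => [q|] /=; last by rewrite iter_mstep_halted -[None]/(omap inr None) IH iter_mstep_halted.
  by case: (md q s0 (tcur t0)) => [[[q' s0'] a'] m] /=; rewrite IH.
elim: k1 (mq0 M1) s t H1 => [//|k IH] q s t; rewrite addSn !iterSr /=.
case: (md q s (tcur t)) => [[[q' s0'] a'] m] /=.
case: q' => [q'|]; first exact: IH.
rewrite iter_mstep_halted => -[-> ->].
rewrite -[Some (inr _)]/(omap inr (Some (mq0 M2))) sim2 iterD.
by rewrite H2 iter_mstep_halted.
Qed.

Lemma runs_if (b : S -> tsym -> bool) M1 M2 k a c :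
  (if b a.1 (tcur a.2) then runs M1 k a c else runs M2 k a c) ->
  runs (mif b M1 M2) k.+1 a c.
Proof.
case: a c => [s t] [s2 t2]; rewrite /runs iterSr /= tmove_stay.
have sim1 : forall k q s t, iter k (@mstep (mif b M1 M2)) (omap (Some \o inl) q, s, t) =
  let: (q', s', t') := iter k (@mstep M1) (q, s, t) in (omap (Some \o inl) q', s', t').
  elim=> [//|n IH] q s0 t0; rewrite !iterSr.
  case: q => [q|] /=; last by rewrite iter_mstep_halted -[None]/(omap (Some \o inl) None) IH iter_mstep_halted.
  by case: (md q s0 (tcur t0)) => [[[q' s0'] a'] m] /=; rewrite IH.
have sim2 : forall k q s t, iter k (@mstep (mif b M1 M2)) (omap (Some \o inr) q, s, t) =
  let: (q', s', t') := iter k (@mstep M2) (q, s, t) in (omap (Some \o inr) q', s', t').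
  elim=> [//|n IH] q s0 t0; rewrite !iterSr.
  case: q => [q|] /=; last by rewrite iter_mstep_halted -[None]/(omap (Some \o inr) None) IH iter_mstep_halted.
  by case: (md q s0 (tcur t0)) => [[[q' s0'] a'] m] /=; rewrite IH.
case: (b s _) => H.
  by rewrite -[Some (Some _)]/(omap (Some \o inl) (Some (mq0 M1))) sim1 H.
by rewrite -[Some (Some _)]/(omap (Some \o inr) (Some (mq0 M2))) sim2 H.
Qed.

Lemma runs_while_stop (b : S -> tsym -> bool) M a :
  ~~ b a.1 (tcur a.2) -> runs (mwhile b M) 1 a a.
Proof. by case: a => [s t] /= /negbTE h; rewrite /runs /= h tmove_stay. Qed.

Lemma runs_while_iter (b : S -> tsym -> bool) M k1 k2 a a1 a2 :
  b a.1 (tcur a.2) -> runs M k1 a a1 -> runs (mwhile b M) k2 a1 a2 ->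
  runs (mwhile b M) (k1 + k2).+1 a a2.
Proof.
case: a a1 a2 => [s t] [s1 t1] [s2 t2]; rewrite /runs iterSr /= tmove_stay => -> H1 H2.
elim: k1 (mq0 M) s t H1 => [//|k IH] q s t; rewrite addSn !iterSr /=.
case: (md q s (tcur t)) => [[[q' s0'] a'] m] /=.
case: q' => [q'|]; first exact: IH.
rewrite iter_mstep_halted => -[-> ->].
by rewrite iterD H2 iter_mstep_halted.
Qed.

End Machines.

(** * Translation into the Turing machines of the statement *)

Section ToTM.
Variables (S : finType) (s0 : S) (M : mach S).
Let st := (mQ M * S)%type.

(** Ranks are shifted by two to leave room for the prescribed start state 0, which becomes a second
    name of the initial pair, and the halting state 1. *)
Definition tm_code (q : option st) : 'I_#|{: st}|.+2 :=
  if q is Some x then inord (enum_rank x).+2 else inord 1.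
Definition tm_decode (i : 'I_#|{: st}|.+2) : st :=
  nth (mq0 M, s0) ((mq0 M, s0) :: (mq0 M, s0) :: enum {: st}) i.

Definition tm_of : TM :=
  @mkTM #|{: st}| (fun i a =>
    let: (q, s) := tm_decode i in
    let: (q', s', a', m) := md q s a in
    (tm_code (omap (fun q => (q, s')) q'), a', m)).

Lemma tm_codeK x : tm_decode (tm_code (Some x)) = x.
Proof.
rewrite /tm_decode /tm_code inordK /=; last by rewrite !ltnS; exact: ltn_ord.
exact: nth_enum_rank.
Qed.

Lemma tm_code_halt q : (tm_code q == inord 1) = (q == None).
Proof.
case: q => [x|]; last by rewrite !eqxx.
apply/eqP => /(congr1 val) /=; rewrite !inordK //.
by rewrite !ltnS; exact: ltn_ord.
Qed.

Definition config_tape (c : config tm_of) : tape := (c_left c, c_cur c, c_right c).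

Definition config_sim (c : config tm_of) (d : mconf M) : Prop :=
  config_tape c = d.2 /\
  match d.1.1 with
  | Some q => ~~ halted c /\ tm_decode (c_state c) = (q, d.1.2)
  | None => halted c
  end.

Lemma config_sim_step c d : config_sim c d -> config_sim (step c) (mstep d).
Proof.
case: d => [[[q|] s] t] [] /=; last by rewrite /step => <- h; rewrite h.
move=> <- [/negbTE nh dq]; rewrite /step nh.
case: c nh dq => i l x r /= nh dq; rewrite /= dq.
case: (md q s x) => [[[q' s'] a'] m].
have H (c : config tm_of) : c_state c = tm_code (omap (fun q => (q, s')) q') ->
  match q' with
  | Some q => ~~ halted c /\ tm_decode (c_state c) = (q, s')
  | None => halted c
  end.
  by move=> E; rewrite /halted E tm_code_halt; case: q' {E} => [q'|] //=; rewrite tm_codeK.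
split=> /=.
  by case: m; case: l {nh}; case: r.
by case: q' H => [q'|] /= H; case: m; case: l {nh}; case: r => * /=; apply: H.
Qed.

Lemma tm_of_run k w s' t' :
  runs M k (s0, config_tape (init_config tm_of w)) (s', t') ->
  halted (run tm_of k w) /\ config_tape (run tm_of k w) = t'.
Proof.
rewrite /runs /= => H.
have : config_sim (run tm_of k w) (None, s', t').
  rewrite -H /run; elim: (k) => [|n IH] /=; last exact: config_sim_step.
  have H0 : forall c : config tm_of, c_state c = ord0 ->
     config_sim c (Some (mq0 M), s0, config_tape c).
    move=> c E; split=> //=; rewrite /halted E; split; last by rewrite /tm_decode.
    by apply/eqP => /(congr1 val) /=; rewrite inordK.
  by apply: H0; case: w {H}.
by case=> /= -> ->.
Qed.

End ToTM.

(** * Queues on a tape *)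

Definition rtape (l s : seq tsym) : tape := (l, head None s, behead s).
Definition ltape (l r : seq tsym) : tape := (behead l, head None l, r).

(* A block is a data bit followed by K membership cells: cell q tells whether
   the data bit is still an element of queue q. *)
Definition block := (bool * seq bool)%type.
Definition flat (log : seq block) : seq bool := flatten [seq x.1 :: x.2 | x <- log].
Definition queue (log : seq block) (q : nat) : seq bool :=
  [seq x.1 | x <- log & nth false x.2 q].

(** The resting position between operations: the head is on the blank that separates [L] from the
    log. [L] is first the unread input and later the output, nearest cell first. The numbers [c] and
    [d] count blanks left behind at both ends by earlier moves. *)
Definition home (L : seq bool) (log : seq block) (c d : nat) : tape :=
  (map Some L ++ nseq c None, None, map Some (flat log) ++ nseq d None).

(** Popping clears one membership cell and never deletes a block: no cells have to be shifted, and a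
    block shared by several queues is consumed in each of them separately. *)
Fixpoint lpop (q : nat) (log : seq block) : seq block :=
  if log is (b, m) :: t then
    if nth false m q then (b, set_nth false m q false) :: t else (b, m) :: lpop q t
  else [::].

Lemma size_lpop q log : size (lpop q log) = size log.
Proof. by elim: log => [|[b m] t IH] //=; case: ifP => _ /=; rewrite ?IH. Qed.

Lemma queue_lpop q log q' :
  queue (lpop q log) q' = if q' == q then behead (queue log q) else queue log q'.
Proof.
rewrite /queue; elim: log => [|[b m] t IH] /=; first by case: ifP.
case: (boolP (nth false m q)) => h /=.
  by rewrite nth_set_nth /=; case: eqVneq => [->|_] //; case: nth.
case: eqVneq IH => [->|_] IH; first by rewrite (negbTE h).
by case: nth => /=; rewrite IH.
Qed.

Lemma queue_rcons log x q :
  queue (rcons log x) q = queue log q ++ nseq (nth false x.2 q) x.1.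
Proof.
rewrite /queue filter_rcons; case: nth; last by rewrite cats0.
by rewrite map_rcons cats1.
Qed.

Definition log_wf (K : nat) (log : seq block) := all (fun x => size x.2 == K) log.

Lemma log_wf_lpop K q log : q < K -> log_wf K log -> log_wf K (lpop q log).
Proof.
move=> qK; elim: log => [|[b m] t IH] //= /andP[/eqP sm wt].
case: ifP => _ /=; last by rewrite sm eqxx IH.
by rewrite size_set_nth sm wt; apply/andP; split=> //; apply/eqP; lia.
Qed.

Lemma size_flat K log : log_wf K log -> size (flat log) = K.+1 * size log.
Proof.
elim: log => [|[b m] t IH] /=; first by rewrite muln0.
by case/andP => /eqP sm /IH {}IH; rewrite /flat /= size_cat -/(flat t) IH sm; lia.
Qed.

(** * Single queue operations as tape routines *)

Section Ops.
Variable X : Type.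
(* user registers, then the two result registers of a pop: found, bit *)
Definition reg := (X * bool * bool)%type.
Implicit Types s : reg.

Definition goR : mach reg := mact (fun s a => (s, a, mvRight)).
Definition goL : mach reg := mact (fun s a => (s, a, mvLeft)).
Definition mskip : mach reg := mact (fun s a => (s, a, mvStay)).
Definition scanR := mwhile (fun _ a => isSome a) goR.
Definition scanL := mwhile (fun _ a => isSome a) goL.

Lemma runs_goR s l a r : runs goR 1 (s, (l, a, r)) (s, rtape (a :: l) r).
Proof. by []. Qed.

Lemma runs_goL s l a r : runs goL 1 (s, (l, a, r)) (s, ltape l (a :: r)).
Proof. by []. Qed.

Lemma runs_skip s t : runs mskip 1 (s, t) (s, t).
Proof. by apply: runs_act; rewrite tmove_stay. Qed.

Lemma runs_scanR s l u r : head None r = None ->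
  runs scanR (2 * size u).+1 (s, rtape l (map Some u ++ r))
    (s, rtape (map Some (rev u) ++ l) r).
Proof.
move=> hr; elim: u l => [|a u IH] l /=.
  by apply: runs_while_stop; rewrite /= /tcur /= hr.
rewrite [2 * _](_ : _ = 1 + (2 * size u).+1); last by lia.
apply: runs_while_iter; [by []|exact: runs_goR|].
by rewrite rev_cons map_rcons cat_rcons; apply: IH.
Qed.

Lemma runs_scanL s l u r : head None l = None ->
  runs scanL (2 * size u).+1 (s, ltape (map Some u ++ l) r)
    (s, ltape l (map Some (rev u) ++ r)).
Proof.
move=> hl; elim: u r => [|a u IH] r /=.
  by apply: runs_while_stop; rewrite /= /tcur /= hl.
rewrite [2 * _](_ : _ = 1 + (2 * size u).+1); last by lia.
apply: runs_while_iter; [by []|exact: runs_goL|].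
by rewrite rev_cons map_rcons cat_rcons; apply: IH.
Qed.

Lemma head_nones d : head None (nseq d (None : tsym)) = None.
Proof. by case: d. Qed.

Lemma behead_nones d : behead (nseq d (None : tsym)) = nseq d.-1 None.
Proof. by case: d. Qed.

Lemma rtape_nones l d : rtape l (nseq d None) = (l, None, nseq d.-1 None).
Proof. by case: d. Qed.

Definition mput (f : reg -> seq bool) (n : nat) : mach reg :=
  foldr (fun i M => mseq (mact (fun s _ => (s, Some (nth false (f s) i), mvRight))) M)
    mskip (iota 0 n).

Lemma runs_put f n s l d : size (f s) = n -> exists d',
  runs (mput f n) n.+1 (s, rtape l (nseq d None))
    (s, rtape (map Some (rev (f s)) ++ l) (nseq d' None)).
Proof.
move=> sf.
have H : forall k i l d, i + k = n -> exists d',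
    runs (foldr (fun i M =>
       mseq (mact (fun s _ => (s, Some (nth false (f s) i), mvRight))) M) mskip (iota i k))
      k.+1 (s, rtape l (nseq d None))
      (s, rtape (map Some (rev (drop i (f s))) ++ l) (nseq d' None)).
  elim=> [|k IH] i l0 d0 ik.
    exists d0; rewrite drop_oversize ?sf; last by lia.
    exact: runs_skip.
  have [|d' H'] := IH i.+1 (Some (nth false (f s) i) :: l0) d0.-1; first by lia.
  exists d'; rewrite /=.
  apply: (@runs_seq _ _ _ 1 k.+1 _ _ _ _ _); first exact: runs_act_to.
  rewrite /= behead_nones (drop_nth false) ?sf; last by lia.
  by rewrite rev_cons map_rcons cat_rcons.
by have := H n 0 l d (add0n n); rewrite drop0.
Qed.

Definition mapp (f : reg -> seq bool) (K : nat) : mach reg :=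
  mseq goR (mseq scanR (mseq (mput f K.+1) (mseq goL scanL))).

Lemma flat_rcons log x : flat (rcons log x) = flat log ++ x.1 :: x.2.
Proof. by rewrite /flat map_rcons flatten_rcons. Qed.

Lemma runs_app f K s L log c d x :
  log_wf K log -> f s = x.1 :: x.2 -> size x.2 = K ->
  exists d', runs (mapp f K) (8 * K.+2 * (size log).+1)
     (s, home L log c d) (s, home L (rcons log x) c d').
Proof.
move=> wf fs sx; set l0 := map Some L ++ nseq c None.
have sf : size (f s) = K.+1 by rewrite fs /= sx.
have [d1 H1] := runs_put (map Some (rev (flat log)) ++ None :: l0) d sf.
exists d1.-1.+1; have szf := size_flat wf.
apply: (@runs_leq _ _ (1 + ((2 * size (flat log)).+1 + (K.+2 + (1 +
   (2 * size (rev (flat (rcons log x)))).+1))))).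
  rewrite size_rev flat_rcons size_cat szf /= sx; lia.
apply: runs_seq (runs_goR _ _ _ _) _.
apply: runs_seq (runs_scanR _ _ _ (head_nones d)) _.
apply: runs_seq H1 _.
rewrite rtape_nones.
apply: runs_seq (runs_goL _ _ _ _) _.
rewrite fs catA -map_cat -rev_cat -flat_rcons.
rewrite -[None :: nseq _ _]/(nseq d1.-1.+1 None).
set u := rev _.
have := @runs_scanL s (None :: l0) u (nseq d1.-1.+1 None) erefl.
by rewrite revK.
Qed.

Definition goRs n := iter n (mseq goR) mskip.

Lemma runs_goRs s l u r : runs (goRs (size u)) (size u).+1
  (s, rtape l (map Some u ++ r)) (s, rtape (map Some (rev u) ++ l) r).
Proof.
elim: u l => [|a u IH] l /=; first exact: runs_skip.
rewrite -[in X in runs _ X]add1n; apply: runs_seq (runs_goR _ _ _ _) _.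
by rewrite rev_cons map_rcons cat_rcons; apply: IH.
Qed.

Definition mpop_block q K : mach reg :=
  mseq (mact (fun s a => ((s.1, a == Some true), a, mvRight)))
  (mseq (goRs q)
  (mseq (mact (fun s a => if a == Some true then ((s.1.1, true, s.2), Some false, mvRight)
                          else (s, a, mvRight)))
    (goRs (K - q.+1)))).

Lemma runs_pop_block q K x b0 l b m r : q < K -> size m = K ->
  runs (mpop_block q K) (K + 3) ((x, false, b0), rtape l (map Some (b :: m) ++ r))
   ((x, nth false m q, b),
    rtape (map Some (rev (b :: if nth false m q then set_nth false m q false else m)) ++ l) r).
Proof.
move=> qK sm.
have szt : size (take q m) = q by rewrite size_takel // sm ltnW.
have szd : size (drop q.+1 m) = K - q.+1 by rewrite size_drop sm.
have -> : (if nth false m q then set_nth false m q false else m) =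
    take q m ++ false :: drop q.+1 m.
  case: ifP => h; first by rewrite set_nthE sm qK.
  by rewrite -{1}(cat_take_drop q m) (drop_nth false) ?sm // h.
have Em : m = take q m ++ nth false m q :: drop q.+1 m.
  by rewrite -drop_nth ?sm // cat_take_drop.
rewrite [X in rtape l (map Some (b :: X) ++ r)]Em.
rewrite (_ : K + 3 = 1 + (q.+1 + (1 + (K - q.+1).+1))); last by lia.
rewrite /= map_cat -catA /=.
apply: (@runs_seq _ _ _ 1 _ _ ((x, false, b), _)).
  by apply: runs_act; rewrite /rtape /tcur /= ; case: (b).
have := runs_goRs (x, false, b) (Some b :: l) (take q m)
  (Some (nth false m q) :: map Some (drop q.+1 m) ++ r).
rewrite szt; move=> H; apply: runs_seq H _.
apply: (@runs_seq _ _ _ 1 _ _ ((x, nth false m q, b), rtape (Some false :: map Some (rev (take q m)) ++ Some b :: l) (map Some (drop q.+1 m) ++ r))).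
  by apply: runs_act; rewrite /rtape /tcur /=; case: (nth false m q).
have := runs_goRs (x, nth false m q, b) (Some false :: map Some (rev (take q m)) ++ Some b :: l) (drop q.+1 m) r.
rewrite szd; congr (runs _ _ _ (_, rtape _ _)).
by rewrite rev_cons rev_cat rev_cons !map_rcons map_cat map_rcons -cats1 -!catA /= -cats1 -catA.
Qed.

(** If the search fails, the bit register still holds the data bit of the last block inspected; the
    conjunction with the found flag resets it to false, the value expected for an empty queue. *)
Definition mpop q K : mach reg :=
  mseq (mact (fun s a => ((s.1.1, false, false), a, mvRight)))
  (mseq (mwhile (fun s a => isSome a && ~~ s.1.2) (mpop_block q K))
  (mseq (mact (fun s a => ((s.1, s.1.2 && s.2), a, mvLeft))) scanL)).

Lemma runs_pop_loop q K x b0 l log d : q < K -> log_wf K log ->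
  exists pre post bit,
  [/\ flat (lpop q log) = pre ++ post,
      runs (mwhile (fun s a => isSome a && ~~ s.1.2) (mpop_block q K))
        ((K + 5) * size log).+1
        ((x, false, b0), rtape l (map Some (flat log) ++ nseq d None))
        ((x, queue log q != [::], bit),
          rtape (map Some (rev pre) ++ l) (map Some post ++ nseq d None))
    & (queue log q != [::]) && bit = head false (queue log q)].
Proof.
move=> qK; elim: log b0 l => [|[b m] t IH] b0 l.
  move=> _; exists [::], [::], b0; split=> //.
  by apply: runs_leq (runs_while_stop _ _); rewrite //= /tcur /= head_nones.
case/andP=> /eqP sm wt.
have B := @runs_pop_block q K x b0 l b m (map Some (flat t) ++ nseq d None) qK sm.
rewrite -[flat (_ :: _)]/((b :: m) ++ flat t) map_cat -catA.
have -> : queue ((b, m) :: t) q = if nth false m q then b :: queue t q else queue t q.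
  by rewrite /queue /=; case: ifP.
case nq: (nth false m q) B => B.
  exists (b :: set_nth false m q false), (flat t), b; split.
  - by rewrite /= nq.
  - apply: runs_leq (runs_while_iter _ B (runs_while_stop _ _)) => //=; first lia.
    by rewrite andbF.
  - by [].
have [pre [post [bit [E R Q]]]] := IH b (map Some (rev (b :: m)) ++ l) wt.
exists (b :: m ++ pre), post, bit; split.
- by rewrite /= nq /flat /= -/(flat _) E catA.
- rewrite -cat_cons rev_cat map_cat -catA.
  by apply: runs_leq (runs_while_iter _ B R) => //=; lia.
- by [].
Qed.

Lemma runs_pop q K s L log c d : q < K -> log_wf K log ->
  exists d', runs (mpop q K) (8 * K.+2 * (size log).+1) (s, home L log c d)
    ((s.1.1, queue log q != [::], head false (queue log q)), home L (lpop q log) c d').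
Proof.
move=> qK wf; set l0 := map Some L ++ nseq c None.
have [pre [post [bit [E R Q]]]] := @runs_pop_loop q K s.1.1 false (None :: l0) log d qK wf.
(* Leaving a cell beyond the represented tape turns it into an explicit blank, so only the padding
   changes. *)
have [d' Ed'] : exists d', head None (map Some post ++ nseq d None) ::
    behead (map Some post ++ nseq d None) = map Some post ++ nseq d' None.
  case: (post) => [|a p]; last by exists d.
  by exists d.-1.+1; case: (d).
exists d'.
have szf : size (flat (lpop q log)) = K.+1 * size log.
  by rewrite (size_flat (log_wf_lpop qK wf)) size_lpop.
apply: (@runs_leq _ _ (1 + (((K + 5) * size log).+1 + (1 + (2 * size (rev pre)).+1)))).
  by move: szf; rewrite E size_cat size_rev; lia.
apply: (@runs_seq _ _ _ 1); first exact: runs_act_to.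
apply: runs_seq R _.
apply: (@runs_seq _ _ _ 1); first exact: runs_act_to.
rewrite /= Q Ed' -[(behead _, _, _)]/(ltape (map Some (rev pre) ++ None :: l0) _).
have := @runs_scanL (s.1.1, queue log q != [::], head false (queue log q))
  (None :: l0) (rev pre) (map Some post ++ nseq d' None) erefl.
by rewrite revK catA -map_cat -E.
Qed.

(** The unread input lies to the left of the head, so its first bit is in the leftmost cell; reading
    at the far end keeps the order of the word. *)
Definition mread : mach reg :=
  mseq goL (mif (fun _ a => isSome a)
    (mseq scanL (mseq goR
      (mseq (mact (fun s a => ((s.1.1, true, a == Some true), None, mvRight))) scanR)))
    (mact (fun s a => ((s.1.1, false, false), a, mvRight)))).

Lemma runs_read_nil s log c d : exists c',
  runs mread 3 (s, home [::] log c d) ((s.1.1, false, false), home [::] log c' d).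
Proof.
exists c.-1.+1; apply: (@runs_seq _ _ _ 1 2 _ _ _ (runs_goL _ _ _ _)).
apply: runs_if; rewrite /ltape /tcur /= head_nones /=.
by apply: runs_act; rewrite /= behead_nones.
Qed.

Lemma runs_read_rcons s L b log c d : exists c',
  runs mread (8 * (size L).+2) (s, home (rcons L b) log c d)
    ((s.1.1, true, b), home L log c' d).
Proof.
exists c.-1.+2; set R0 := map Some (flat log) ++ nseq d None.
apply: (@runs_leq _ _ (1 + ((2 * size (rcons L b)).+1 + (1 + (1 + (2 * size (rev L)).+1))).+1)).
  by rewrite size_rcons size_rev; lia.
apply: (@runs_seq _ _ _ 1 _ _ _ _ (runs_goL _ _ _ _)).
apply: runs_if; rewrite {1}/ltape /tcur /=.
have -> : head None (map Some (rcons L b) ++ nseq c None) = Some (head b L) by case: (L).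
apply: runs_seq; first exact: runs_scanL (head_nones c).
rewrite /ltape head_nones behead_nones.
apply: runs_seq (runs_goR _ _ _ _) _.
rewrite rev_rcons.
apply: (@runs_seq _ _ _ 1); first exact: runs_act_to.
rewrite /tcur /= (_ : (Some b == Some true) = b); last by case: b.
have := @runs_scanR (s.1.1, true, b) (nseq c.-1.+2 None) (rev L) (None :: R0) erefl.
by rewrite revK.
Qed.

Definition memit (f : reg -> bool) : mach reg :=
  mseq goL (mseq scanL (mseq (mact (fun s _ => (s, Some (f s), mvRight))) scanR)).

Lemma runs_emit f s L log c d : exists c',
  runs (memit f) (8 * (size L).+2) (s, home L log c d) (s, home (rcons L (f s)) log c' d).
Proof.
exists c.-1; set R0 := map Some (flat log) ++ nseq d None.
apply: (@runs_leq _ _ (1 + ((2 * size L).+1 + (1 + (2 * size (rev L)).+1)))).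
  by rewrite size_rev; lia.
apply: (@runs_seq _ _ _ 1 _ _ _ _ (runs_goL _ _ _ _)).
apply: runs_seq; first exact: runs_scanL (head_nones c).
apply: (@runs_seq _ _ _ 1); first exact: runs_act_to.
have := @runs_scanR s (Some (f s) :: nseq c.-1 None) (rev L) (None :: R0) erefl.
by rewrite revK /= behead_nones /home map_rcons cat_rcons.
Qed.

Definition mfinish : mach reg := mseq goL (mseq scanL goR).

Lemma runs_finish s L log c d : exists l,
  runs mfinish (8 * (size L).+2) (s, home L log c d)
   (s, rtape l (map Some (rev L) ++ None :: map Some (flat log) ++ nseq d None)).
Proof.
exists (None :: nseq c.-1 None).
apply: (@runs_leq _ _ (1 + ((2 * size L).+1 + 1))); first by lia.
apply: (@runs_seq _ _ _ 1 _ _ _ _ (runs_goL _ _ _ _)).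
apply: runs_seq; first exact: runs_scanL (head_nones c).
by rewrite /ltape head_nones behead_nones.
Qed.

End Ops.

(** * Queue programs *)

Definition poly_bounded (f : nat -> nat) := exists a d, forall n, f n <= a * n.+1 ^ d.

Lemma poly_bounded_leq f g : (forall n, f n <= g n) -> poly_bounded g -> poly_bounded f.
Proof. by move=> fg [a [d H]]; exists a, d => n; apply: leq_trans (fg n) (H n). Qed.

Lemma poly_bounded_cst c : poly_bounded (fun=> c).
Proof. by exists c, 0 => n; rewrite expn0 muln1. Qed.

Lemma poly_bounded_id : poly_bounded id.
Proof. by exists 1, 1 => n; rewrite expn1 mul1n. Qed.

Lemma poly_bounded_add f g : poly_bounded f -> poly_bounded g ->
  poly_bounded (fun n => f n + g n).
Proof.
move=> [a [d H]] [a' [d' H']]; exists (a + a'), (d + d') => n.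
rewrite mulnDl leq_add //.
  by apply: leq_trans (H n) _; rewrite leq_mul2l leq_pexp2l ?orbT //; lia.
by apply: leq_trans (H' n) _; rewrite leq_mul2l leq_pexp2l ?orbT //; lia.
Qed.

Lemma poly_bounded_mul f g : poly_bounded f -> poly_bounded g ->
  poly_bounded (fun n => f n * g n).
Proof.
move=> [a [d H]] [a' [d' H']]; exists (a * a'), (d + d') => n.
by rewrite expnD mulnACA leq_mul.
Qed.

Lemma poly_boundedP f : poly_bounded f -> exists c, forall n, f n <= c * n ^ c + c.
Proof.
(* For positive n one has (n+1)^d <= 2^d n^d, and the additive constant covers n = 0. *)
move=> [a [d H]]; exists (a * 2 ^ d + d) => n; apply: leq_trans (H n) _.
case: n => [|n].
  by rewrite exp1n muln1 addnC -addnA; apply: leq_trans (leq_addr _ _); rewrite leq_pmulr ?expn_gt0.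
apply: leq_trans (leq_addr _ _).
apply: (@leq_trans (a * 2 ^ d * n.+1 ^ d)).
  rewrite -mulnA -expnMn leq_mul2l; apply/orP; right.
  by case: (d) => // d'; rewrite leq_exp2r //; lia.
by apply: leq_mul; [exact: leq_addr|rewrite leq_pexp2l //; exact: leq_addl].
Qed.

(* Registers, queues, and the bits emitted so far.  [Pop q] reports in
   register 0 whether queue q was nonempty, and in register 1 its first bit.
   [Loop c] runs c as many times as the input has bits. *)
Inductive cmd :=
  | Set_ of nat & (seq bool -> bool)
  | App of seq nat & (seq bool -> bool)
  | Pop of nat
  | Emit of (seq bool -> bool)
  | Seq of cmd & cmd
  | If of (seq bool -> bool) & cmd & cmd
  | Loop of cmd.

Definition upd (f : nat -> seq bool) (q : nat) (v : seq bool) :=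
  fun i => if i == q then v else f i.

Definition qstate := (seq bool * (nat -> seq bool) * seq bool)%type.

Fixpoint sem (n : nat) (c : cmd) (x : qstate) : qstate :=
  let: (r, Q, o) := x in
  match c with
  | Set_ i e => (set_nth false r i (e r), Q, o)
  | App qs e => (r, fun i => if i \in qs then rcons (Q i) (e r) else Q i, o)
  | Pop q => (set_nth false (set_nth false r 0 (Q q != [::])) 1 (head false (Q q)),
              upd Q q (behead (Q q)), o)
  | Emit e => (r, Q, rcons o (e r))
  | Seq c1 c2 => sem n c2 (sem n c1 x)
  | If e c1 c2 => if e r then sem n c1 x else sem n c2 x
  | Loop c => iter n (sem n c) x
  end.

(** One number bounds both the tape operations and the cells added to log and output. Since the log
    never shrinks, the cost of an operation depends on its length, and both bounds are needed
    together. In a loop the constants 3 pay for the marker and for turning the counter. *)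
Fixpoint op_count (n : nat) (c : cmd) : nat :=
  match c with
  | Seq c1 c2 => op_count n c1 + op_count n c2
  | If e c1 c2 => (op_count n c1 + op_count n c2).+1
  | Loop c => 3 + n * (op_count n c + 3)
  | _ => 2
  end.

Fixpoint depth (c : cmd) : nat :=
  match c with
  | Seq c1 c2 | If _ c1 c2 => maxn (depth c1) (depth c2)
  | Loop c => (depth c).+1
  | _ => 0
  end.

Fixpoint cmd_wf (nr nq : nat) (c : cmd) : bool :=
  match c with
  | Set_ i _ => i < nr
  | App qs _ => all (fun q => q < nq) qs
  | Pop q => q < nq
  | Emit _ => true
  | Seq c1 c2 | If _ c1 c2 => cmd_wf nr nq c1 && cmd_wf nr nq c2
  | Loop c => cmd_wf nr nq c
  end.

Lemma op_count_poly c : poly_bounded (fun n => op_count n c).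
Proof.
elim: c => [i e|qs e|q|e|c1 H1 c2 H2|e c1 H1 c2 H2|c H] /=; try exact: poly_bounded_cst.
- exact: poly_bounded_add.
- apply: poly_bounded_leq (poly_bounded_add (poly_bounded_cst 1) (poly_bounded_add H1 H2)).
  by move=> n; rewrite add1n.
- apply: poly_bounded_add (poly_bounded_cst 3) _.
  apply: poly_bounded_mul poly_bounded_id _.
  exact: poly_bounded_add H (poly_bounded_cst 3).
Qed.

(** * Compilation of queue programs *)

Section Compile.
Variables (nr nq nc : nat).
Hypothesis nr_gt1 : 1 < nr.
Let K := nq + nc.
Let X := nr.-tuple bool.

Definition tset (s : X) (i : nat) (b : bool) : X := insubd s (set_nth false s i b).

Lemma val_tset s i b : i < nr -> val (tset s i b) = set_nth false (val s) i b.
Proof.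
move=> lt; rewrite val_insubd size_set_nth size_tuple (maxn_idPr lt) eqxx //.
Qed.

Definition mask (qs : seq nat) := mkseq (fun i => i \in qs) K.

(** A loop at nesting depth [d] owns the counter queue [nq + d], which holds one true bit per input
    bit. A false marker is appended and the bits are rotated, one run of the body each, until the
    marker is popped. The counter is then as before, so an inner loop can be started again. *)
Fixpoint comp (d : nat) (c : cmd) : mach (reg X) :=
  match c with
  | Set_ i e => mact (fun s a => ((tset s.1.1 i (e s.1.1), s.1.2, s.2), a, mvStay))
  | App qs e => mapp (fun s : reg X => e s.1.1 :: mask qs) K
  | Pop q => mseq (mpop _ q K)
      (mact (fun s a => ((tset (tset s.1.1 0 s.1.2) 1 s.2, s.1.2, s.2), a, mvStay)))
  | Emit e => memit (fun s : reg X => e s.1.1)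
  | Seq c1 c2 => mseq (comp d c1) (comp d c2)
  | If e c1 c2 => mif (fun (s : reg X) _ => e s.1.1) (comp d c1) (comp d c2)
  | Loop c =>
      mseq (mapp (fun _ => false :: mask [:: nq + d]) K)
      (mseq (mpop _ (nq + d) K)
        (mwhile (fun s _ => s.2)
          (mseq (mapp (fun _ => true :: mask [:: nq + d]) K)
          (mseq (comp d.+1 c) (mpop _ (nq + d) K)))))
  end.

Definition st_rep (s : reg X) (t : tape) (r : seq bool) (F : nat -> seq bool)
    (L : seq bool) (z : nat) : Prop :=
  exists log c d, [/\ t = home L log c d, val s.1.1 = r, log_wf K log,
    forall i, i < K -> queue log i = F i & size log + size L <= z].

Definition opcost (B : nat) := 8 * K.+2 * B.+2.

Lemma st_rep_ext s t r F G L z : (forall i, i < K -> F i = G i) ->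
  st_rep s t r F L z -> st_rep s t r G L z.
Proof.
move=> FG [log [c [d [? ? ? H ?]]]]; exists log, c, d; split=> // i iK.
by rewrite H // FG.
Qed.

Lemma st_rep_leq s t r F L z z' : z <= z' -> st_rep s t r F L z -> st_rep s t r F L z'.
Proof.
by move=> zz [log [c [d [? ? ? ? le]]]]; exists log, c, d; split=> //; apply: leq_trans le zz.
Qed.

Lemma step_app s t r F L z qs (e : reg X -> bool) B : st_rep s t r F L z -> z <= B ->
  exists t', runs (mapp (fun s => e s :: mask qs) K) (opcost B) (s, t) (s, t') /\
    st_rep s t' r (fun i => if i \in qs then rcons (F i) (e s) else F i) L z.+1.
Proof.
move=> [log [c [d [-> sr wf H le]]]] zB.
have [d' R] := @runs_app X (fun s => e s :: mask qs) K s L log c d (e s, mask qs) wf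
  erefl (size_mkseq _ _).
exists (home L (rcons log (e s, mask qs)) c d'); split.
  apply: runs_leq R; rewrite leq_mul2l; apply/orP; right.
  by move: le zB; lia.
exists (rcons log (e s, mask qs)), c, d'; split=> //.
- by rewrite /log_wf all_rcons /= size_mkseq eqxx.
- move=> i iK; rewrite queue_rcons /= nth_mkseq // H //.
  by case: (i \in qs); rewrite ?cats0 // cats1.
- by rewrite size_rcons addSn ltnS.
Qed.

Lemma step_pop s t r F L z q B : st_rep s t r F L z -> z <= B -> q < K ->
  exists t', runs (mpop X q K) (opcost B) (s, t) ((s.1.1, F q != [::], head false (F q)), t') /\
    st_rep (s.1.1, F q != [::], head false (F q)) t' r (upd F q (behead (F q))) L z.
Proof.
move=> [log [c [d [-> sr wf H le]]]] zB qK.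
have [d' R] := @runs_pop X q K s L log c d qK wf.
rewrite -H //; exists (home L (lpop q log) c d'); split.
  apply: runs_leq R; rewrite leq_mul2l; apply/orP; right.
  by move: le zB; lia.
exists (lpop q log), c, d'; split=> //.
- exact: log_wf_lpop.
- move=> i iK; rewrite queue_lpop /upd; case: eqP => // _; exact: H.
- by rewrite size_lpop.
Qed.

(** The invariant requires all counters from depth [d] on to be full and gives every counter back
    unchanged; [B] bounds the length of the log throughout, which makes the cost per operation
    uniform. *)
Lemma comp_ok n B c d s t r F Q L z :
  cmd_wf nr nq c -> depth c + d <= nc ->
  (forall l, d <= l < nc -> F (nq + l) = nseq n true) ->
  (forall i, i < nq -> F i = Q i) ->
  st_rep s t r F L z -> z + op_count n c <= B ->
  exists s' t', runs (comp d c) (op_count n c * opcost B) (s, t) (s', t') /\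
    let: (r', Q', L') := sem n c (r, Q, L) in
    st_rep s' t' r' (fun i => if i < nq then Q' i else F i) L' (z + op_count n c).
Proof.
have cpos : 0 < opcost B by rewrite /opcost muln_gt0.
elim: c d s t r F Q L z => [i e|qs e|q|e|c1 H1 c2 H2|e c1 H1 c2 H2|c IH] d s t r F Q L z /=.
- move=> wi _ _ FQ [log [c [dd [-> sr wf H le]]]] _.
  exists (tset s.1.1 i (e s.1.1), s.1.2, s.2), (home L log c dd); split.
    by apply: (@runs_leq _ _ 1); [lia|apply: runs_act].
  exists log, c, dd; split=> //; rewrite ?val_tset -?sr //; last by lia.
  by move=> j jK; rewrite H //; case: ifP => // /FQ.
- move=> wq _ _ FQ R zB.
  have [|t' [R' S']] := @step_app s t r F L z qs (fun s : reg X => e s.1.1) B R; first by lia.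
  exists s, t'; split; first by apply: runs_leq R'; lia.
  apply: st_rep_leq (st_rep_ext _ S'); first by lia.
  case: R => [log [c [dd [_ -> _ _ _]]]] i iK /=.
  case: (boolP (i \in qs)) => iq; last by case: ifP => // /FQ.
  by move/allP: wq => /(_ i iq) iq'; rewrite iq' FQ.
- move=> wq _ _ FQ R zB.
  have [||t' [R' S']] := @step_pop s t r F L z q B R; rewrite ?/K; try by lia.
  rewrite -!FQ //.
  exists (tset (tset s.1.1 0 (F q != [::])) 1 (head false (F q)), F q != [::], head false (F q)), t'.
  split.
    apply: (@runs_leq _ _ (opcost B + 1)); first by lia.
    by apply: runs_seq R' _; apply: runs_act; rewrite tmove_stay.
  case: S' => [log [c [dd [-> sr wf H le]]]].
  exists log, c, dd; split=> //; last by lia.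
    by rewrite !val_tset ?sr //; lia.
  move=> i iK; rewrite H // /upd; case: eqP => [->|_]; first by rewrite wq.
  by case: ifP => // /FQ.
- move=> _ _ _ FQ [log [c [dd [-> sr wf H le]]]] zB.
  have [c' R] := @runs_emit X (fun s : reg X => e s.1.1) s L log c dd.
  exists s, (home (rcons L (e r)) log c' dd); split.
    rewrite -sr; apply: runs_leq R; rewrite /opcost; nia.
  exists log, c', dd; split=> //; last by rewrite size_rcons; lia.
  by move=> i iK; rewrite H //; case: ifP => // /FQ.
- move=> /andP[w1 w2] dc FC FQ R zB.
  have [||s1 [t1 [R1 S1]]] := H1 d s t r F Q L z w1 _ FC FQ R; try by lia.
  case: (sem n c1 _) S1 => [[r1 Q1] L1] S1.
  have [||||s2 [t2 [R2 S2]]] := H2 d s1 t1 r1 _ Q1 L1 _ w2 _ _ _ S1; try by lia.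
  + by move=> l lc; rewrite ltnNge leq_addr /= FC.
  + by move=> i ->.
  exists s2, t2; split; first by rewrite mulnDl; apply: runs_seq R1 R2.
  case: (sem n c2 _) S2 => [[r2 Q2] L2] S2; rewrite addnA.
  by apply: st_rep_ext S2 => i iK; case: ifP => h; rewrite ?h.
- move=> /andP[w1 w2] dc FC FQ R zB.
  have er : val s.1.1 = r by case: R => [log [c [dd []]]].
  case er' : (e r).
    have [||s1 [t1 [R1 S1]]] := H1 d s t r F Q L z w1 _ FC FQ R; try by lia.
    exists s1, t1; split.
      apply: (@runs_leq _ _ (op_count n c1 * opcost B).+1); first by nia.
      by apply: runs_if => /=; rewrite er er'.
    by case: (sem n c1 _) S1 => [[r1 Q1] L1]; apply: st_rep_leq; lia.
  have [||s1 [t1 [R1 S1]]] := H2 d s t r F Q L z w2 _ FC FQ R; try by lia.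
  exists s1, t1; split.
    apply: (@runs_leq _ _ (op_count n c2 * opcost B).+1); first by nia.
    by apply: runs_if => /=; rewrite er er'.
  by case: (sem n c2 _) S1 => [[r1 Q1] L1]; apply: st_rep_leq; lia.
move=> wc dc FC FQ R zB.
set k := nq + d.
have kK : k < K by rewrite /k /K; lia.
(* The counter with [j] turns to go. Its first bit has already been popped into the register, so the
   tape holds [behead (C j)]. *)
pose C j := nseq j true ++ false :: nseq (n - j) true.
have loop j : forall s t r F' Q L z, j <= n ->
    F' k = behead (C j) -> s.2 = (0 < j) ->
    (forall i, i < nq -> F' i = Q i) ->
    (forall i, i < K -> nq <= i -> i != k -> F' i = F i) ->
    st_rep s t r F' L z -> z + j * (op_count n c + 3) <= B ->
    exists s' t', runs (mwhile (fun s _ => s.2)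
          (mseq (mapp (fun _ => true :: mask [:: k]) K)
          (mseq (comp d.+1 c) (mpop _ k K)))) (j * (op_count n c + 3) * opcost B).+1 (s, t) (s', t') /\
    let: (r', Q', L') := iter j (sem n c) (r, Q, L) in
    st_rep s' t' r' (fun i => if i < nq then Q' i else F i) L' (z + j * (op_count n c + 3)).
  elim: j => [|j IHj] {zB R} s1 t1 r1 F' Q1 L1 z1 jn Fk s2 FQ1 FF R zB.
    exists s1, t1; split; first by apply: runs_while_stop; rewrite /= s2.
    apply: st_rep_leq (st_rep_ext _ R); first by lia.
    move=> i iK; case: ltnP => [/FQ1 //|ni].
    have [->|ik] := eqVneq i k; last exact: FF.
    by rewrite Fk /C /= subn0 FC //; lia.
  have [|t2 [R2 S2]] := @step_app s1 t1 r1 F' L1 z1 [:: k] (fun=> true) B R; first by lia.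
  have [||||s3 [t3 [R3 S3]]] := IH d.+1 s1 t2 r1 _ Q1 L1 _ wc _ _ _ S2.
  + by lia.
  + move=> l ld; rewrite inE ifF; last by apply/negbTE/eqP; rewrite /k; lia.
    rewrite FF ?FC //; rewrite /k /K; try lia.
  + by move=> i ni; rewrite inE ifF ?FQ1 //; apply/negbTE/eqP; rewrite /k; lia.
  + by move: zB; rewrite mulSn; lia.
  rewrite iterSr.
  case: (sem n c _) S3 => [[r3 Q3] L3] S3.
  have [|t4 [R4 S4]] := @step_pop s3 t3 r3 _ L3 _ k B S3 _ kK.
    by move: zB; rewrite mulSn; lia.
  have nk : (k < nq) = false by rewrite /k; lia.
  move: R4 S4; rewrite nk inE eqxx Fk.
  have -> : rcons (behead (C j.+1)) true = C j.
    rewrite /C /= -cats1 -catA /= cats1 -[rcons _ _]/(rcons _ (nth true [:: true] 0)).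
    congr (_ ++ _ :: _); rewrite (_ : n - j = (n - j.+1).+1); last by lia.
    by elim: (n - j.+1) => //= m <-.
  have -> : head false (C j) = (0 < j) by rewrite /C; case: (j).
  move=> R4 S4.
  have [||||||s5 [t5 [R5 S5]]] := IHj _ _ _ _ Q3 _ _ _ _ _ _ _ S4.
  + by lia.
  + by rewrite /upd eqxx.
  + by [].
  + by move=> i ni; rewrite /upd ifF ?ni //; apply/negbTE/eqP; rewrite /k; lia.
  + move=> i iK ni ik; rewrite /upd (negbTE ik) ltnNge ni /= inE (negbTE ik); exact: FF.
  + by move: zB; rewrite mulSn; lia.
  exists s5, t5; split.
    apply: runs_leq (runs_while_iter _ (runs_seq R2 (runs_seq R3 R4)) R5); last by rewrite /= s2.
    rewrite mulSn !mulnDl; lia.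
  case: (iter j _ _) S5 => [[r5 Q5] L5]; apply: st_rep_leq; rewrite mulSn; lia.
have [|t1 [R1 S1]] := @step_app s t r F L z [:: k] (fun=> false) B R; first by lia.
have [|t2 [R2 S2]] := @step_pop s t1 r _ L _ k B S1 _ kK; first by lia.
move: R2 S2; rewrite inE eqxx FC; last by lia.
have -> : rcons (nseq n true) false = C n by rewrite /C subnn cats1.
have -> : head false (C n) = (0 < n) by rewrite /C; case: (n).
move=> R2 S2.
have [||||||s3 [t3 [R3 S3]]] := loop n _ _ _ _ Q _ _ _ _ _ _ _ S2.
- by [].
- by rewrite /upd eqxx.
- by [].
- move=> i ni; have ik : (i == k) = false by apply/negbTE/eqP; rewrite /k; lia.
  by rewrite /upd inE ik FQ.
- by move=> i iK ni ik; rewrite /upd inE (negbTE ik).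
- by lia.
exists s3, t3; split.
  by apply: runs_leq (runs_seq R1 (runs_seq R2 R3)); rewrite mulnDl; lia.
by case: (iter n _ _) S3 => [[r5 Q5] L5]; apply: st_rep_leq; lia.
Qed.

(** Each input bit adds one block to queue 0 and one true block shared by all counters; this is how
    a loop comes to run as often as the input has bits. *)
Definition mload : mach (reg X) :=
  mseq (scanR _) (mseq (mread _) (mwhile (fun s _ => s.1.2)
    (mseq (mapp (fun s => s.2 :: mask [:: 0]) K)
    (mseq (mapp (fun _ => true :: mask (iota nq nc)) K) (mread _))))).

Definition loaded (w : seq bool) (i : nat) : seq bool :=
  if i == 0 then w else if nq <= i < nq + nc then nseq (size w) true else [::].

Lemma loaded_rcons w b i : 0 < nq -> loaded (rcons w b) i =
  if i == 0 then rcons (loaded w i) b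
  else if i \in iota nq nc then rcons (loaded w i) true else loaded w i.
Proof.
move=> nq0; rewrite /loaded mem_iota size_rcons; case: eqP => // _; case: ifP => // _.
by elim: (size w) => //= m <-.
Qed.

Lemma rep_read s L log c d F z v : val s.1.1 = nseq nr false ->
  L = rev v -> log_wf K log -> (forall i, i < K -> queue log i = F i) -> size log <= z ->
  exists t', runs (mread X) (8 * (size v).+3) (s, home L log c d)
     ((s.1.1, v != [::], head false v), t') /\
    exists c', t' = home (rev (behead v)) log c' d.
Proof.
move=> sv -> wf H le; case: v => [|b v] /=.
  have [c' R] := runs_read_nil s log c d.
  by exists (home [::] log c' d); split; [apply: runs_leq R; lia|exists c'].
rewrite rev_cons; have [c' R] := runs_read_rcons s (rev v) b log c d.
exists (home (rev v) log c' d); split; last by exists c'.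
by apply: runs_leq R; rewrite size_rev; lia.
Qed.

Definition load_time n := (2 * n).+1 + (8 * n.+3 + (n * (2 * opcost (2 * n) + 8 * n.+3 + 1)).+1).

Lemma runs_load w s : 0 < nq -> val s.1.1 = nseq nr false -> exists s' t',
  runs mload (load_time (size w)) (s, rtape [::] (map Some w)) (s', t') /\
  st_rep s' t' (nseq nr false) (loaded w) [::] (2 * size w).
Proof.
move=> nq0 sv; set n := size w.
have loop v : forall u s log c d, w = u ++ v -> val s.1.1 = nseq nr false ->
   s.1.2 = (v != [::]) -> s.2 = head false v -> log_wf K log ->
   (forall i, i < K -> queue log i = loaded u i) -> size log <= 2 * size u ->
   exists s' t', runs (mwhile (fun s _ => s.1.2)
    (mseq (mapp (fun s => s.2 :: mask [:: 0]) K)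
    (mseq (mapp (fun _ => true :: mask (iota nq nc)) K) (mread _))))
      (size v * (2 * opcost (2 * n) + 8 * n.+3 + 1)).+1
      (s, home (rev (behead v)) log c d) (s', t') /\
    st_rep s' t' (nseq nr false) (loaded w) [::] (2 * n).
  elim: v => [|b v IH] u s1 log c d wE sv1 s2 s3 wf H sz.
    exists s1, (home [::] log c d); split; first by apply: runs_while_stop; rewrite /= s2.
    exists log, c, d; split=> //; last by rewrite addn0 /n wE cats0.
    by rewrite wE cats0.
  have nE : n = size u + (size v).+1 by rewrite /n wE size_cat.
  have S0 : st_rep s1 (home (rev v) log c d) (nseq nr false) (loaded u) (rev v) (2 * size u + size v).
    by exists log, c, d; split=> //; rewrite size_rev leq_add2r.
  have [|t1 [R1 S1]] := @step_app s1 _ _ _ _ _ [:: 0] (fun s => s.2) (2 * n) S0; first by lia.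
  have [|t2 [R2 S2]] := @step_app s1 _ _ _ _ _ (iota nq nc) (fun=> true) (2 * n) S1; first by lia.
  case: S2 R2 => [log2 [c2 [d2 [-> _ wf2 H2 le2]]]] R2.
  have [t3 [R3 [c3 E3]]] := @rep_read s1 (rev v) log2 c2 d2 _ (size log2) v sv1 erefl wf2 H2 (leqnn _).
  have szl : size log2 <= 2 * size (rcons u b).
    by move: le2; rewrite size_rev size_rcons; lia.
  have [|||||||s4 [t4 [R4 S4]]] := IH (rcons u b) (s1.1.1, v != [::], head false v) log2 c3 d2.
  - by rewrite wE cat_rcons.
  - by [].
  - by [].
  - by [].
  - by [].
  - move=> i iK; rewrite H2 // loaded_rcons // inE s3.
    case: eqP => [->|_]; last by case: ifP.
    by rewrite mem_iota leqNgt nq0.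
  - exact: szl.
  exists s4, t4; split=> //.
  apply: runs_leq (runs_while_iter _ (runs_seq R1 (runs_seq R2 R3)) _); last first.
  - rewrite E3; exact: R4.
  - by rewrite /= s2.
  - by rewrite /=; lia.
have S0 := @runs_scanR X s [::] w [::] erefl; rewrite !cats0 in S0.
have H0 : runs (scanR X) (2 * n).+1 (s, rtape [::] (map Some w)) (s, home (rev w) [::] 0 0).
  by rewrite /home /= cats0.
have [t1 [R1 [c1 E1]]] := @rep_read s (rev w) [::] 0 0 (fun=> [::]) 0 w sv erefl erefl
  (fun _ _ => erefl) (leqnn 0).
have [|s2 [t2 [R2 S2]]] := loop w [::] (s.1.1, w != [::], head false w) [::] c1 0
  erefl sv erefl erefl erefl _ erefl.
  by move=> i iK; rewrite /loaded /=; case: eqP => // _; case: ifP.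
exists s2, t2; split=> //.
by apply: runs_seq H0 _; apply: runs_seq R1 _; rewrite E1.
Qed.

Definition mprog (c : cmd) : mach (reg X) := mseq mload (mseq (comp 0 c) (mfinish _)).

Definition prog_time (c : cmd) n :=
  load_time n + (op_count n c * opcost (2 * n + op_count n c) + 8 * (2 * n + op_count n c).+2).

(** Emission extends the left end of the tape whereas the output is read from left to right, which
    accounts for [rev]. For questions this is only a renaming. *)
Lemma runs_prog c w s : 0 < nq -> val s.1.1 = nseq nr false -> cmd_wf nr nq c -> depth c <= nc ->
  exists s' l u,
  runs (mprog c) (prog_time c (size w)) (s, rtape [::] (map Some w)) (s', rtape l u) /\
  read_word u =
    rev (sem (size w) c (nseq nr false, fun i => if i == 0 then w else [::], [::])).2.
Proof.
move=> nq0 sv wf dc; set n := size w.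
have [s1 [t1 [R1 S1]]] := runs_load w nq0 sv.
have [|||s2 [t2 [R2]]] := @comp_ok n (2 * n + op_count n c) c 0 s1 t1 _ _
   (fun i => if i == 0 then w else [::]) _ _ wf _ _ _ S1 (leqnn _).
- by rewrite addn0.
- move=> l lc; rewrite /loaded ifF; last by apply/negbTE/eqP; lia.
  by rewrite ifT //; lia.
- by move=> i ni; rewrite /loaded leqNgt ni.
case: (sem n c _) => [[r Q] L] [log [c2 [d2 [E sr wl H le]]]] /=; rewrite E in R2.
have [l R3] := runs_finish s2 L log c2 d2.
exists s2, l, (map Some (rev L) ++ None :: map Some (flat log) ++ nseq d2 None); split.
  apply: runs_seq R1 _; apply: runs_leq (runs_seq R2 R3).
  by rewrite leq_add2l leq_mul2l; lia.
by elim: (rev L) => //= a u ->.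
Qed.

Lemma prog_time_poly c : poly_bounded (prog_time c).
Proof.
have PS f : poly_bounded f -> poly_bounded (fun n => (f n).+1).
  move=> H; apply: poly_bounded_leq (poly_bounded_add H (poly_bounded_cst 1)) => n.
  by rewrite addn1.
have P1 := poly_bounded_id.
have P2 a f : poly_bounded f -> poly_bounded (fun n => a * f n).
  by move=> H; apply: poly_bounded_mul (poly_bounded_cst a) H.
have Pc f : poly_bounded f -> poly_bounded (fun n => opcost (f n)).
  by move=> H; apply: (P2); do 2 apply: (PS).
have Po := op_count_poly c.
apply: poly_bounded_add.
  apply: poly_bounded_add; first by apply: (PS); apply: (P2).
  apply: poly_bounded_add; first by apply: (P2); do 3 apply: (PS).
  apply: (PS); apply: poly_bounded_mul => //.
  apply: poly_bounded_add; last exact: poly_bounded_cst.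
  apply: poly_bounded_add; first by apply: (P2); apply: (Pc); apply: (P2).
  by apply: (P2); do 3 apply: (PS).
apply: poly_bounded_add.
  by apply: poly_bounded_mul => //; apply: (Pc); apply: poly_bounded_add => //; apply: (P2).
by apply: (P2); do 2 apply: (PS); apply: poly_bounded_add => //; apply: (P2).
Qed.

End Compile.

Lemma cmd_ptm nr nq c : 1 < nr -> 0 < nq -> cmd_wf nr nq c ->
  exists P : ptm, forall w, ptm_eval P w =
    rev (sem (size w) c (nseq nr false, fun i => if i == 0 then w else [::], [::])).2.
Proof.
move=> nr1 nq0 wf.
pose M := mprog nr nq (depth c) c.
pose s0 : reg (nr.-tuple bool) := ([tuple of nseq nr false], false, false).
have [k Hk] := poly_boundedP (prog_time_poly nq (depth c) c).
have H w : halted (run (tm_of s0 M) (k * size w ^ k + k) w) /\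
    output (run (tm_of s0 M) (k * size w ^ k + k) w) =
    rev (sem (size w) c (nseq nr false, fun i => if i == 0 then w else [::], [::])).2.
  have [s' [l [u [R <-]]]] := @runs_prog nr nq (depth c) nr1 c w s0 nq0 erefl wf (leqnn _).
  have R' : runs M (k * size w ^ k + k)
      (s0, config_tape (init_config (tm_of s0 M) w)) (s', rtape l u).
    by apply: runs_leq (Hk _) _; case: (w) R.
  have [-> E] := tm_of_run R'.
  split=> //; rewrite /output; case: E => _ -> ->.
  by case: (u).
exists (@mkPtm (tm_of s0 M) k (fun w => proj1 (H w))) => w.
by case: (H w).
Qed.

(** * A library of queue subroutines *)

Lemma sem_seq n c1 c2 x : sem n (Seq c1 c2) x = sem n c2 (sem n c1 x).
Proof. by case: x => [[]]. Qed.

Lemma sem_loop n c x : sem n (Loop c) x = iter n (sem n c) x.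
Proof. by case: x => [[]]. Qed.

Lemma sem_ifT n (e : seq bool -> bool) c1 c2 r Q o : e r ->
  sem n (If e c1 c2) (r, Q, o) = sem n c1 (r, Q, o).
Proof. by move=> /= ->. Qed.

Lemma sem_ifF n (e : seq bool -> bool) c1 c2 r Q o : ~~ e r ->
  sem n (If e c1 c2) (r, Q, o) = sem n c2 (r, Q, o).
Proof. by move=> /= /negbTE->. Qed.

Definition Skip := App [::] (fun=> false).

Lemma sem_skip n x : sem n Skip x = x.
Proof. by case: x => [[]]. Qed.

Notation "c1 ;; c2" := (Seq c1 c2) (at level 60, right associativity).
Notation rg i := (fun r : seq bool => nth false r i).

Lemma upd_same Q q v : upd Q q v q = v.
Proof. by rewrite /upd eqxx. Qed.

Definition appq (Q : nat -> seq bool) (ds : seq nat) (v : seq bool) :=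
  fun i => if i \in ds then Q i ++ v else Q i.

Definition Clean := Set_ 0 (fun=> false) ;; Set_ 1 (fun=> false) ;; Set_ 2 (fun=> false) ;;
  Set_ 3 (fun=> false) ;; Set_ 4 (fun=> false).

Notation clean rest := [:: false, false, false, false, false & rest].

Lemma sem_clean n a b c d e rest Q o :
  sem n Clean ([:: a, b, c, d, e & rest], Q, o) = (clean rest, Q, o).
Proof. by []. Qed.

Lemma sem_pop n q a b rest Q o : sem n (Pop q) ([:: a, b & rest], Q, o) =
  ([:: Q q != [::], head false (Q q) & rest], upd Q q (behead (Q q)), o).
Proof. by []. Qed.

(** Decodes the first component of an [enc_list]. It is total because it is also applied to coin
    strings: a truncated code simply ends the component. *)
Fixpoint split1 (s : seq bool) : seq bool * seq bool :=
  match s with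
  | true :: b :: s' => let: (u, v) := split1 s' in (b :: u, v)
  | false :: _ :: s' => ([::], s')
  | _ => ([::], [::])
  end.

Definition split_body q ds :=
  If (rg 3) Skip
    (Pop q ;; If (rg 0)
       (If (rg 1) (Pop q ;; If (rg 0) (App ds (rg 1)) Skip)
                  (Pop q ;; Set_ 3 (fun=> true)))
       (Set_ 3 (fun=> true))).

Definition Unpack q ds := Set_ 3 (fun=> false) ;; Loop (split_body q ds) ;; Clean.

Lemma split_loop_done n m (q : nat) (ds : seq nat) a b c e rest Q o :
  iter m (sem n (split_body q ds)) ([:: a, b, c, true, e & rest], Q, o) =
  ([:: a, b, c, true, e & rest], Q, o).
Proof. by elim: m => //= m ->. Qed.

(** A pass consumes two cells, whence the bound [2 * m]; once the terminator or the end is met,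
    register 3 freezes the remaining passes. *)
Lemma split_loop n m (q : nat) (ds : seq nat) s a b c e rest Q o : q \notin ds -> Q q = s -> size s <= 2 * m ->
  exists a' b' d', iter m (sem n (split_body q ds)) ([:: a, b, c, false, e & rest], Q, o) =
  ([:: a', b', c, d', e & rest], appq (upd Q q (split1 s).2) ds (split1 s).1, o).
Proof.
move=> qds; elim: m s a b Q => [|m IH] s a b Q Qq ms.
  exists a, b, false; congr (_, _, _); apply: funext => i; rewrite /appq /upd.
  by case: s Qq ms => // Qq _; rewrite cats0 if_same; case: eqP => // ->.
rewrite iterSr; set f := iter m _; rewrite /=.
have E Q' u v : Q' q = u -> (forall i, i != q -> Q' i = if i \in ds then Q i ++ v else Q i) ->
   Q' = appq (upd Q q u) ds v.
  move=> E1 E2; apply: funext => i; rewrite /appq /upd.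
  case: (eqVneq i q) => [->|iq]; first by rewrite (negbTE qds).
  exact: E2.
case: s Qq ms => [|x [|y s]] Qq ms; rewrite Qq /=.
- rewrite /f split_loop_done; exists false, false, true; congr (_, _, _).
  apply: E; first by rewrite /upd eqxx.
  by move=> i iq; rewrite /upd (negbTE iq) cats0 if_same.
- case: x Qq ms => Qq ms /=; rewrite /upd eqxx /=.
    rewrite /f; have [||a' [b' [d' ->]]] := IH [::] false false
      (fun i => if i == q then [::] else if i == q then [::] else Q i); first by rewrite eqxx.
      by move: ms => /=; lia.
    exists a', b', d'; congr (_, _, _); apply: E.
      by rewrite /appq /upd eqxx (negbTE qds).
    by move=> i iq; rewrite /appq /upd /= (negbTE iq) /=.
  rewrite /f split_loop_done; exists false, false, true; congr (_, _, _).
  apply: E; first by rewrite eqxx.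
  by move=> i iq; rewrite (negbTE iq) cats0 if_same.
- case: x Qq ms => Qq ms /=; rewrite /upd eqxx /=.
    set Q1 := (X in f (_, X, _)).
    rewrite /f; have [||a' [b' [d' ->]]] := IH s true y Q1.
    + by rewrite /Q1 (negbTE qds) eqxx.
    + by move: ms => /=; lia.
    case: (split1 s) => u v; exists a', b', d'; congr (_, _, _); apply: E.
      by rewrite /appq /upd eqxx (negbTE qds).
    move=> i iq; rewrite /appq /upd /Q1 /= (negbTE iq) /=.
    by case: (i \in ds) => //; rewrite -cats1 -catA.
  rewrite /f split_loop_done; exists true, y, true; congr (_, _, _).
  apply: E; first by rewrite eqxx.
  by move=> i iq; rewrite (negbTE iq) cats0 if_same.
Qed.

Lemma sem_unpack n (q : nat) (ds : seq nat) rest Q o : q \notin ds -> size (Q q) <= 2 * n ->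
  sem n (Unpack q ds) (clean rest, Q, o) =
  (clean rest, appq (upd Q q (split1 (Q q)).2) ds (split1 (Q q)).1, o).
Proof.
move=> qds sz; rewrite /Unpack !sem_seq sem_loop.
rewrite [sem n (Set_ _ _) _]/=.
have [a [b [d ->]]] := @split_loop n n q ds (Q q) false false false false rest Q o qds erefl sz.
exact: sem_clean.
Qed.

Definition Clear q := Loop (Pop q) ;; Clean.

Lemma sem_clear n q a b c d e rest Q o : size (Q q) <= n ->
  sem n (Clear q) ([:: a, b, c, d, e & rest], Q, o) = (clean rest, upd Q q [::], o).
Proof.
move=> sz; rewrite sem_seq sem_loop.
have H m : forall a b Q, size (Q q) <= m -> exists a' b',
    iter m (sem n (Pop q)) ([:: a, b, c, d, e & rest], Q, o) =
    ([:: a', b', c, d, e & rest], upd Q q [::], o).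
  elim: m => [|m IH] {sz Q} {}a {}b Q sz.
    exists a, b; congr (_, _, _); apply: funext => i; rewrite /upd.
    by case: eqP => // ->; case: (Q q) sz.
  rewrite iterSr; set f := iter m _; rewrite /= /f; set Q1 := upd _ _ _.
  have [|a' [b' ->]] := IH (Q q != [::]) (head false (Q q)) Q1.
    by rewrite /Q1 /upd eqxx size_behead; move: sz; case: (size _).
  exists a', b'; congr (_, _, _); apply: funext => i; rewrite /Q1 /upd.
  by case: eqP.
by have [a' [b' ->]] := H n a b Q sz; exact: sem_clean.
Qed.

Definition Move q ds := Loop (Pop q ;; If (rg 0) (App ds (rg 1)) Skip) ;; Clean.

Lemma sem_move n (q : nat) (ds : seq nat) rest Q o : q \notin ds -> size (Q q) <= n ->
  sem n (Move q ds) (clean rest, Q, o) = (clean rest, appq (upd Q q [::]) ds (Q q), o).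
Proof.
move=> qds sz; rewrite sem_seq sem_loop; set body := (X in iter n (sem n X)).
have H m : forall a b Q, size (Q q) <= m -> exists a' b',
    iter m (sem n body) ([:: a, b, false, false, false & rest], Q, o) =
    ([:: a', b', false, false, false & rest], appq (upd Q q [::]) ds (Q q), o).
  elim: m => [|m IH] {sz Q} a b Q sz.
    exists a, b; congr (_, _, _); apply: funext => i; rewrite /appq /upd.
    case Qq : (Q q) sz => // _; rewrite cats0 if_same.
    by case: (eqVneq i q) => // ->.
  rewrite iterSr; set x := (X in iter m _ X).
  have [Q1 [a1 [b1 [-> E1 E2]]]] : exists Q1 a1 b1,
      [/\ x = ([:: a1, b1, false, false, false & rest], Q1, o), Q1 q = behead (Q q) &
        forall i, i != q -> Q1 i = if i \in ds then Q i ++ take 1 (Q q) else Q i].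
    rewrite /x /=; case Qq: (Q q) => [|y s] /=.
      exists (upd Q q [::]), false, false; split=> //; first by rewrite /upd eqxx.
      by move=> i iq; rewrite /upd (negbTE iq) cats0 if_same.
    exists (fun i => if i \in ds then rcons (upd Q q s i) y else upd Q q s i), true, y.
    split=> //; first by rewrite (negbTE qds) /upd eqxx.
    by move=> i iq; rewrite /upd (negbTE iq) take0 cats1.
  have [|a' [b' ->]] := IH a1 b1 Q1; first by rewrite E1 size_behead; move: sz; case: (size _).
  exists a', b'; congr (_, _, _); apply: funext => i; rewrite /appq /upd E1.
  case: (eqVneq i q) => [->|iq]; first by rewrite (negbTE qds).
  rewrite E2 //; case: (i \in ds) => //; rewrite -catA; congr (_ ++ _).
  by case: (Q q) => //= y s; rewrite take0.
by have [a' [b' ->]] := H n false false Q sz; exact: sem_clean.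
Qed.

(* Keeps every other element; [b] tells whether the first one is dropped. *)
Fixpoint alt (b : bool) (s : seq bool) : seq bool :=
  if s is x :: s' then (if b then alt false s' else x :: alt true s') else [::].

Lemma nth_alt b s k : nth false (alt b s) k = nth false s (b + 2 * k).
Proof.
elim: s b k => [|x s IH] b k; first by rewrite !nth_nil.
case: b => /=; first by rewrite IH.
by case: k => [|k] //; rewrite mulnS /= IH.
Qed.

Lemma size_alt b s : size (alt b s) <= size s.
Proof. by elim: s b => [|x s IH] [] //=; [apply: leqW|rewrite ltnS]; apply: IH. Qed.

Definition Filter q d := Loop (Pop q ;; If (rg 0)
   (If (rg 2) Skip (App [:: d] (rg 1)) ;; Set_ 2 (fun r => ~~ nth false r 2)) Skip) ;; Clean.

Lemma sem_filter n q d a b c rest Q o : q != d -> size (Q q) <= n ->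
  sem n (Filter q d) ([:: a, b, c, false, false & rest], Q, o) =
  (clean rest, upd (upd Q q [::]) d (Q d ++ alt c (Q q)), o).
Proof.
move=> qd sz; rewrite sem_seq sem_loop; set body := (X in iter n (sem n X)).
have dq : (d == q) = false by rewrite eq_sym (negbTE qd).
have H m : forall a b c Q, size (Q q) <= m -> exists a' b' c',
    iter m (sem n body) ([:: a, b, c, false, false & rest], Q, o) =
    ([:: a', b', c', false, false & rest], upd (upd Q q [::]) d (Q d ++ alt c (Q q)), o).
  elim: m => [|m IH] {sz Q} {}a {}b {}c Q sz.
    exists a, b, c; congr (_, _, _); apply: funext => i; rewrite /upd.
    case Qq : (Q q) sz => // _; rewrite cats0.
    by case: (eqVneq i d) => [->|_] //; case: (eqVneq i q) => [->|].
  rewrite iterSr; set x := (X in iter m _ X).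
  have [Q1 [a1 [b1 [c1 [-> E1 E2 E3]]]]] : exists Q1 a1 b1 c1,
      [/\ x = ([:: a1, b1, c1, false, false & rest], Q1, o), Q1 q = behead (Q q),
        Q1 d ++ alt c1 (behead (Q q)) = Q d ++ alt c (Q q) &
        forall i, i != q -> i != d -> Q1 i = Q i].
    rewrite /x /=; case Qq: (Q q) => [|y s] /=.
      exists (upd Q q [::]), false, false, c; split=> //; rewrite /upd ?eqxx ?dq //.
      by move=> i /negbTE->.
    case: (c) => /=.
      exists (upd Q q s), true, y, false; split=> //; rewrite /upd ?eqxx ?dq //.
      by move=> i /negbTE->.
    exists (fun i => if i \in [:: d] then rcons (upd Q q s i) y else upd Q q s i), true, y, true.
    split=> //.
    - by rewrite inE (negbTE qd) /upd eqxx.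
    - by rewrite inE eqxx /upd dq -cats1 -catA.
    - by move=> i /negbTE iq /negbTE id; rewrite inE id /upd iq.
  have [|a' [b' [c' ->]]] := IH a1 b1 c1 Q1; first by rewrite E1 size_behead; move: sz; case: (size _).
  exists a', b', c'; congr (_, _, _); apply: funext => i; rewrite /upd E1 E2.
  case: (eqVneq i d) => // id; case: (eqVneq i q) => // iq.
  exact: E3.
by have [a' [b' [c' ->]]] := H n a b c Q sz; exact: sem_clean.
Qed.

Definition sel (idx s : seq bool) := foldl (fun s b => alt b s) s idx.

Lemma size_sel idx s : size (sel idx s) <= size s.
Proof.
elim: idx s => [//|b idx IH] s /=.
exact: leq_trans (IH _) (size_alt _ _).
Qed.

Lemma num_cons b s : num_of_bits (b :: s) = b + 2 * num_of_bits s.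
Proof.
rewrite /num_of_bits big_ord_recl /= expn0 muln1; congr (_ + _).
by rewrite big_distrr /=; apply: eq_bigr => i _; rewrite expnS mulnCA.
Qed.

Lemma num_nil : num_of_bits [::] = 0.
Proof. by rewrite /num_of_bits big_ord0. Qed.

Lemma head_sel idx s : head false (sel idx s) = nth false s (num_of_bits idx).
Proof.
elim: idx s => [|b idx IH] s /=; first by rewrite num_nil nth0.
by rewrite IH nth_alt num_cons.
Qed.

(* Lookup by repeated halving: T starts as a copy of V and is thinned out
   according to the bits of the index A, least significant first. *)
Definition Nth V V' T U A :=
  Move V [:: V'; T] ;; Move V' [:: V] ;;
  Loop (Pop A ;; If (rg 0) (Set_ 2 (rg 1) ;; Filter T U ;; Move U [:: T]) Skip) ;;
  Pop T ;; Set_ 5 (rg 1) ;; Clear T.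

Lemma sem_nth n V V' T U A v rest Q o :
  uniq [:: V; V'; T; U; A] -> Q V' = [::] -> Q T = [::] -> Q U = [::] ->
  size (Q V) <= n -> size (Q A) <= n ->
  sem n (Nth V V' T U A) (clean (v :: rest), Q, o) =
  (clean (nth false (Q V) (num_of_bits (Q A)) :: rest), upd Q A [::], o).
Proof.
move=> U5 QV' QT QU sV sA.
have [[[n1 n2] [n3 n4]] [[n5 n6] [n7 [n8 [n9 n10]]]]] :
  ((((V == V') = false) * ((V == T) = false)) * (((V == U) = false) * ((V == A) = false))) *
  ((((V' == T) = false) * ((V' == U) = false)) * (((V' == A) = false) * (((T == U) = false) *
   (((T == A) = false) * ((U == A) = false))))).
  move: U5; rewrite /= !inE !negb_or.
  by case/and5P=> /and4P[/negbTE-> /negbTE-> /negbTE-> /negbTE->]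
    /and3P[/negbTE-> /negbTE-> /negbTE->] /andP[/negbTE-> /negbTE->] /negbTE->.
have m1 := (n1, n2, n3, n4, n5, n6, n7, n8, n9, n10).
have m2 : ((V' == V) = false) * ((T == V) = false) * ((U == V) = false) * ((A == V) = false) *
   ((T == V') = false) * ((U == V') = false) * ((A == V') = false) * ((U == T) = false) *
   ((A == T) = false) * ((A == U) = false) by do !split; rewrite eq_sym m1.
rewrite /Nth; do 5 rewrite sem_seq.
rewrite sem_move ?inE ?m1 //.
rewrite sem_move ?inE ?m2 //; last by rewrite /appq /upd !inE eqxx ?m2 QV'.
set Q1 := appq _ _ _.
have E1 : Q1 = upd Q T (Q V).
  apply: funext => i; rewrite /Q1 /appq /upd !inE eqxx m2 QV' /=.
  case: (eqVneq i V) => [->|nV] /=; first by rewrite m1 n2.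
  case: (eqVneq i V') => [->|nV'] /=; first by rewrite m1 QV'.
  by case: (eqVneq i T) => [->|//]; rewrite QT.
rewrite E1 {Q1 E1} sem_loop; set body := (X in iter n (sem n X)).
have H m : forall idx s Q2, size idx <= m -> size s <= n -> Q2 A = idx -> Q2 T = s -> Q2 U = [::] ->
    iter m (sem n body) (clean (v :: rest), Q2, o) =
    (clean (v :: rest), upd (upd Q2 A [::]) T (sel idx s), o).
  elim: m => [|m IH] idx s Q2 si ss QA2 QT2 QU2.
    congr (_, _, _); apply: funext => i; rewrite /upd.
    case: idx QA2 si => // QA2 _ /=.
    by case: (eqVneq i T) => [->|_] //; case: (eqVneq i A) => [->|].
  rewrite iterSr; set f := iter m _.
  have -> : sem n body (clean (v :: rest), Q2, o) = (clean (v :: rest),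
      if idx is b :: idx' then upd (upd Q2 A idx') T (alt b s) else Q2, o).
    rewrite /body sem_seq sem_pop QA2.
    case: idx QA2 {si} => [|b idx] QA2.
      rewrite sem_ifF // sem_skip; congr (_, _, _); apply: funext => i; rewrite /upd.
      by case: (eqVneq i A) => [->|//].
    rewrite sem_ifT // sem_seq sem_seq [sem n (Set_ _ _) _]/=.
    rewrite sem_filter ?m1 //; last by rewrite /upd m1 QT2.
    rewrite sem_move ?inE ?m2 //; last first.
      rewrite /upd eqxx !(m1, m2) QU2 /= QT2.
      exact: leq_trans (size_alt _ _) ss.
    congr (_, _, _); apply: funext => i; rewrite /appq /upd !inE !eqxx ?(m1, m2) QU2 QT2 /=.
    case: (eqVneq i T) => [->|nT] /=; first by rewrite m1.
    case: (eqVneq i U) => [->|nU] //=; first by rewrite m1 QU2.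
  rewrite /f; case: idx si QA2 => [|b idx] si QA2.
    by rewrite (IH [::] s).
  rewrite (IH idx (alt b s)) //.
  - congr (_, _, _); apply: funext => i; rewrite /upd.
    by case: (eqVneq i T) => // _; case: (eqVneq i A).
  - exact: leq_trans (size_alt _ _) ss.
  - by rewrite /upd m2 eqxx.
  - by rewrite /upd eqxx.
  - by rewrite /upd !m1 m2.
rewrite (H n (Q A) (Q V)) //; try by rewrite /upd ?eqxx ?m1 ?m2.
rewrite sem_pop [sem n (Set_ _ _) _]/= upd_same head_sel.
rewrite sem_clear; last first.
  by rewrite upd_same size_behead (leq_trans (leq_pred _)) // (leq_trans (size_sel _ _)).
congr (_, _, _); apply: funext => i; rewrite /upd.
by case: (eqVneq i T) => [->|//]; rewrite m1 QT.
Qed.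

(** Bits arrive least significant first, so the last differing pair decides the order, and register
    3 is overwritten at every difference. Popping an empty queue yields false, which pads the
    shorter number with zeros. *)
Definition Cmp q1 q2 :=
  Set_ 2 (fun=> true) ;;
  Loop (Pop q1 ;; Set_ 4 (rg 1) ;; Pop q2 ;;
        Set_ 3 (fun r => if nth false r 4 == nth false r 1 then nth false r 3 else nth false r 1) ;;
        Set_ 2 (fun r => nth false r 2 && (nth false r 4 == nth false r 1))) ;;
  Set_ 0 (fun=> false) ;; Set_ 1 (fun=> false) ;; Set_ 4 (fun=> false).

Lemma num_head s : num_of_bits s = head false s + 2 * num_of_bits (behead s).
Proof. by case: s => [|b s]; rewrite ?num_nil // num_cons. Qed.

Lemma sem_cmp n q1 q2 rest Q o : q1 != q2 -> size (Q q1) <= n -> size (Q q2) <= n ->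
  sem n (Cmp q1 q2) (clean rest, Q, o) =
  ([:: false, false, num_of_bits (Q q1) == num_of_bits (Q q2),
     num_of_bits (Q q1) < num_of_bits (Q q2), false & rest],
   upd (upd Q q1 [::]) q2 [::], o).
Proof.
move=> q12 s1 s2; rewrite /Cmp sem_seq sem_seq sem_loop [sem n (Set_ _ _) _]/=.
set body := (X in iter n (sem n X)).
have H m : forall a b c d e Q, size (Q q1) <= m -> size (Q q2) <= m -> exists a' b' e',
    iter m (sem n body) ([:: a, b, c, d, e & rest], Q, o) =
    ([:: a', b', c && (num_of_bits (Q q1) == num_of_bits (Q q2)),
      if num_of_bits (Q q1) == num_of_bits (Q q2) then d else
      num_of_bits (Q q1) < num_of_bits (Q q2), e' & rest], upd (upd Q q1 [::]) q2 [::], o).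
  elim: m => [|m IH] {s1 s2 Q} a b c d e Q s1 s2.
    have /nilP E1 : nilp (Q q1) by rewrite /nilp -leqn0.
    have /nilP E2 : nilp (Q q2) by rewrite /nilp -leqn0.
    exists a, b, e; rewrite E1 E2 eqxx andbT; congr (_, _, _).
    apply: funext => i; rewrite /upd.
    by case: (eqVneq i q2) => [->|_] //; case: (eqVneq i q1) => [->|_].
  set e1 := head false (Q q1); set b1 := head false (Q q2).
  set Q1 := upd (upd Q q1 (behead (Q q1))) q2 (behead (Q q2)).
  rewrite iterSr (_ : sem n body _ = ([:: Q q2 != [::], b1, c && (e1 == b1),
    if e1 == b1 then d else b1, e1 & rest], Q1, o)); last first.
    rewrite /=; have -> : upd Q q1 (behead (Q q1)) q2 = Q q2; last by [].
    by rewrite /upd eq_sym (negbTE q12).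
  have [||a' [b' [e' ->]]] := IH (Q q2 != [::]) b1 (c && (e1 == b1)) (if e1 == b1 then d else b1) e1 Q1.
  - rewrite /Q1 /upd (negbTE q12) eqxx size_behead; move: s1; case: (size _) => //=.
  - rewrite /Q1 /upd eqxx size_behead; move: s2; case: (size _) => //=.
  exists a', b', e'.
  have -> : Q1 q1 = behead (Q q1) by rewrite /Q1 /upd (negbTE q12) eqxx.
  have -> : Q1 q2 = behead (Q q2) by rewrite /Q1 /upd eqxx.
  rewrite [num_of_bits (Q q1)]num_head [num_of_bits (Q q2)]num_head -/e1 -/b1.
  set x := num_of_bits (behead (Q q1)); set y := num_of_bits (behead (Q q2)).
  have -> : (e1 + 2 * x == b1 + 2 * y) = (e1 == b1) && (x == y).
    apply/eqP/andP => [|[/eqP-> /eqP->]] //.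
    by case: (e1); case: (b1) => /= E; split=> //; apply/eqP; lia.
  congr ([:: _, _, _, _, _ & _], _, _).
  - by rewrite andbA.
  - have [E|nE] := eqVneq x y; last by rewrite andbF; apply/idP/idP; case: (e1); case: (b1); lia.
    by rewrite andbT E; case: (e1); case: (b1) => //=; apply/esym; lia.
  - apply: funext => i; rewrite /Q1 /upd.
    by case: (eqVneq i q2) => // _; case: (eqVneq i q1).
have [a' [b' [e' ->]]] := H n false false true false false Q s1 s2.
rewrite /=; congr ([:: _, _, _, _, _ & _], _, _).
by case: eqP => // ->; rewrite ltnn.
Qed.

(** The length of [L] serves as a number in unary; register 3 records that [O] ran out too early. *)
Definition TakeBy L O D :=
  Loop (Pop L ;; If (rg 0) (Pop O ;; If (rg 0) (App [:: D] (rg 1)) (Set_ 3 (fun=> true))) Skip) ;;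
  Set_ 0 (fun=> false) ;; Set_ 1 (fun=> false).

Lemma sem_takeby n L O D rest Q o : L != O -> L != D -> O != D -> size (Q L) <= n ->
  sem n (TakeBy L O D) (clean rest, Q, o) =
  ([:: false, false, false, size (Q O) < size (Q L), false & rest],
   upd (upd (upd Q L [::]) O (drop (size (Q L)) (Q O))) D (Q D ++ take (size (Q L)) (Q O)), o).
Proof.
move=> /negbTE LO /negbTE LD /negbTE OD sL; rewrite /TakeBy sem_seq sem_loop.
set body := (X in iter n (sem n X)).
have OL : (O == L) = false by rewrite eq_sym.
have DL : (D == L) = false by rewrite eq_sym.
have DO : (D == O) = false by rewrite eq_sym.
have H m : forall a b d Q, size (Q L) <= m -> exists a' b',
    iter m (sem n body) ([:: a, b, false, d, false & rest], Q, o) =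
    ([:: a', b', false, d || (size (Q O) < size (Q L)), false & rest],
     upd (upd (upd Q L [::]) O (drop (size (Q L)) (Q O))) D (Q D ++ take (size (Q L)) (Q O)), o).
  elim: m => [|m IH] {sL Q} a b d Q sL.
    have /nilP E1 : nilp (Q L) by rewrite /nilp -leqn0.
    exists a, b; rewrite E1 ltn0 orbF take0 cats0 drop0; congr (_, _, _).
    apply: funext => i; rewrite /upd.
    case: (eqVneq i D) => [->|_] //; case: (eqVneq i O) => [->|_] //.
    by case: (eqVneq i L) => [->|_].
  rewrite iterSr; set x := (X in iter m _ X).
  have [Q1 [a1 [b1 [d1 [-> E1 [E2 E3 E4] E5]]]]] : exists Q1 a1 b1 d1,
      [/\ x = ([:: a1, b1, false, d1, false & rest], Q1, o), Q1 L = behead (Q L),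
        [/\ drop (size (behead (Q L))) (Q1 O) = drop (size (Q L)) (Q O),
         Q1 D ++ take (size (behead (Q L))) (Q1 O) = Q D ++ take (size (Q L)) (Q O) &
         d1 || (size (Q1 O) < size (behead (Q L))) = d || (size (Q O) < size (Q L))] &
        forall i, i != L -> i != O -> i != D -> Q1 i = Q i].
    rewrite /x /=; case QL: (Q L) => [|u l] /=.
      exists (upd Q L [::]), false, false, d; split=> //.
      - by rewrite /upd eqxx.
      - by rewrite /upd OL DL !drop0 !take0 !ltn0.
      - by move=> i /negbTE iL _ _; rewrite /upd iL.
    rewrite [upd Q L l O]/upd OL; case QO: (Q O) => [|v s] /=.
      exists (upd (upd Q L l) O [::]), false, false, true; split=> //.
      - by rewrite /upd LO eqxx.
      - by rewrite /upd eqxx DO DL /= orbT.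
      - by move=> i /negbTE iL /negbTE iO _; rewrite /upd iO iL.
    exists (fun i => if i \in [:: D] then rcons (upd (upd Q L l) O s i) v
      else upd (upd Q L l) O s i), true, v, d; split=> //.
    - by rewrite inE LD /upd LO eqxx.
    - rewrite !inE eqxx OD /upd eqxx DO DL /=; split=> //.
      by rewrite -cats1 -catA.
    - by move=> i /negbTE iL /negbTE iO /negbTE iD; rewrite inE iD /upd iO iL.
  have [|a' [b' ->]] := IH a1 b1 d1 Q1.
    by rewrite E1 size_behead; move: sL; case: (size _).
  exists a', b'; rewrite E1 E2 E3 E4; congr (_, _, _); apply: funext => i; rewrite /upd.
  case: (eqVneq i D) => // iD; case: (eqVneq i O) => // iO; case: (eqVneq i L) => // iL.
  exact: E5.
by have [a' [b' ->]] := H n false false false Q sL.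
Qed.

(** * Queue contents as explicit lists, for symbolic execution *)

Lemma upd_nth l q v : upd (nth [::] l) q v = nth [::] (set_nth [::] l q v).
Proof. by apply: funext => i; rewrite nth_set_nth. Qed.

Definition lapp (l : seq (seq bool)) ds v :=
  foldr (fun d l => set_nth [::] l d (nth [::] l d ++ v)) l ds.

Lemma appq_nth l ds v : uniq ds -> appq (nth [::] l) ds v = nth [::] (lapp l ds v).
Proof.
elim: ds => [_|d ds IH] //= /andP[nd ud].
rewrite -upd_nth -IH //; apply: funext => i; rewrite /appq /upd inE (negbTE nd).
by case: eqP => [->|_] //=.
Qed.

Definition enc1 (u : seq bool) := flatten [seq [:: true; b] | b <- u] ++ [:: false; false].

Lemma split1_enc1 u v : split1 (enc1 u ++ v) = (u, v).
Proof. by elim: u => [|b u] //=; rewrite /enc1 /= => ->. Qed.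

Lemma enc_list_cons u us : enc_list (u :: us) = enc1 u ++ enc_list us.
Proof. by []. Qed.

Lemma size_enc1 u : size (enc1 u) = 2 * size u + 2.
Proof. by rewrite /enc1 size_cat /=; congr (_ + 2); elim: u => //= b u ->; lia. Qed.

Lemma size_enc_list_cons u us : size (enc_list (u :: us)) = 2 * size u + 2 + size (enc_list us).
Proof. by rewrite enc_list_cons size_cat size_enc1. Qed.

Lemma unpack_nth n q ds rest l o u v : split1 (nth [::] l q) = (u, v) ->
  q \notin ds -> uniq ds -> size (nth [::] l q) <= 2 * n ->
  sem n (Unpack q ds) (clean rest, nth [::] l, o) =
  (clean rest, nth [::] (lapp (set_nth [::] l q v) ds u), o).
Proof. by move=> E qds uds sz; rewrite sem_unpack // E upd_nth appq_nth. Qed.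

Lemma nth_nth n V V' T U A v rest l o :
  uniq [:: V; V'; T; U; A] -> nth [::] l V' = [::] -> nth [::] l T = [::] -> nth [::] l U = [::] ->
  size (nth [::] l V) <= n -> size (nth [::] l A) <= n ->
  sem n (Nth V V' T U A) (clean (v :: rest), nth [::] l, o) =
  (clean (nth false (nth [::] l V) (num_of_bits (nth [::] l A)) :: rest),
   nth [::] (set_nth [::] l A [::]), o).
Proof. by move=> *; rewrite sem_nth // upd_nth. Qed.

(** * The programs of the verifier *)

Arguments sem : simpl never.
Arguments bin : simpl never.
Arguments enc_list : simpl never.

Lemma sem_set n i e r Q o : sem n (Set_ i e) (r, Q, o) = (set_nth false r i (e r), Q, o).
Proof. by []. Qed.

Lemma app_nth n ds e r l o : uniq ds ->
  sem n (App ds e) (r, nth [::] l, o) = (r, nth [::] (lapp l ds [:: e r]), o).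
Proof.
move=> u; rewrite -appq_nth //; congr (_, _, _); apply: funext => i.
by rewrite /appq; case: ifP => // _; rewrite cats1.
Qed.

Lemma pop_nth n q a b rest l o : sem n (Pop q) ([:: a, b & rest], nth [::] l, o) =
  ([:: nth [::] l q != [::], head false (nth [::] l q) & rest],
   nth [::] (set_nth [::] l q (behead (nth [::] l q))), o).
Proof. by rewrite sem_pop upd_nth. Qed.

Lemma clear_nth n q a b c d e rest l o : size (nth [::] l q) <= n ->
  sem n (Clear q) ([:: a, b, c, d, e & rest], nth [::] l, o) =
  (clean rest, nth [::] (set_nth [::] l q [::]), o).
Proof. by move=> sz; rewrite sem_clear // upd_nth. Qed.

(* Queues: 0 input; 1-4 x, r, y, z; 5-7 N, D, k; 8-10 number of inputs, gates and
   outputs of D; 11-16 fields of the current gate; 17 gate values; 18-20 scratch;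
   21-25 copies of i; 26-29 copies of j; 30 output bits of D; 31, 32 the input
   indices a, b of gate i.
   Registers 6-8: gate tag; 9, 11: values of the gates indexed by its two
   arguments; 10: circuit input indexed by the first argument; 12: its first bit. *)
Definition gate_fun (r : seq bool) : bool :=
  match nth false r 6, nth false r 7, nth false r 8 with
  | false, false, false => nth false r 10
  | true, false, false => nth false r 12
  | false, true, false => nth false r 9 && nth false r 11
  | true, true, false => nth false r 9 || nth false r 11
  | _, _, _ => ~~ nth false r 9
  end.

Definition Reset := Set_ 5 (fun=> false) ;; Set_ 6 (fun=> false) ;; Set_ 7 (fun=> false) ;;
  Set_ 8 (fun=> false) ;; Set_ 9 (fun=> false) ;; Set_ 10 (fun=> false) ;;
  Set_ 11 (fun=> false) ;; Set_ 12 (fun=> false).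

(** A lookup destroys its index, hence three copies of the first argument. All candidate values are
    fetched for every kind of gate, and [gate_fun] selects by tag. When no gate is left the tag is
    empty and the pass changes nothing, so a loop of fixed length does no harm. *)
Definition gate_body :=
  Unpack 9 [:: 11] ;; Unpack 11 [:: 12] ;; Unpack 11 [:: 13; 14; 15] ;; Unpack 11 [:: 16] ;;
  Pop 12 ;; If (rg 0)
   (Set_ 6 (rg 1) ;; Pop 12 ;; Set_ 7 (rg 1) ;; Pop 12 ;; Set_ 8 (rg 1) ;; Clean ;;
    Nth 17 18 19 20 13 ;; Set_ 9 (rg 5) ;;
    Nth 21 18 19 20 14 ;; Set_ 10 (rg 5) ;;
    Nth 17 18 19 20 16 ;; Set_ 11 (rg 5) ;;
    Pop 15 ;; Set_ 12 (rg 1) ;; Clear 15 ;;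
    App [:: 17] gate_fun ;; Reset) Skip.

Definition zregs := nseq 18 false.

Definition glist (pre post : seq (seq bool)) (gs outs V I : seq bool) : seq (seq bool) :=
  pre ++ [:: gs; outs; [::]; [::]; [::]; [::]; [::]; [::]; V; [::]; [::]; [::]; I] ++ post.

Lemma sem_gate_body n pre post outs o t0 t1 t2 gs G0 G1 G2 A B gs' V I :
  size pre = 9 -> split1 gs = (G0, gs') -> split1 G0 = ([:: t0; t1; t2], G1) ->
  split1 G1 = (A, G2) -> split1 G2 = (B, [::]) ->
  size gs <= n -> size G0 <= n -> size G1 <= n -> size G2 <= n ->
  size V <= n -> size I <= n -> size A <= n -> size B <= n ->
  sem n gate_body (zregs, nth [::] (glist pre post gs outs V I), o) =
  (zregs, nth [::] (glist pre post gs' outs (rcons V (gate_fun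
    [:: false; false; false; false; false; false; t0; t1; t2;
      nth false V (num_of_bits A); nth false I (num_of_bits A); nth false V (num_of_bits B);
      head false A])) I), o).
Proof.
case: pre => [//|p0 [//|p1 [//|p2 [//|p3 [//|p4 [//|p5 [//|p6 [//|p7 [//|p8 [|//]]]]]]]]]] _.
move=> E0 E1 E2 E3 sgs s0 s1 s2 sV sI sA sB.
rewrite /zregs /glist /gate_body /=.
rewrite sem_seq (@unpack_nth _ _ _ _ _ _ G0 gs') //=; last by lia.
rewrite sem_seq (@unpack_nth _ _ _ _ _ _ [:: t0; t1; t2] G1) //=; last by lia.
rewrite sem_seq (@unpack_nth _ _ _ _ _ _ A G2) //=; last by lia.
rewrite sem_seq (@unpack_nth _ _ _ _ _ _ B [::]) //=; last by lia.
rewrite sem_seq pop_nth /=.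
rewrite sem_ifT //.
rewrite sem_seq sem_set /= sem_seq pop_nth /= sem_seq sem_set /= sem_seq pop_nth /= sem_seq sem_set /=.
rewrite sem_seq sem_clean /=.
rewrite sem_seq nth_nth //= sem_seq sem_set /=.
rewrite sem_seq nth_nth //= sem_seq sem_set /=.
rewrite sem_seq nth_nth //= sem_seq sem_set /=.
rewrite sem_seq pop_nth /= sem_seq sem_set /= sem_seq clear_nth /=; last first.
  by rewrite size_behead; lia.
rewrite sem_seq app_nth //= /Reset !sem_seq !sem_set /= cats1.
by [].
Qed.

Lemma sem_gate_body_nil n pre post outs o V I : size pre = 9 ->
  sem n gate_body (zregs, nth [::] (glist pre post [::] outs V I), o) =
  (zregs, nth [::] (glist pre post [::] outs V I), o).
Proof.
case: pre => [//|p0 [//|p1 [//|p2 [//|p3 [//|p4 [//|p5 [//|p6 [//|p7 [//|p8 [|//]]]]]]]]]] _.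
rewrite /zregs /glist /gate_body /=.
do 4 rewrite sem_seq (@unpack_nth _ _ _ _ _ _ [::] [::]) //=.
by rewrite sem_seq pop_nth /= sem_ifF // sem_skip.
Qed.

Lemma size_bin a : 0 < size (bin a).
Proof. by rewrite size_mkseq. Qed.

Lemma num_mkseq_bits m a : a < 2 ^ m -> num_of_bits (mkseq (fun i => odd (a %/ 2 ^ i)) m) = a.
Proof.
elim: m a => [|m IH] a; first by rewrite num_nil; case: a.
move=> am; rewrite /mkseq /= num_cons expn0 divn1.
have -> : [seq odd (a %/ 2 ^ i) | i <- iota 1 m] = mkseq (fun i => odd ((a %/ 2) %/ 2 ^ i)) m.
  rewrite /mkseq -[1]/(1 + 0) iotaDl -map_comp; apply: eq_map => i /=.
  by rewrite expnS divnMA.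
rewrite IH; last by rewrite ltn_divLR // -expnSr.
by rewrite -modn2 addnC mulnC -divn_eq.
Qed.

Lemma num_bin a : num_of_bits (bin a) = a.
Proof.
by apply: num_mkseq_bits; case: a => // a; rewrite trunc_log_ltn.
Qed.

Lemma sem_gate n pre post outs o g gs V I :
  size pre = 9 -> size (enc_list (map enc_dgate (g :: gs))) <= n ->
  size V <= n -> size I <= n ->
  sem n gate_body (zregs, nth [::] (glist pre post (enc_list (map enc_dgate (g :: gs))) outs V I), o) =
  (zregs, nth [::] (glist pre post (enc_list (map enc_dgate gs)) outs
     (rcons V (dgate_val (nth false I) V g)) I), o).
Proof.
move=> sp; rewrite [map _ _]/= size_enc_list_cons => sz sV sI.
have E0 : split1 (enc_list (enc_dgate g :: [seq enc_dgate i | i <- gs])) =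
  (enc_dgate g, enc_list (map enc_dgate gs)) by rewrite enc_list_cons split1_enc1.
have H t0 t1 t2 A Bs B : enc_dgate g = enc_list ([:: t0; t1; t2] :: A :: Bs) ->
    split1 (enc_list Bs) = (B, [::]) -> size B <= size (enc_list Bs) ->
   gate_fun [:: false; false; false; false; false; false; t0; t1; t2;
      nth false V (num_of_bits A); nth false I (num_of_bits A); nth false V (num_of_bits B);
      head false A] = dgate_val (nth false I) V g -> 
  sem n gate_body (zregs, nth [::] (glist pre post (enc_list (enc_dgate g :: map enc_dgate gs)) outs V I), o) =
  (zregs, nth [::] (glist pre post (enc_list (map enc_dgate gs)) outs
     (rcons V (dgate_val (nth false I) V g)) I), o).
  move=> Eg EB sB <-.
  move: sz; rewrite Eg !size_enc_list_cons /= => sz.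
  apply: (@sem_gate_body n pre post outs o t0 t1 t2 _ (enc_dgate g) (enc_list (A :: Bs)) (enc_list Bs)) => //.
  - by rewrite -Eg; exact: E0.
  - by rewrite Eg; exact: (split1_enc1 [:: t0; t1; t2] (enc_list (A :: Bs))).
  - exact: (split1_enc1 A (enc_list Bs)).
  - by rewrite !size_enc_list_cons /=; lia.
  - by rewrite Eg !size_enc_list_cons /=; lia.
  - by rewrite size_enc_list_cons; lia.
  - by lia.
  - by lia.
  - by lia.
case: g sz E0 H => [i|b|a b|a b|a] sz E0 H.
- by apply: (H _ _ _ (bin i) [::] [::]) => //=; rewrite num_bin.
- by apply: (H _ _ _ [:: b] [::] [::]).
- apply: (H _ _ _ (bin a) [:: bin b] (bin b)) => //; last by rewrite /gate_fun /= !num_bin.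
    exact: (split1_enc1 (bin b) [::]).
  by rewrite size_enc_list_cons; lia.
- apply: (H _ _ _ (bin a) [:: bin b] (bin b)) => //; last by rewrite /gate_fun /= !num_bin.
    exact: (split1_enc1 (bin b) [::]).
  by rewrite size_enc_list_cons; lia.
- by apply: (H _ _ _ (bin a) [::] [::]) => //=; rewrite /gate_fun /= num_bin.
Qed.

Definition dvals inp V gs := foldl (fun vs g => rcons vs (dgate_val inp vs g)) V gs.

Lemma size_dvals inp V gs : size (dvals inp V gs) = size V + size gs.
Proof.
by rewrite /dvals; elim: gs V => [|g gs IH] V /=; rewrite ?addn0 // IH size_rcons addSnnS.
Qed.

Lemma size_enc_list_ge us : 2 * size us <= size (enc_list us).
Proof. by elim: us => // u us IH; rewrite size_enc_list_cons /=; lia. Qed.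

Lemma gate_loop n pre post outs o gs I :
  size pre = 9 -> size (enc_list (map enc_dgate gs)) <= n -> size I <= n ->
  sem n (Loop gate_body)
    (zregs, nth [::] (glist pre post (enc_list (map enc_dgate gs)) outs [::] I), o) =
  (zregs, nth [::] (glist pre post [::] outs (dvals (nth false I) [::] gs) I), o).
Proof.
move=> sp sz sI; rewrite sem_loop.
have H m V : size gs <= m -> size V + size gs <= n ->
    iter m (sem n gate_body)
     (zregs, nth [::] (glist pre post (enc_list (map enc_dgate gs)) outs V I), o) =
    (zregs, nth [::] (glist pre post [::] outs (dvals (nth false I) V gs) I), o).
  elim: m gs V sz => [|m IH] gs V sz sm sV.
    by case: gs sz sm sV.
  rewrite iterSr; case: gs sz sm sV => [|g gs] sz sm sV.
    by rewrite sem_gate_body_nil // (IH [::]).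
  rewrite sem_gate //; last by move: sV => /=; lia.
  rewrite IH //.
    by move: sz; rewrite /= size_enc_list_cons; lia.
  by move: sV; rewrite size_rcons /=; lia.
have := size_enc_list_ge (map enc_dgate gs); rewrite size_map => sg.
by apply: H; rewrite /=; lia.
Qed.

Definition out_body :=
  Unpack 10 [:: 13; 15] ;; Pop 15 ;; If (rg 0)
    (Clear 15 ;; Nth 17 18 19 20 13 ;; App [:: 30] (rg 5) ;; Set_ 5 (fun=> false)) Skip.

Lemma out_loop n p0 p1 p2 p3 p4 p5 p6 p7 p8 V I i1 i2 i3 i4 j1 j2 j3 j4 os post o :
  size (enc_list (map bin os)) <= n -> size V <= n ->
  sem n (Loop out_body)
    (zregs, nth [::] (glist [:: p0; p1; p2; p3; p4; p5; p6; p7; p8]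
      [:: i1, i2, i3, i4, j1, j2, j3, j4, [::] & post] [::] (enc_list (map bin os)) V I), o) =
  (zregs, nth [::] (glist [:: p0; p1; p2; p3; p4; p5; p6; p7; p8]
      [:: i1, i2, i3, i4, j1, j2, j3, j4, [seq nth false V a | a <- os] & post] [::] [::] V I), o).
Proof.
move=> sz sV; rewrite sem_loop.
have H m O : size os <= m ->
    iter m (sem n out_body)
    (zregs, nth [::] (glist [:: p0; p1; p2; p3; p4; p5; p6; p7; p8]
      [:: i1, i2, i3, i4, j1, j2, j3, j4, O & post] [::] (enc_list (map bin os)) V I), o) =
    (zregs, nth [::] (glist [:: p0; p1; p2; p3; p4; p5; p6; p7; p8]
      [:: i1, i2, i3, i4, j1, j2, j3, j4, O ++ [seq nth false V a | a <- os] & post] [::] [::] V I), o).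
  elim: m os O sz => [|m IH] os O sz sm.
    by case: os sz sm; rewrite //= cats0.
  rewrite iterSr; case: os sz sm => [|a os] sz sm.
    rewrite (_ : sem n out_body _ = (zregs, nth [::] (glist [:: p0; p1; p2; p3; p4; p5; p6; p7; p8]
      [:: i1, i2, i3, i4, j1, j2, j3, j4, O & post] [::] [::] V I), o)).
      by rewrite (IH [::]) //= cats0.
    rewrite /zregs /glist /out_body /=.
    rewrite sem_seq (@unpack_nth _ _ _ _ _ _ [::] [::]) //=.
    by rewrite sem_seq pop_nth /= sem_ifF // sem_skip.
  rewrite -cat_rcons -(IH os); last 2 first.
  - by move: sz; rewrite /= size_enc_list_cons; lia.
  - by [].
  congr (iter _ _ _); rewrite /zregs /glist /out_body /=.
  move: sz; rewrite map_cons size_enc_list_cons => sz.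
  have E : split1 (enc_list (bin a :: map bin os)) = (bin a, enc_list (map bin os)).
    by rewrite enc_list_cons split1_enc1.
  have sb := size_bin a.
  have szE := size_enc_list_cons (bin a) (map bin os).
  move: (enc_list (bin a :: map bin os)) E szE => W E szE.
  rewrite sem_seq (@unpack_nth _ _ _ _ _ _ (bin a) (enc_list (map bin os))) //=; last by lia.
  move: (num_bin a) sb sz {E szE}; move: (bin a) => ba nb sb sz.
  rewrite sem_seq pop_nth /= sem_ifT //; last by case: ba sb {nb sz}.
  rewrite sem_seq clear_nth /=; last by rewrite size_behead; lia.
  rewrite sem_seq nth_nth //=; last by lia.
  by rewrite sem_seq app_nth //= sem_set /= nb cats1.
apply: (H n [::]).
by have := size_enc_list_ge (map bin os); rewrite size_map; lia.
Qed.

Lemma size_split1 s : size (split1 s).1 <= size s /\ size (split1 s).2 <= size s.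
Proof.
elim: {s}(size s) {-2}s (leqnn (size s)) => [|m IH] [|x [|y s]] //=; first by case: x.
rewrite ltnS => sm; case: x => //=; last by split; [|lia].
have [] := IH s (ltnW sm); case: (split1 s) => u v /=; lia.
Qed.

Lemma size_enc_list_nil : size (enc_list [::]) = 0.
Proof. by []. Qed.

Lemma size_take_le (T : Type) m (s : seq T) : size (take m s) <= size s.
Proof. by rewrite size_take_min geq_minr. Qed.

Lemma cmp_nth n q1 q2 rest l o : q1 != q2 ->
  size (nth [::] l q1) <= n -> size (nth [::] l q2) <= n ->
  sem n (Cmp q1 q2) (clean rest, nth [::] l, o) =
  ([:: false, false, num_of_bits (nth [::] l q1) == num_of_bits (nth [::] l q2),
     num_of_bits (nth [::] l q1) < num_of_bits (nth [::] l q2), false & rest],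
   nth [::] (set_nth [::] (set_nth [::] l q1 [::]) q2 [::]), o).
Proof. by move=> *; rewrite sem_cmp // !upd_nth. Qed.

Lemma takeby_nth n L O D rest l o : L != O -> L != D -> O != D -> size (nth [::] l L) <= n ->
  sem n (TakeBy L O D) (clean rest, nth [::] l, o) =
  ([:: false, false, false, size (nth [::] l O) < size (nth [::] l L), false & rest],
   nth [::] (set_nth [::] (set_nth [::] (set_nth [::] l L [::]) O
      (drop (size (nth [::] l L)) (nth [::] l O))) D
      (nth [::] l D ++ take (size (nth [::] l L)) (nth [::] l O))), o).
Proof. by move=> *; rewrite sem_takeby // !upd_nth. Qed.

Definition emit_queue q := Loop (Pop q ;; If (rg 0) (Emit (rg 1)) Skip).

Lemma sem_emit_queue n q rest Q o : size (Q q) <= n ->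
  (sem n (emit_queue q) (clean rest, Q, o)).2 = o ++ Q q.
Proof.
rewrite /emit_queue sem_loop; set body := (X in iter n (sem n X)).
have H m : forall a b Q o, size (Q q) <= m ->
   (iter m (sem n body) ([:: a, b, false, false, false & rest], Q, o)).2 = o ++ Q q.
  elim: m => [|m IH] a b {}Q {}o.
    by case: (Q q) => //= _; rewrite cats0.
  rewrite iterSr /body sem_seq sem_pop.
  case Qq: (Q q) => [|x s] sz.
    by rewrite sem_ifF // sem_skip IH /upd eqxx ?cats0.
  by rewrite sem_ifT // -[sem n (Emit _) _]/(_, _, _) IH /upd eqxx /= ?cat_rcons.
exact: H.
Qed.

Definition askA_prog := Unpack 0 [:: 1] ;; Unpack 0 [:: 2] ;; Unpack 2 [:: 3] ;; emit_queue 3.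
Definition askB_prog := Unpack 0 [:: 1] ;; Unpack 0 [:: 2] ;; Unpack 2 [:: 3] ;;
  Unpack 2 [:: 4] ;; emit_queue 4.

Definition qi (r : seq bool) := (split1 r).1.
Definition qj (r : seq bool) := (split1 (split1 r).2).1.

Definition init_queues (w : seq bool) := [:: w, [::], [::], [::], [::], [::], [::], [::], [::],
  [::], [::] & nseq 22 [::]].

Lemma init_queuesE w : (fun i : nat => if i == 0 then w else [::]) = nth [::] (init_queues w).
Proof. by apply: funext; do 40 (case=> //). Qed.

Lemma askA_ok x r : let w := enc_list [:: x; r] in
  (sem (size w) askA_prog (zregs, fun i => if i == 0 then w else [::], [::])).2 = qi r.
Proof.
move=> w; set n := size w; rewrite init_queuesE /init_queues /zregs /=.
have [s1 s2] := size_split1 r.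
have sn : 2 * size x + 2 + (2 * size r + 2 + 0) = n by rewrite /n /w !size_enc_list_cons.
rewrite sem_seq (@unpack_nth _ _ _ _ _ _ x (enc_list [:: r])) //=; last 2 first.
- exact: (split1_enc1 x (enc_list [:: r])).
- by lia.
rewrite sem_seq (@unpack_nth _ _ _ _ _ _ r [::]) //=; last 2 first.
- exact: (split1_enc1 r [::]).
- by rewrite size_enc_list_cons size_enc_list_nil; lia.
rewrite sem_seq (@unpack_nth _ _ _ _ _ _ (split1 r).1 (split1 r).2) //=; last 2 first.
- by case: split1.
- by lia.
by rewrite sem_emit_queue //=; lia.
Qed.

Lemma askB_ok x r : let w := enc_list [:: x; r] in
  (sem (size w) askB_prog (zregs, fun i => if i == 0 then w else [::], [::])).2 = qj r.
Proof.
move=> w; set n := size w; rewrite init_queuesE /init_queues /zregs /=.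
have [s1 s2] := size_split1 r.
have [s3 s4] := size_split1 (split1 r).2.
have sn : 2 * size x + 2 + (2 * size r + 2 + 0) = n by rewrite /n /w !size_enc_list_cons.
rewrite sem_seq (@unpack_nth _ _ _ _ _ _ x (enc_list [:: r])) //=; last 2 first.
- exact: (split1_enc1 x (enc_list [:: r])).
- by lia.
rewrite sem_seq (@unpack_nth _ _ _ _ _ _ r [::]) //=; last 2 first.
- exact: (split1_enc1 r [::]).
- by rewrite size_enc_list_cons size_enc_list_nil; lia.
rewrite sem_seq (@unpack_nth _ _ _ _ _ _ (split1 r).1 (split1 r).2) //=; last 2 first.
- by case: split1.
- by lia.
rewrite /= sem_seq (@unpack_nth _ _ _ _ _ _ (qj r) (split1 (split1 r).2).2) //=; last 2 first.
- by rewrite /qj; case: (split1 (split1 r).2).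
- by lia.
by rewrite sem_emit_queue //= /qj; lia.
Qed.

(* The three bits of the kind code come lsb first. *)
Definition kind_val (k0 k1 k2 ya yb : bool) : bool :=
  match k0, k1, k2 with
  | true, false, false => true
  | false, true, false => ya && yb
  | true, true, false => ya || yb
  | false, false, true => ~~ ya
  | _, _, _ => false
  end.

Definition violation (kv ya yb z ji ja jb jk : bool) : bool :=
  [|| ji && (z != kv), ja && (z != ya), jb && (z != yb) | jk && ~~ z].

Definition reject_fun (r : seq bool) : bool :=
  let g := nth false r in
  [&& ~~ g 9, g 10 &
    violation (kind_val (g 6) (g 7) (g 8) (g 15) (g 16)) (g 15) (g 16) (g 17)
      (g 11) (g 12) (g 13) (g 14)].

(** Registers here: 6-8 kind code, 9 wrong width, 10 whether i < N, 11-14 whether j equals i, a, b,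
    k, 15-16 Alice's bits, 17 Bob's bit. Every comparison consumes its own copy of i or j. *)
Definition check_prog :=
  Pop 30 ;; Set_ 6 (rg 1) ;; Pop 30 ;; Set_ 7 (rg 1) ;; Pop 30 ;; Set_ 8 (rg 1) ;; Clean ;;
  TakeBy 24 30 31 ;; Set_ 9 (rg 3) ;; Clean ;;
  TakeBy 25 30 32 ;; Set_ 9 (fun r => nth false r 9 || nth false r 3) ;; Clean ;;
  Pop 30 ;; Set_ 9 (fun r => nth false r 9 || nth false r 0) ;; Clean ;;
  Cmp 22 5 ;; Set_ 10 (rg 3) ;; Clean ;;
  Cmp 23 26 ;; Set_ 11 (rg 2) ;; Clean ;;
  Cmp 31 27 ;; Set_ 12 (rg 2) ;; Clean ;;
  Cmp 32 28 ;; Set_ 13 (rg 2) ;; Clean ;;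
  Cmp 7 29 ;; Set_ 14 (rg 2) ;; Clean ;;
  Pop 3 ;; Set_ 15 (rg 1) ;; Pop 3 ;; Set_ 16 (rg 1) ;; Pop 4 ;; Set_ 17 (rg 1) ;;
  If reject_fun Skip (Emit (fun=> true)).

Definition dec_prog :=
  Unpack 0 [:: 1] ;; Unpack 0 [:: 2] ;; Unpack 0 [:: 3] ;; Unpack 0 [:: 4] ;;
  Unpack 1 [:: 5] ;; Unpack 1 [:: 6] ;; Unpack 1 [:: 7] ;;
  Unpack 2 [:: 21; 22; 23; 24; 25] ;; Unpack 2 [:: 26; 27; 28; 29] ;;
  Unpack 6 [:: 8] ;; Unpack 6 [:: 9] ;; Unpack 6 [:: 10] ;;
  Loop gate_body ;; Loop out_body ;; check_prog.

(** The output of the circuit is cut into fields by the length of [i], which is correct only if [i]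
    has the width of the circuit; the first conjunct tests this through the number of output
    bits. *)
Definition reject (N k : nat) (o i j y z : seq bool) : bool :=
  let o3 := drop 3 o in
  let w := size i in
  let ya := nth false y 0 in let yb := nth false y 1 in
  let num := num_of_bits in
  [&& size o3 == 2 * w, num i < N &
    violation (kind_val (nth false o 0) (nth false o 1) (nth false o 2) ya yb) ya yb
      (nth false z 0) (num i == num j) (num (take w o3) == num j)
      (num (take w (drop w o3)) == num j) (k == num j)].

Lemma check_ok n N k p0 p1 p2 y z p6 p8 g10 V O i j :
  size i <= n -> size j <= n -> size O <= n -> size (bin N) <= n -> size (bin k) <= n ->
  (sem n check_prog (zregs, nth [::] (glist [:: p0; p1; p2; y; z; bin N; p6; bin k; p8]
     [:: i; i; i; i; j; j; j; j; O; [::]; [::]] [::] g10 V i), [::])).2 =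
  if reject N k O i j y z then [::] else [:: true].
Proof.
move=> si sj sO sN sk; rewrite /check_prog /zregs /glist /=.
do 3 (rewrite sem_seq pop_nth /= sem_seq sem_set /=).
have o0 : head false O = nth false O 0 by case: (O).
have o1 : head false (behead O) = nth false O 1 by case: (O) => [|? []].
have o2 : head false (behead (behead O)) = nth false O 2 by case: (O) => [|? [|? []]].
have o3 : behead (behead (behead O)) = drop 3 O by case: (O) => [|? [|? [|? ?]]] //=; rewrite drop0.
rewrite o0 o1 o2 o3; set O3 := drop 3 O.
have sO3 : size O3 <= n by rewrite size_drop (leq_trans (leq_subr _ _)).
rewrite sem_seq sem_clean.
rewrite sem_seq takeby_nth //= sem_seq sem_set /= sem_seq sem_clean.
rewrite sem_seq takeby_nth //= sem_seq sem_set /= sem_seq sem_clean.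
rewrite sem_seq pop_nth /= sem_seq sem_set /= sem_seq sem_clean.
rewrite sem_seq cmp_nth //= sem_seq sem_set /= sem_seq sem_clean.
rewrite sem_seq cmp_nth //= sem_seq sem_set /= sem_seq sem_clean.
have sa : size (take (size i) O3) <= n by rewrite (leq_trans (size_take_le _ _)).
have sb : size (take (size i) (drop (size i) O3)) <= n by rewrite (leq_trans (size_take_le _ _)) // size_drop (leq_trans (leq_subr _ _)).
rewrite sem_seq cmp_nth //= sem_seq sem_set /= sem_seq sem_clean.
rewrite sem_seq cmp_nth //= sem_seq sem_set /= sem_seq sem_clean.
rewrite sem_seq cmp_nth //= sem_seq sem_set /= sem_seq sem_clean.
do 3 (rewrite sem_seq pop_nth /= sem_seq sem_set /=).
have y0 : head false y = nth false y 0 by case: (y).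
have y1 : head false (behead y) = nth false y 1 by case: (y) => [|? []].
have z0 : head false z = nth false z 0 by case: (z).
rewrite y0 y1 z0 !num_bin.
set regs := (X in sem n _ (X, _, _)).
have -> : reject N k O i j y z = reject_fun regs.
  rewrite /reject /reject_fun /regs /= -/O3; congr (_ && _).
  (* There are exactly [2 * size i] bits iff both cuts of length [size i] succeed and nothing is
     left over. *)
  move: O3 {o0 o1 o2 y0 y1 z0 o3 sO3 sa sb regs} => O3; apply/eqP/idP => [E|].
    by rewrite !negb_or -!leqNgt negbK -size_eq0 !size_drop E; apply/andP; split; [apply/andP; split|]; lia.
  rewrite !negb_or -!leqNgt negbK -size_eq0 !size_drop => /andP[/andP[h1 h2] /eqP h3].
  by apply: anti_leq; rewrite mul2n -addnn -leq_subRL // h2 -subn_eq0 subnDA h3.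
case h : (reject_fun regs); first by rewrite sem_ifT // sem_skip.
by rewrite sem_ifF // h.
Qed.

Lemma size_enc_list2 u v : size (enc_list [:: u; v]) = 2 * size u + 2 + (2 * size v + 2).
Proof. by rewrite !size_enc_list_cons size_enc_list_nil !addn0. Qed.

Lemma size_enc_list1 u : size (enc_list [:: u]) = 2 * size u + 2.
Proof. by rewrite size_enc_list_cons size_enc_list_nil addn0. Qed.

Lemma dec_ok N D k r y z : let w := enc_list [:: enc_inst N D k; r; y; z] in
  (sem (size w) dec_prog (zregs, fun i => if i == 0 then w else [::], [::])).2 =
  if reject N k (dc_eval D (nth false (qi r))) (qi r) (qj r) y z then [::] else [:: true].
Proof.
move=> w; set n := size w; rewrite init_queuesE /init_queues /zregs /=.
have [s1 s2] := size_split1 r.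
have [s3 s4] := size_split1 (split1 r).2.
pose x := enc_inst N D k.
pose gs := enc_list (map enc_dgate (dc_gates D)).
pose os := enc_list (map bin (dc_outs D)).
have sn : 2 * size x + 2 + (2 * size r + 2 + (2 * size y + 2 + (2 * size z + 2 + 0))) = n.
  by rewrite /n /w !size_enc_list_cons.
have sx : 2 * size (bin N) + 2 + (2 * size (enc_dc D) + 2 + (2 * size (bin k) + 2 + 0)) = size x.
  by rewrite /x /enc_inst !size_enc_list_cons.
have sd : 2 * size (bin (dc_nin D)) + 2 + (2 * size gs + 2 + (2 * size os + 2 + 0)) = size (enc_dc D).
  by rewrite /enc_dc !size_enc_list_cons.
have sou := size_enc_list_ge (map bin (dc_outs D)); rewrite size_map -/os in sou.
have sga := size_enc_list_ge (map enc_dgate (dc_gates D)); rewrite size_map -/gs in sga.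
have E0 : split1 w = (x, enc_list [:: r; y; z]) by exact: (split1_enc1 x _).
have E1 : split1 (enc_list [:: r; y; z]) = (r, enc_list [:: y; z]) by exact: (split1_enc1 r _).
have E2 : split1 (enc_list [:: y; z]) = (y, enc_list [:: z]) by exact: (split1_enc1 y _).
have E3 : split1 (enc_list [:: z]) = (z, [::]) by exact: (split1_enc1 z [::]).
have E4 : split1 x = (bin N, enc_list [:: enc_dc D; bin k]) by exact: (split1_enc1 (bin N) _).
have E5 : split1 (enc_list [:: enc_dc D; bin k]) = (enc_dc D, enc_list [:: bin k]).
  exact: (split1_enc1 (enc_dc D) _).
have E6 : split1 (enc_list [:: bin k]) = (bin k, [::]) by exact: (split1_enc1 (bin k) [::]).
have E9 : split1 (enc_dc D) = (bin (dc_nin D), enc_list [:: gs; os]) by exact: (split1_enc1 (bin (dc_nin D)) _).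
have E10 : split1 (enc_list [:: gs; os]) = (gs, enc_list [:: os]) by exact: (split1_enc1 gs _).
have E11 : split1 (enc_list [:: os]) = (os, [::]) by exact: (split1_enc1 os [::]).
have swn : size w = n by [].
have EV : dc_eval D (nth false (qi r)) = [seq nth false (dvals (nth false (qi r)) [::] (dc_gates D)) i | i <- dc_outs D] by [].
clearbody n w x.
have z1 : size (enc_list [:: r; y; z]) <= n by rewrite !size_enc_list_cons size_enc_list_nil; lia.
have z2 : size (enc_list [:: y; z]) <= n by rewrite size_enc_list2; lia.
have z3 : size (enc_list [:: z]) <= n by rewrite size_enc_list1; lia.
have z5 : size (enc_list [:: enc_dc D; bin k]) <= n by rewrite size_enc_list2; lia.
have z6 : size (enc_list [:: bin k]) <= n by rewrite size_enc_list1; lia.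
have E7 : split1 r = (qi r, (split1 r).2) by rewrite /qi; case: split1.
have E8 : split1 (split1 r).2 = (qj r, (split1 (split1 r).2).2) by rewrite /qj; case: split1.
have z10 : size (enc_list [:: gs; os]) <= n by rewrite size_enc_list2; lia.
have z11 : size (enc_list [:: os]) <= n by rewrite size_enc_list1; lia.
have le2 m : m <= n -> m <= 2 * n by lia.
have zi : size (qi r) <= n by rewrite /qi; lia.
have zj : size (qj r) <= n by rewrite /qj; lia.
have zr : size r <= n by lia.
have zr2 : size (split1 r).2 <= n by lia.
have zN : size (bin N) <= n by lia.
have zk : size (bin k) <= n by lia.
have zx : size x <= n by lia.
have zd : size (enc_dc D) <= n by lia.
have zgs : size gs <= n by lia.
have zos : size os <= n by lia.
have zgn : size (dc_gates D) <= n by lia.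
have zon : size (dc_outs D) <= n by lia.
have zw : size w <= n by rewrite swn.
rewrite /dec_prog.
clear sn sx sd s1 s2 s3 s4 sou sga.
rewrite sem_seq (@unpack_nth _ _ _ _ _ _ (x) (enc_list [:: r; y; z])) //=; last by apply: le2.
rewrite sem_seq (@unpack_nth _ _ _ _ _ _ (r) (enc_list [:: y; z])) //=; last by apply: le2.
rewrite sem_seq (@unpack_nth _ _ _ _ _ _ (y) (enc_list [:: z])) //=; last by apply: le2.
rewrite sem_seq (@unpack_nth _ _ _ _ _ _ (z) ([::])) //=; last by apply: le2.
rewrite sem_seq (@unpack_nth _ _ _ _ _ _ (bin N) (enc_list [:: enc_dc D; bin k])) //=; last by apply: le2.
rewrite sem_seq (@unpack_nth _ _ _ _ _ _ (enc_dc D) (enc_list [:: bin k])) //=; last by apply: le2.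
rewrite sem_seq (@unpack_nth _ _ _ _ _ _ (bin k) ([::])) //=; last by apply: le2.
rewrite sem_seq (@unpack_nth _ _ _ _ _ _ (qi r) ((split1 r).2)) //=; last by apply: le2.
rewrite sem_seq (@unpack_nth _ _ _ _ _ _ (qj r) ((split1 (split1 r).2).2)) //=; last by apply: le2.
rewrite sem_seq (@unpack_nth _ _ _ _ _ _ (bin (dc_nin D)) (enc_list [:: gs; os])) //=; last by apply: le2.
rewrite sem_seq (@unpack_nth _ _ _ _ _ _ (gs) (enc_list [:: os])) //=; last by apply: le2.
rewrite sem_seq (@unpack_nth _ _ _ _ _ _ (os) ([::])) //=; last by apply: le2.
set l := (X in sem n _ (_, nth [::] X, _)).
pose pre := [:: [::]; [::]; (split1 (split1 r).2).2; y; z; bin N; [::]; bin k; bin (dc_nin D)].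
pose post O := [:: qi r; qi r; qi r; qi r; qj r; qj r; qj r; qj r; O; [::]; [::]].
rewrite -[l]/(glist pre (post [::]) gs os [::] (qi r)) -[clean _]/zregs.
rewrite sem_seq gate_loop //.
rewrite sem_seq (@out_loop n) //; last by rewrite size_dvals.
rewrite -EV /pre /post check_ok //.
by rewrite EV size_map.
Qed.

(** * The verifier *)

Lemma ptm_of_prog c : cmd_wf 18 33 c ->
  exists P : ptm, forall w, ptm_eval P w =
    rev (sem (size w) c (zregs, fun i => if i == 0 then w else [::], [::])).2.
Proof. exact: cmd_ptm. Qed.

Lemma verifier_exists : exists V : verifier,
  [/\ good_verifier V, [/\ v_m V =1 id, v_la V =1 id & v_lb V =1 id],
    forall x r, qA V x r = rev (qi r), forall x r, qB V x r = rev (qj r) &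
    forall N D k r y z, v_accepts V (enc_inst N D k) r y z =
      ~~ reject N k (dc_eval D (nth false (qi r))) (qi r) (qj r) y z].
Proof.
have [Pa Ha] := @ptm_of_prog askA_prog erefl.
have [Pb Hb] := @ptm_of_prog askB_prog erefl.
have [Pd Hd] := @ptm_of_prog dec_prog erefl.
(* A machine that halts at its first step leaves 1^n on the tape; it serves for the coin length and
   both answer lengths. *)
have idP : is_poly id.
  pose M := @mkTM 0 (fun _ a => (inord 1, a, mvStay)).
  have H w : exists d, run M (1 * size w ^ 1 + 1) w = d /\
      (halted d /\ output d = w).
    eexists; split; first by [].
    have h1 : halted (step (init_config M w)) /\ output (step (init_config M w)) = w.
      rewrite /step ifF; last first.
        case: w => [|b w]; apply/negbTE/eqP => /(congr1 val) /=; by rewrite inordK.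
      case: w => [|b w] /=; rewrite /halted /= eqxx; split=> //.
      by rewrite /output /=; congr (_ :: _); elim: w => //= c w ->.
    have h2 m : iter m (@step M) (step (init_config M w)) = step (init_config M w).
      by elim: m => //= m ->; rewrite {1}/step (proj1 h1).
    by rewrite /run addn1 iterSr h2.
  have Hh w : halted (run M (1 * size w ^ 1 + 1) w) by case: (H w) => d [-> []].
  exists (@mkPtm M 1 Hh) => n; rewrite /ptm_eval /=.
  by case: (H (nseq n true)) => d [-> []].
exists (mkVerifier id id id Pa Pb Pd); split=> //.
- by move=> x r; rewrite /qA /= Ha askA_ok.
- by move=> x r; rewrite /qB /= Hb askB_ok.
- move=> N D k r y z; rewrite /v_accepts /= Hd dec_ok.
  by case: reject.
Qed.

(** * The circuit described by an instance *)

Definition gk_val (g : gkind) (u v : bool) : bool :=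
  match g with
  | GZero => false | GOne => true | GAnd => u && v | GOr => u || v | GNot => ~~ u
  end.

Lemma succ_valsS D n :
  succ_vals D n.+1 = rcons (succ_vals D n) (sgate_val (succ_vals D n) (succ_gate D n)).
Proof. by rewrite {1}/succ_vals -addn1 iotaD foldl_cat. Qed.

Lemma size_succ_vals D n : size (succ_vals D n) = n.
Proof. by elim: n => // n IH; rewrite succ_valsS size_rcons IH. Qed.

Lemma nth_succ_vals D n i : i < n -> nth false (succ_vals D n) i = succ_value D i.
Proof.
elim: n => // n IH; rewrite ltnS leq_eqVlt => /orP[/eqP->|lt] //.
by rewrite -IH // succ_valsS nth_rcons size_succ_vals lt.
Qed.

Lemma succ_valueE D i g a b : succ_gate D i = Some (g, a, b) -> succ_gate_ok D i ->
  succ_value D i = gk_val g (succ_value D a) (succ_value D b).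
Proof.
rewrite /succ_gate_ok {1}/succ_value succ_valsS nth_rcons size_succ_vals ltnn eqxx => ->.
by case: g => //= [/andP[]|/andP[]|] *; rewrite !nth_succ_vals.
Qed.

Definition wbits (w i : nat) := mkseq (fun j => odd (i %/ 2 ^ j)) w.

(** Positions past the end read as false, in agreement with leading zeros; so evaluating a circuit
    on a bit string is the same as evaluating it at the number. *)
Lemma nth_num s j : nth false s j = odd (num_of_bits s %/ 2 ^ j).
Proof.
elim: s j => [|b s IH] [|j] /=; rewrite ?num_nil ?div0n // num_cons.
  by rewrite divn1 oddD oddM /= addbF; case: b.
rewrite IH expnS divnMA; congr (odd (_ %/ _)).
by rewrite addnC mulnC divnMDl // divn_small ?addn0 //; case: b.
Qed.

Lemma kind_valE D i g a b ya yb :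
  let o := dc_eval D (fun j => odd (i %/ 2 ^ j)) in
  3 <= size o -> succ_gate D i = Some (g, a, b) ->
  kind_val (nth false o 0) (nth false o 1) (nth false o 2) ya yb = gk_val g ya yb.
Proof.
move=> o; rewrite /succ_gate -/o; case: o => [|o0 [|o1 [|o2 o]]] //= _.
rewrite take0 !num_cons num_nil.
by case: o0; case: o1; case: o2 => //= -[<- _ _].
Qed.

Lemma rejectE N D k i j y z : succ_valid N D k ->
  reject N k (dc_eval D (nth false i)) i j y z =
  [&& size i == dc_nin D, num_of_bits i < N &
    if succ_gate D (num_of_bits i) is Some (g, a, b) then
      violation (gk_val g (nth false y 0) (nth false y 1)) (nth false y 0) (nth false y 1)
       (nth false z 0) (num_of_bits i == num_of_bits j) (a == num_of_bits j)
       (b == num_of_bits j) (k == num_of_bits j)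
    else false].
Proof.
case=> wf so NN kN ok; set w := dc_nin D in so *.
have so' inp : size (dc_eval D inp) = 3 + 2 * w by rewrite size_map.
have -> : nth false i = (fun j => odd (num_of_bits i %/ 2 ^ j)).
  by apply: funext => l; exact: nth_num.
set o := dc_eval _ _; have soo : size o = 3 + 2 * w by exact: so'.
rewrite /reject size_drop soo addKn eqn_mul2l /= eq_sym.
case: eqP => //= siw; case: ltnP => //= iN.
have := ok _ iN; rewrite /succ_gate_ok.
case E : (succ_gate D (num_of_bits i)) => [[[g a] b]|//] _.
rewrite (@kind_valE D _ g a b) ?soo //.
have [<- <-] : num_of_bits (take w (drop 3 o)) = a /\
    num_of_bits (take w (drop (3 + w) o)) = b.
  by move: E; rewrite /succ_gate -/o -/w; case: num_of_bits => [|[|[|[|[|]]]]] // [] _ -> ->.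
by rewrite siw drop_drop [w + 3]addnC.
Qed.

Definition rej N D k (r y z : seq bool) :=
  reject N k (dc_eval D (nth false (qi r))) (qi r) (qj r) y z.

(** It suffices to count the 3 + 2w output indices: each takes at least four bits, and each of the
    two enclosing encodings doubles them. *)
Lemma size_enc_inst N D k : size (dc_outs D) = 3 + 2 * dc_nin D ->
  32 * dc_nin D + 48 <= size (enc_inst N D k).
Proof.
move=> so.
have H os : 4 * size os <= size (enc_list (map bin os)).
  elim: os => [|a os IH] //; rewrite map_cons size_enc_list_cons.
  by have := size_bin a; move: IH => /=; lia.
have := H (dc_outs D); set u := enc_list _ => Hu.
have E1 : size (enc_dc D) >= 2 * size u.
  rewrite /enc_dc !size_enc_list_cons size_enc_list_nil -/u.
  by move: (size _) (size u) (size _) => *; lia.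
have E2 : size (enc_inst N D k) >= 2 * size (enc_dc D).
  rewrite /enc_inst (size_enc_list_cons (bin N)) size_enc_list2.
  by move: (size _) (size _) (size _) => *; lia.
by lia.
Qed.

Lemma question_exists n (u v : seq bool) : 2 * size u + 2 * size v + 4 <= n ->
  exists r : n.-tuple bool, qi r = u /\ qj r = v.
Proof.
move=> le; pose s := enc1 u ++ enc1 v ++ nseq (n - (2 * size u + 2 * size v + 4)) false.
have ss : size s == n by rewrite /s size_cat (size_cat (enc1 v)) !size_enc1 size_nseq; apply/eqP; lia.
by exists (Tuple ss); rewrite /qi /qj -[tval _]/s /s split1_enc1 [(_, _).2]/= split1_enc1.
Qed.

(** * A circuit with exponentially many layers *)

Section Hard.
Variable m : nat.

Definition hgate (t c : nat) : dgate :=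
  if t == 0 then DConst (c == 0) else
  match c with
  | 0 => DIn t
  | 1 => DAnd (5 * t.-1 + 2) (5 * t)
  | 2 => DOr (5 * t.-1 + 2) (5 * t)
  | 3 => DNot (5 * t + 2)
  | _ => DOr (5 * t + 1) (5 * t + 3)
  end.

Definition hgates := mkseq (fun p => hgate (p %/ 5) (p %% 5)) (5 * m.+1).

(** Block 0 holds the constants: position 0 is true and position 1 is false. The two index fields
    are therefore 2(h-1) and 2(h-1)+1, with bit t of h-1 at position 5(t+1)+4. The kind bits repeat
    the test that h is nonzero, giving code 3 (OR) or 0 (ZERO). *)
Definition houts := [:: 5 * m + 2; 5 * m + 2; 1] ++
  (1 :: mkseq (fun t => 5 * t + 9) m) ++ (0 :: mkseq (fun t => 5 * t + 9) m).

(* Gates 2h and 2h+1 both compute the OR of gates 2h-2 and 2h-1, and gates 0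
   and 1 are ZERO.  Within block t+1 the gates are: bit t of h, then its
   conjunction and disjunction with "one of the bits below t is set", the
   negation of the latter, and finally bit t of h-1. *)
Definition hcirc := mkDC m.+1 hgates houts.

Definition low (h t : nat) := h %% 2 ^ t != 0.
Definition pbit (h t : nat) := (low h t && odd (h %/ 2 ^ t)) || ~~ low h t.+1.

Definition hval (h t c : nat) : bool :=
  if t == 0 then c == 0 else
  match c with
  | 0 => odd (h %/ 2 ^ t.-1)
  | 1 => low h t.-1 && odd (h %/ 2 ^ t.-1)
  | 2 => low h t
  | 3 => ~~ low h t
  | _ => pbit h t.-1
  end.

Lemma modn_2S h t : h %% 2 ^ t.+1 = odd (h %/ 2 ^ t) * 2 ^ t + h %% 2 ^ t.
Proof.
rewrite {1}(divn_eq h (2 ^ t)) {1}(divn_eq (h %/ 2 ^ t) 2) modn2 mulnDl -mulnA -expnS -addnA.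
rewrite modnMDl modn_small // expnS; have := ltn_pmod h (expn_gt0 2 t).
by move: (h %% 2 ^ t) (2 ^ t) (odd _) => a b [] /=; lia.
Qed.

Lemma lowS h t : low h t.+1 = low h t || odd (h %/ 2 ^ t).
Proof.
rewrite /low modn_2S addn_eq0 muln_eq0 negb_and negb_or expn_eq0 /= orbC.
by case: odd; rewrite ?orbF ?orbT.
Qed.

(** The borrow of the subtraction h - 1 reaches bit t iff all lower bits of h vanish, and then it
    flips that bit. *)
Lemma pbitE h t : 0 < h -> pbit h t = odd (h.-1 %/ 2 ^ t).
Proof.
move=> h0; rewrite /pbit lowS negb_or /low.
have p0 : 0 < 2 ^ t by rewrite expn_gt0.
have [E|nE] := eqVneq (h %% 2 ^ t) 0 => /=.
  have := divn_eq h (2 ^ t); rewrite E addn0; case: (h %/ 2 ^ t) => [|q] Eh.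
    by rewrite Eh in h0.
  rewrite Eh mulSn (_ : (2 ^ t + q * 2 ^ t).-1 = q * 2 ^ t + (2 ^ t).-1); last by lia.
  by rewrite divnMDl // divn_small ?addn0 ?prednK //= negbK.
rewrite orbF; congr odd.
have := divn_eq h (2 ^ t); set q := h %/ _; set s := h %% _ => Eh.
rewrite Eh (_ : (q * 2 ^ t + s).-1 = q * 2 ^ t + s.-1); last by lia.
rewrite divnMDl // divn_small ?addn0 //.
by have := ltn_pmod h p0; rewrite -/s; lia.
Qed.

Lemma dvals_mkseq inp gs f :
  (forall p, p < size gs -> dgate_val inp (mkseq f p) (nth (DConst false) gs p) = f p) ->
  dvals inp [::] gs = mkseq f (size gs).
Proof.
elim/last_ind: gs => [|gs g IH] H //.
rewrite /dvals foldl_rcons -/(dvals _ _ _) IH; last first.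
  move=> p lp; have := H p; rewrite size_rcons nth_rcons lp; apply.
  exact: leq_trans lp (leqnSn _).
have := H (size gs); rewrite size_rcons nth_rcons ltnn eqxx => -> //.
by rewrite /mkseq -addn1 iotaD map_cat cats1.
Qed.

Lemma hdvals i : dvals (fun j => odd (i %/ 2 ^ j)) [::] hgates =
  mkseq (fun p => hval (i %/ 2) (p %/ 5) (p %% 5)) (5 * m.+1).
Proof.
set h := i %/ 2; set f := fun p => hval h (p %/ 5) (p %% 5).
rewrite (@dvals_mkseq _ _ f) size_mkseq // => p lp.
rewrite nth_mkseq //.
have fE t c : c < 5 -> f (5 * t + c) = hval h t c.
  by move=> c5; rewrite /f mulnC divnMDl // divn_small // addn0 modnMDl modn_small.
rewrite [RHS]/(hval h (p %/ 5) (p %% 5)).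
have := ltn_pmod p (isT : 0 < 5).
have arg q : q < p -> nth false (mkseq f p) q = f q by move=> qp; rewrite nth_mkseq.
have pE := divn_eq p 5; move: (p %/ 5) (p %% 5) pE => t c pE c5.
rewrite /hgate /hval; case: t pE => [|t] pE //=.
case: c pE c5 => [|[|[|[|[|//]]]]] pE _ /=; rewrite ?arg; try (by lia).
- by rewrite /h -divnMA -expnS.
- by rewrite fE // -[5 * t.+1]addn0 fE //= /hval; case: (t) => //; rewrite /low modn1.
- rewrite fE // -[5 * t.+1]addn0 fE //= /hval lowS; case: (t) => //; rewrite /low modn1 //.
- by rewrite fE.
- by rewrite !fE.
Qed.

Lemma hdc_eval i : let h := i %/ 2 in
  dc_eval hcirc (fun j => odd (i %/ 2 ^ j)) =
  [:: low h m; low h m; false] ++ (false :: mkseq (pbit h) m) ++ (true :: mkseq (pbit h) m).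
Proof.
move=> h; rewrite /dc_eval -/(dvals _ _ _) [dc_gates _]/= hdvals -/h.
set f := fun p => hval h (p %/ 5) (p %% 5).
have fE t c : c < 5 -> f (5 * t + c) = hval h t c.
  by move=> c5; rewrite /f mulnC divnMDl // divn_small // addn0 modnMDl modn_small.
have N t c : t <= m -> c < 5 -> nth false (mkseq f (5 * m.+1)) (5 * t + c) = hval h t c.
  by move=> tm c5; rewrite nth_mkseq ?fE //; lia.
have L : hval h m 2 = low h m by rewrite /hval /low; case: (m) => //; rewrite modn1.
have M : [seq nth false (mkseq f (5 * m.+1)) o | o <- mkseq (fun t => 5 * t + 9) m] = mkseq (pbit h) m.
  rewrite /mkseq -map_comp; apply/eq_in_map => t; rewrite mem_iota => /andP[_ tm] /=.
  by rewrite (_ : 5 * t + 9 = 5 * t.+1 + 4) ?N //; lia.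
rewrite /houts !map_cat !map_cons M !N // L.
by rewrite -{1 2}[1]/(5 * 0 + 1) -[in X in _ ++ X](_ : 5 * 0 + 0 = 0) // !N.
Qed.

Lemma num_ones n : num_of_bits (nseq n true) = (2 ^ n).-1.
Proof.
elim: n => [|n IH] /=; first by rewrite num_nil.
rewrite num_cons IH expnS; have : 0 < 2 ^ n by rewrite expn_gt0.
by move: (2 ^ n) => a /=; lia.
Qed.

(** At h = 0 the borrow runs through all bits, so the index fields of the ZERO gates name the two
    top gates. The verifier compares answers on these fields too, which the cheating strategy has to
    respect. *)
Lemma hsucc_gate i : 0 < m -> i < 2 ^ m.+1 ->
  succ_gate hcirc i = if i < 2 then Some (GZero, 2 * (2 ^ m).-1, (2 * (2 ^ m).-1).+1)
    else Some (GOr, 2 * (i %/ 2).-1, (2 * (i %/ 2).-1).+1).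
Proof.
move=> m0 im; rewrite /succ_gate hdc_eval [dc_nin _]/=; set h := i %/ 2.
have hm : h < 2 ^ m by rewrite /h ltn_divLR // mulnC -expnS.
have sm : size (mkseq (pbit h) m) = m by rewrite size_mkseq.
set a := false :: mkseq _ _; set b := true :: mkseq _ _.
have -> : take 3 ([:: low h m; low h m; false] ++ a ++ b) = [:: low h m; low h m; false] by [].
have -> : drop 3 ([:: low h m; low h m; false] ++ a ++ b) = a ++ b by [].
have -> : take m.+1 (a ++ b) = a by rewrite take_size_cat //= sm.
have -> : take m.+1 (drop (3 + m.+1) ([:: low h m; low h m; false] ++ a ++ b)) = b.
  rewrite addnC -drop_drop [drop 3 _](_ : _ = a ++ b) // drop_size_cat /= ?sm //.
  by rewrite take_oversize //= sm.
have -> : low h m = (h != 0) by rewrite /low modn_small.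
have -> : (i < 2) = (h == 0) by rewrite /h -leqn0 [_ <= 0]leqNgt divn_gt0 // -ltnNge.
rewrite !num_cons num_nil.
have -> : num_of_bits (mkseq (pbit h) m) = if h == 0 then (2 ^ m).-1 else h.-1.
  case: eqP => [h0|/eqP h0].
    rewrite -num_ones; congr num_of_bits; apply: (@eq_from_nth _ false); rewrite ?size_nseq ?sm // => t tm.
    by rewrite nth_mkseq // nth_nseq tm /pbit h0 /low !mod0n.
  rewrite -[RHS](@num_mkseq_bits m); last by apply: leq_ltn_trans hm; exact: leq_pred.
  by congr num_of_bits; apply: eq_mkseq => t; rewrite pbitE // lt0n.
by case: eqP => h0 /=.
Qed.

Lemma hvalid : 0 < m -> succ_valid (2 ^ m.+1) hcirc (2 ^ m.+1).-1.
Proof.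
move=> m0; split.
- apply/andP; split.
    apply/forallP => -[p lp']; have lp : p < 5 * m.+1 by move: lp'; rewrite size_mkseq.
    rewrite [nat_of_ord _]/= nth_mkseq //; clear lp'.
    have := ltn_pmod p (isT : 0 < 5); have pE := divn_eq p 5.
    move: (p %/ 5) (p %% 5) pE => t c pE c5; rewrite /hgate.
    case: t pE => [|t] pE //=.
    by case: c pE c5 => [|[|[|[|[|//]]]]] pE _ /=; lia.
  rewrite [dc_gates _]/= size_mkseq [dc_outs _]/= /houts.
  have H : all (fun o => o < 5 * m.+1) (mkseq (fun t => 5 * t + 9) m).
    by apply/allP => o /mapP[t]; rewrite mem_iota => ? ->; lia.
  by rewrite !all_cat /= !H; lia.
- by rewrite /houts !size_cat /= !size_mkseq; lia.
- by [].
- by rewrite prednK ?expn_gt0.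
- move=> i iN; rewrite /succ_gate_ok hsucc_gate //.
  case: ltnP => //= i2; have := divn_eq i 2; have := ltn_pmod i (isT : 0 < 2).
  have : 0 < i %/ 2 by rewrite divn_gt0.
  by move: (i %/ 2) (i %% 2) => h c; lia.
Qed.

Lemma hvalue i : 0 < m -> i < 2 ^ m.+1 -> succ_value hcirc i = false.
Proof.
move=> m0; elim/ltn_ind: i => i IH iN.
have [_ _ _ _ /(_ i iN) ok] := hvalid m0.
have := ok; rewrite /succ_gate_ok; have := hsucc_gate m0 iN; case: ltnP => i2 E.
  by rewrite (succ_valueE E ok).
rewrite E => /andP[ai bi]; rewrite (succ_valueE E ok) /=.
by rewrite !IH //; apply: ltn_trans iN.
Qed.

End Hard.

(** * Length of the hard instances *)

Lemma size_bin_le a : size (bin a) <= a.+1.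
Proof.
rewrite size_mkseq ltnS; case: a => [|a]; first by rewrite trunc_log0.
apply: leq_trans (trunc_logP (isT : 1 < 2) (ltn0Sn a)); exact/ltnW/ltn_expl.
Qed.

Lemma size_enc_list_le us b : all (fun u => size u <= b) us ->
  size (enc_list us) <= size us * (2 * b + 2).
Proof.
elim: us => [|u us IH] //= /andP[ub /IH]; rewrite size_enc_list_cons mulSn.
by move=> H; apply: leq_add => //; rewrite leq_add2r leq_mul2l.
Qed.

Lemma size_enc_dgate g b :
  match g with
  | DIn i => i < b | DConst _ => 0 < b
  | DAnd a c | DOr a c => (a < b) && (c < b)
  | DNot a => a < b end -> size (enc_dgate g) <= 4 * b + 12.
Proof.
have S1 u v : size (enc_list [:: u; v]) = 2 * size u + 2 + (2 * size v + 2) := size_enc_list2 u v.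
case: g => [i|c|a c|a c|a] H; rewrite /enc_dgate.
- by rewrite S1 [size (_ :: _)]/=; have := size_bin_le i; lia.
- by rewrite S1 /=; lia.
- rewrite size_enc_list_cons S1 [size (_ :: _)]/=; case/andP: H; have := size_bin_le a; have := size_bin_le c; lia.
- rewrite size_enc_list_cons S1 [size (_ :: _)]/=; case/andP: H; have := size_bin_le a; have := size_bin_le c; lia.
- by rewrite S1 [size (_ :: _)]/=; have := size_bin_le a; lia.
Qed.

(** The length of a gate index is estimated by its value, which is crude but linear in [M]; any
    polynomial bound yields some positive exponent in the tightness claim. *)
Lemma size_hard M : 7 <= M ->
  size (enc_inst (2 ^ M.+2) (hcirc M.+1) (2 ^ M.+2).-1) <= (100 * M) * (100 * M).
Proof.
move=> M7; have [m Em] : exists m, m = M.+1 by exists M.+1.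
rewrite -Em.
have G : size (enc_list (map enc_dgate (hgates m))) <= (5 * m.+1) * (2 * (4 * (5 * m.+1) + 12) + 2).
  have := @size_enc_list_le (map enc_dgate (hgates m)) (4 * (5 * m.+1) + 12).
  rewrite size_map size_mkseq; apply.
  rewrite /hgates !all_map; apply/allP => p; rewrite mem_iota => /andP[_ lp].
  apply: size_enc_dgate; have := ltn_pmod p (isT : 0 < 5); have pE := divn_eq p 5.
  move: (p %/ 5) (p %% 5) pE => t c pE c5; rewrite /hgate.
  case: t pE => [|t] pE //=.
  by case: c pE c5 => [|[|[|[|[|//]]]]] pE _ /=; lia.
have O : size (enc_list (map bin (houts m))) <= (3 + 2 * m.+1) * (2 * (5 * m + 10) + 2).
  have := @size_enc_list_le (map bin (houts m)) (5 * m + 10).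
  have -> : size (map bin (houts m)) = 3 + 2 * m.+1.
    by rewrite size_map; case: (@hvalid m); rewrite ?Em.
  apply; rewrite all_map; apply: (@sub_all _ (fun a => a < 5 * m + 10)).
    by move=> a; apply: leq_trans (size_bin_le a).
  have H : all (fun o => o < 5 * m + 10) (mkseq (fun t => 5 * t + 9) m).
    by apply/allP => o /mapP[t]; rewrite mem_iota => ? ->; lia.
  by rewrite /houts !all_cat /= !H; lia.
have Dc : size (enc_dc (hcirc m)) <= 2 * m.+2 + 2 +
   (2 * ((5 * m.+1) * (2 * (4 * (5 * m.+1) + 12) + 2)) + 2 +
   (2 * ((3 + 2 * m.+1) * (2 * (5 * m + 10) + 2)) + 2)).
  rewrite /enc_dc (size_enc_list_cons (bin _)) size_enc_list2.
  apply: leq_add; last apply: leq_add; rewrite leq_add2r leq_mul2l //=.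
  exact: size_bin_le.
(* [N] and [k] are exponential in [m], so for them the logarithmic length is required. *)
have B1 : size (bin (2 ^ m.+1)) <= m.+2 by rewrite size_mkseq ltnS trunc_expnK.
have B2 : size (bin (2 ^ m.+1).-1) <= m.+2.
  rewrite size_mkseq ltnS -[X in _ <= X](@trunc_expnK 2 m.+1) //.
  exact: leq_trunc_log (leq_pred _).
rewrite /enc_inst (size_enc_list_cons (bin _)) size_enc_list2.
apply: leq_trans (leq_add (leq_add (leq_mul (leqnn 2) B1) (leqnn 2))
  (leq_add (leq_add (leq_mul (leqnn 2) Dc) (leqnn 2)) (leq_add (leq_mul (leqnn 2) B2) (leqnn 2)))) _.
by rewrite Em; clear -M7; nia.
Qed.

Local Open Scope ring_scope.

(** * Soundness *)

Section Prob.
Variables (la lb : nat) (P : strategy la lb).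
Hypothesis HP : no_signaling P.

Definition pr s t (E : seq bool -> seq bool -> bool) : R :=
  \sum_(y : la.-tuple bool) \sum_(z : lb.-tuple bool) P s t y z * (E y z)%:R.

Lemma pr_le s t (E F : seq bool -> seq bool -> bool) :
  (forall y z, E y z -> F y z) -> pr s t E <= pr s t F.
Proof.
move=> EF; apply: ler_sum => y _; apply: ler_sum => z _.
case: HP => P0 _ _ _; apply: ler_wpM2l => //.
by rewrite ler_nat; have := EF y z; case: (E y z) => // ->.
Qed.

Lemma pr_or s t (E F : seq bool -> seq bool -> bool) :
  pr s t (fun y z => E y z || F y z) <= pr s t E + pr s t F.
Proof.
rewrite -big_split /=; apply: ler_sum => y _; rewrite -big_split /=; apply: ler_sum => z _.
case: HP => P0 _ _ _; rewrite -mulrDr; apply: ler_wpM2l => //.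
by rewrite -natrD ler_nat; case: (E y z); case: (F y z).
Qed.

Lemma pr_true s t : pr s t (fun _ _ => true) = 1.
Proof.
case: HP => _ /(_ s t) <- _ _; apply: eq_bigr => y _; apply: eq_bigr => z _.
by rewrite mulr1.
Qed.

Lemma pr_false s t : pr s t (fun _ _ => false) = 0.
Proof. by apply: big1 => y _; apply: big1 => z _; rewrite mulr0. Qed.

Lemma pr_ge0 s t E : 0 <= pr s t E.
Proof. by rewrite -(pr_false s t); apply: pr_le. Qed.

Lemma prC s t E : pr s t (fun y z => ~~ E y z) = 1 - pr s t E.
Proof.
rewrite -(pr_true s t) -sumrB; apply: eq_bigr => y _; rewrite -sumrB.
by apply: eq_bigr => z _; rewrite -mulrBr; case: (E y z); rewrite ?subrr ?subr0.
Qed.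

Lemma pr_alice s t t' (E : seq bool -> bool) :
  pr s t (fun y _ => E y) = pr s t' (fun y _ => E y).
Proof.
by case: HP => _ _ _ H; apply: eq_bigr => y _; rewrite -!mulr_suml (H s t t').
Qed.

Lemma pr_bob s s' t (E : seq bool -> bool) :
  pr s t (fun _ z => E z) = pr s' t (fun _ z => E z).
Proof.
case: HP => _ _ H _; rewrite /pr exchange_big [RHS]exchange_big.
by apply: eq_bigr => z _; rewrite -!mulr_suml (H s s' t).
Qed.

End Prob.

Section Soundness.
Variables (N : nat) (D : dcircuit) (k la lb : nat) (P : strategy la lb) (delta : R).
Hypothesis valid : succ_valid N D k.
Hypothesis HP : no_signaling P.
Let w := dc_nin D.
Let q i := rev (wbits w i).
Hypothesis small : forall i j, (i < N)%N -> (j < N)%N ->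
  pr P (q i) (q j) (fun y z =>
    reject N k (dc_eval D (nth false (wbits w i))) (wbits w i) (wbits w j) y z) <= delta.

Let wrong v (y : seq bool) c := nth false y c != succ_value D v.
(** By no-signaling Alice's question is immaterial here, and [[::]] is an arbitrary choice. *)
Let err j := pr P [::] (q j) (fun _ z => wrong j z 0).

Lemma num_wbits i : (i < N)%N -> num_of_bits (wbits w i) = i.
Proof. by case: valid => _ _ NN _ _ iN; apply: num_mkseq_bits; apply: leq_trans iN NN. Qed.

Lemma pr_violation i j g a b : (i < N)%N -> (j < N)%N -> succ_gate D i = Some (g, a, b) ->
  pr P (q i) (q j) (fun y z =>
      violation (gk_val g (nth false y 0) (nth false y 1)) (nth false y 0) (nth false y 1)
       (nth false z 0) (i == j) (a == j) (b == j) (k == j)) <= delta.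
Proof.
move=> iN jN E; apply: le_trans (small iN jN); apply: pr_le => // y z.
by rewrite rejectE // !num_wbits // size_mkseq eqxx iN E.
Qed.

(** Alice's marginal allows Bob's question to be moved to the input [j] itself. There a wrong bit of
    Alice means that either the two bits differ, which is a violation, or Bob is wrong as well. *)
Lemma alice_input_err i j g a b c : (i < N)%N -> (j < N)%N -> succ_gate D i = Some (g, a, b) ->
  (c == 0)%N && (a == j) || (c == 1)%N && (b == j) ->
  forall t, pr P (q i) t (fun y _ => wrong j y c) <= delta + err j.
Proof.
move=> iN jN E Hc t; rewrite (pr_alice HP _ t (q j)).
have := pr_violation iN jN E => H.
apply: le_trans (lerD H (lexx _)); rewrite /err (pr_bob HP [::] (q i)).
apply: le_trans (pr_or HP _ _ _ _); apply: pr_le => // y z.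
rewrite /wrong /violation.
case/orP: Hc => /andP[/eqP-> /eqP->]; rewrite eqxx /=;
  by case: (nth false y _); case: (nth false z 0); case: (succ_value D j); rewrite ?orbT.
Qed.

Lemma err_bound i : (i < N)%N -> err i <= 3 * (2 ^+ i.+1 - 1) * delta.
Proof.
have d0 : (0 < N)%N -> 0 <= delta.
  by move=> N0; apply: le_trans (small N0 N0); apply: pr_ge0.
elim/ltn_ind: i => i IH iN.
have {}d0 : 0 <= delta by apply: d0; apply: leq_ltn_trans iN.
case: (valid) => _ _ _ _ /(_ i iN) ok.
case E : (succ_gate D i) (ok) => [[[g a] b]|]; rewrite /succ_gate_ok E // => ok'.
have V := succ_valueE E ok.
have mono j : (j < i)%N -> err j <= 3 * (2 ^+ i - 1) * delta.
  move=> ji; apply: le_trans (IH j ji (ltn_trans ji iN)) _.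
  apply: ler_wpM2r => //; apply: ler_wpM2l => //; rewrite lerD2r.
  by rewrite ler_weXn2l // ler1n.
have p1 : 1 <= 2 ^+ i :> R by rewrite exprn_ege1 // ler1n.
(* The gate function of Alice's bits is wrong only if one of them is; each is wrong with probability
   at most [delta] plus the bound for a smaller index. *)
have H : pr P (q i) (q i) (fun y _ => gk_val g (nth false y 0) (nth false y 1) != succ_value D i)
    <= 2 * delta + 6 * (2 ^+ i - 1) * delta.
  have pos : 0 <= 2 * delta + 6 * (2 ^+ i - 1) * delta.
    by rewrite addr_ge0 // !mulr_ge0 // subr_ge0.
  case: g E ok' V => E ok' /= V.
  - by apply: le_trans pos; rewrite -(pr_false P (q i) (q i)); apply: pr_le => // y z; rewrite V.
  - by apply: le_trans pos; rewrite -(pr_false P (q i) (q i)); apply: pr_le => // y z; rewrite V.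
  - case/andP: ok' => ai bi.
    have Ha := @alice_input_err i a _ a b 0 iN (ltn_trans ai iN) E _ (q i).
    have Hb := @alice_input_err i b _ a b 1 iN (ltn_trans bi iN) E _ (q i).
    apply: (@le_trans _ _ ((delta + err a) + (delta + err b))).
      apply: le_trans (lerD (Ha _) (Hb _)); rewrite ?eqxx ?orbT //.
      apply: le_trans (pr_or HP _ _ _ _); apply: pr_le => // y z; rewrite /wrong V.
      by case: (nth _ y 0); case: (nth _ y 1); case: (succ_value D a); case: (succ_value D b).
    by have := mono a ai; have := mono b bi; lra.
  - case/andP: ok' => ai bi.
    have Ha := @alice_input_err i a _ a b 0 iN (ltn_trans ai iN) E _ (q i).
    have Hb := @alice_input_err i b _ a b 1 iN (ltn_trans bi iN) E _ (q i).
    apply: (@le_trans _ _ ((delta + err a) + (delta + err b))).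
      apply: le_trans (lerD (Ha _) (Hb _)); rewrite ?eqxx ?orbT //.
      apply: le_trans (pr_or HP _ _ _ _); apply: pr_le => // y z; rewrite /wrong V.
      by case: (nth _ y 0); case: (nth _ y 1); case: (succ_value D a); case: (succ_value D b).
    by have := mono a ai; have := mono b bi; lra.
  - have Ha := @alice_input_err i a _ a b 0 iN (ltn_trans ok' iN) E _ (q i).
    apply: (@le_trans _ _ (delta + err a)).
      apply: le_trans (Ha _); rewrite ?eqxx //.
      apply: pr_le => // y z; rewrite /wrong V.
      by case: (nth _ y 0); case: (succ_value D a).
    have := mono a ok'; have : 0 <= 3 * (2 ^+ i - 1) * delta by rewrite !mulr_ge0 // subr_ge0.
    by lra.
have H2 : err i <= delta + (2 * delta + 6 * (2 ^+ i - 1) * delta).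
  apply: le_trans (lerD (pr_violation iN iN E) H); rewrite /err (pr_bob HP [::] (q i)).
  apply: le_trans (pr_or HP _ _ _ _); apply: pr_le => // y z.
  rewrite /wrong /violation eqxx /=.
  by case: (nth false z 0); case: gk_val; case: (succ_value D i); rewrite ?orbT.
by apply: le_trans H2 _; rewrite exprS; lra.
Qed.

(** On gate [k] the answer 0 is a violation and the answer 1 is an error, so 1 <= [delta] + [err k].
    The total coefficient 6 2^k - 2 is below 2^(k+3), and k < N. *)
Lemma delta_lower : ~~ succ_value D k -> 1 <= 2 ^+ N.+2 * delta.
Proof.
move=> vk; case: (valid) => _ _ _ kN ok.
have okk := ok k kN.
case E : (succ_gate D k) (okk) => [[[g a] b]|]; rewrite /succ_gate_ok E // => _.
have H1 := pr_violation kN kN E.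
have H2 := err_bound kN.
have d0 : 0 <= delta by apply: le_trans H1; apply: pr_ge0.
have : 1 <= delta + err k.
  apply: le_trans (lerD H1 (lexx _)); rewrite /err (pr_bob HP [::] (q k)) -(pr_true HP (q k) (q k)).
  apply: le_trans (pr_or HP _ _ _ _); apply: pr_le => // y z _.
  rewrite /wrong (negbTE vk) /violation eqxx.
  by case: (nth false z 0); rewrite ?orbT.
have : 2 ^+ k.+3 * delta <= 2 ^+ N.+2 * delta.
  by apply: ler_wpM2r => //; rewrite ler_weXn2l // ler1n.
have : 0 <= 2 ^+ k * delta by rewrite mulr_ge0 // exprn_ge0.
move: H2; rewrite !exprS; lra.
Qed.

End Soundness.

(** * From single question pairs to the acceptance probability *)

Section Game.
Variables (V : verifier) (N : nat) (D : dcircuit) (k : nat).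
Let x := enc_inst N D k.
Let n := size x.
Hypothesis valid : succ_valid N D k.
Hypothesis Vm : v_m V n = n.
Hypothesis VA : forall x r, qA V x r = rev (qi r).
Hypothesis VB : forall x r, qB V x r = rev (qj r).
Hypothesis Vacc : forall r y z, v_accepts V x r y z = ~~ rej N D k r y z.

Lemma acc_probE P : no_signaling P -> acc_prob V x P =
  1 - (2 ^+ n)^-1 * \sum_(r : n.-tuple bool) pr P (rev (qi r)) (rev (qj r)) (rej N D k r).
Proof.
move=> HP; rewrite /acc_prob -/n.
transitivity ((2 ^+ n)^-1 * \sum_(r : n.-tuple bool)
    (1 - pr P (rev (qi r)) (rev (qj r)) (rej N D k r))).
  rewrite Vm; congr (_ * _); apply: eq_bigr => r _; rewrite -prC //.
  by apply: eq_bigr => y _; apply: eq_bigr => z _; rewrite VA VB Vacc.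
rewrite sumrB mulrBr; congr (_ - _).
rewrite sumr_const card_tuple card_bool -[X in _ * X]mulr_natl mulr1 natrX mulVf //.
by rewrite expf_neq0 // pnatr_eq0.
Qed.

Lemma soundness P : succ_value D k = false -> no_signaling P ->
  acc_prob V x P <= 1 - (2^-1) ^+ (2 ^ n)%N.
Proof.
move=> vk HP; rewrite acc_probE //; set S := \sum_r _.
have p0 : 0 < 2 ^+ n :> R by rewrite exprn_gt0.
have sz : (32 * dc_nin D + 48 <= n)%N by case: valid => _ so _ _ _; apply: size_enc_inst.
(* The sum [S] over all coin strings plays the part of [delta]: it dominates the failure on any pair
   produced by at least one string. *)
have small i j : (i < N)%N -> (j < N)%N ->
    pr P (rev (wbits (dc_nin D) i)) (rev (wbits (dc_nin D) j)) (fun y z =>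
    reject N k (dc_eval D (nth false (wbits (dc_nin D) i))) (wbits (dc_nin D) i)
      (wbits (dc_nin D) j) y z) <= S.
  move=> iN jN.
  have [|r [E1 E2]] := @question_exists n (wbits (dc_nin D) i) (wbits (dc_nin D) j).
    by rewrite !size_mkseq; lia.
  rewrite /S (bigD1 r) //= /rej E1 E2 lerDl.
  by apply: sumr_ge0 => r' _; apply: pr_ge0.
have := delta_lower valid HP small; rewrite vk => /(_ isT) H.
rewrite lerD2l lerN2.
(* One half of 2^n absorbs [N], as the width is below [n]; the other half absorbs n + 2. *)
have le : (n + N.+2 <= 2 ^ n)%N.
  have H1 : (N <= 2 ^ n.-1)%N.
    case: valid => _ _ NN _ _; apply: leq_trans NN _; rewrite leq_pexp2l //.
    by move: sz; clear; move: (dc_nin D) n => *; lia.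
  have H2 : (n + 2 <= 2 ^ n.-1)%N.
    have : (4 <= n)%N by move: sz; clear; move: (dc_nin D) n => *; lia.
    move: (n) => m; case: m => // m; elim: m => // m IH.
    rewrite leq_eqVlt => /orP[/eqP<- //|]; rewrite ltnS => /IH /=.
    by rewrite expnS; clear; move: (2 ^ m)%N => *; lia.
  have n0 : (0 < n)%N by move: sz; clear; move: (dc_nin D) n => *; lia.
  rewrite -{2}(prednK n0) expnS; move: H1 H2; clear; move: (2 ^ n.-1)%N n => *; lia.
apply: (@le_trans _ _ ((2^-1) ^+ (n + N.+2))).
  by rewrite ler_wiXn2l // ?invr_ge0 ?invf_le1 // ler1n.
rewrite exprD !exprVn ler_pM2l ?invr_gt0 //.
by rewrite -[X in X <= _]mulr1 ler_pdivrMl ?exprn_gt0.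
Qed.

End Game.

(** * Strategies with one- and two-bit answers *)

Section Embed.
Variables (la lb : nat).
Hypotheses (la2 : (1 < la)%N) (lb1 : (0 < lb)%N).
Variable mu : seq bool -> seq bool -> bool * bool -> bool -> R.

Definition embA (u : bool * bool) : la.-tuple bool :=
  [tuple nth false [:: u.1; u.2] i | i < la].
Definition embB (v : bool) : lb.-tuple bool := [tuple nth false [:: v] i | i < lb].

Lemma nth_embA u : nth false (embA u) 0 = u.1 /\ nth false (embA u) 1 = u.2.
Proof.
have l0 : (0 < la)%N := ltnW la2.
by rewrite -[0%N]/(val (Ordinal l0)) -[1%N]/(val (Ordinal la2)) -!tnth_nth !tnth_mktuple.
Qed.

Lemma nth_embB v : nth false (embB v) 0 = v.
Proof. by rewrite -[0%N]/(val (Ordinal lb1)) -!tnth_nth !tnth_mktuple. Qed.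

(** Answers have length |x|, but the verifier reads two bits of Alice and one of Bob. A table over
    these bits is carried to point masses on answers padded with false, which preserves
    nonnegativity, total mass and marginals. *)
Definition embed : strategy la lb := fun s t y z =>
  \sum_u \sum_v mu s t u v * ((y == embA u)%:R * (z == embB v)%:R).

Definition ns_table : Prop :=
  [/\ (forall s t u v, 0 <= mu s t u v),
      (forall s t, \sum_u \sum_v mu s t u v = 1),
      (forall s s' t v, \sum_u mu s t u v = \sum_u mu s' t u v)
    & (forall s t t' u, \sum_v mu s t u v = \sum_v mu s t' u v)].

Lemma sum_pick (T : finType) (a : T) (f : T -> R) : \sum_y (y == a)%:R * f y = f a.
Proof.
rewrite (bigD1 a) //= eqxx mul1r big1 ?addr0 // => y /negbTE->.
by rewrite mul0r.
Qed.

Lemma pr_embed s t E : pr embed s t E = \sum_u \sum_v mu s t u v * (E (embA u) (embB v))%:R.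
Proof.
rewrite /pr /embed.
under eq_bigr => y _ do under eq_bigr => z _ do rewrite mulr_suml.
under eq_bigr => y _ do rewrite exchange_big /=.
rewrite exchange_big; apply: eq_bigr => u _.
under eq_bigr => y _ do under eq_bigr => z _ do rewrite mulr_suml.
under eq_bigr => y _ do rewrite exchange_big /=.
rewrite exchange_big; apply: eq_bigr => v _.
under eq_bigr => y _ do under eq_bigr => z _ do rewrite -mulrA -mulrA mulrCA.
under eq_bigr => y _ do rewrite -mulr_sumr.
rewrite sum_pick.
under eq_bigr => z _ do rewrite mulrCA.
by rewrite sum_pick.
Qed.

Lemma sum_embed_alice s t z : \sum_y embed s t y z = \sum_v (\sum_u mu s t u v) * (z == embB v)%:R.
Proof.
rewrite /embed exchange_big /=.
under eq_bigr => u _.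
  rewrite exchange_big /=.
  under eq_bigr => v _.
    under eq_bigr => y _ do rewrite mulrCA.
    rewrite sum_pick.
    over.
  over.
by rewrite exchange_big /=; apply: eq_bigr => v _; rewrite mulr_suml.
Qed.

Lemma sum_embed_bob s t y : \sum_z embed s t y z = \sum_u (\sum_v mu s t u v) * (y == embA u)%:R.
Proof.
rewrite /embed exchange_big /=; apply: eq_bigr => u _.
rewrite exchange_big /= mulr_suml; apply: eq_bigr => v _.
under eq_bigr => z _ do rewrite mulrA mulrC.
by rewrite sum_pick.
Qed.

Lemma embed_ns : ns_table -> no_signaling embed.
Proof.
case=> mu0 mu1 muA muB; split.
- by move=> s t y z; do 2 apply: sumr_ge0 => ? _; rewrite !mulr_ge0.
- move=> s t; rewrite -(mu1 s t).
  transitivity (pr embed s t (fun _ _ => true)).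
    by apply: eq_bigr => y _; apply: eq_bigr => z _; rewrite mulr1.
  by rewrite pr_embed; apply: eq_bigr => y _; apply: eq_bigr => z _; rewrite mulr1.
- by move=> s s' t z; rewrite !sum_embed_alice; apply: eq_bigr => v _; rewrite (muA s s').
- by move=> s t t' y; rewrite !sum_embed_bob; apply: eq_bigr => v _; rewrite (muB s t t').
Qed.

End Embed.

(** * Completeness *)

Section Completeness.
Variables (N : nat) (D : dcircuit) (k : nat).
Hypothesis valid : succ_valid N D k.

(** The questions reach the provers reversed, hence [rev]. Being a product of point masses that each
    depend on one question, the strategy cannot signal. *)
Definition honest (s t : seq bool) (u : bool * bool) (v : bool) : R :=
  (u == if succ_gate D (num_of_bits (rev s)) is Some (_, a, b)
        then (succ_value D a, succ_value D b) else (false, false))%:R *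
  (v == succ_value D (num_of_bits (rev t)))%:R.

Lemma sum_delta (T : finType) (a : T) : \sum_y (y == a)%:R = 1 :> R.
Proof. by rewrite -[RHS]/((fun=> 1) a) -sum_pick; apply: eq_bigr => y _; rewrite mulr1. Qed.

Lemma honest_ns : ns_table honest.
Proof.
split=> [s t u v|s t|s s' t v|s t t' u].
- by rewrite /honest mulr_ge0.
- rewrite /honest; under eq_bigr => u _ do rewrite -mulr_sumr sum_delta mulr1.
  exact: sum_delta.
- by rewrite /honest -!mulr_suml !sum_delta.
- by rewrite /honest -!mulr_sumr !sum_delta.
Qed.

Lemma honest_accepted (la lb : nat) (r : seq bool) : (1 < la)%N -> (0 < lb)%N -> succ_value D k ->
  pr (embed (la := la) (lb := lb) honest) (rev (qi r)) (rev (qj r)) (rej N D k r) = 0.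
Proof.
move=> la2 lb1 vk; rewrite pr_embed big1 // => u _; rewrite big1 // => v _.
rewrite /honest !revK; case: eqP => [Eu|]; last by rewrite !mul0r.
case: eqP => [Ev|]; last by rewrite mulr0 mul0r.
rewrite /rej rejectE //; have [-> ->] := nth_embA la2 u; rewrite (nth_embB lb1).
case: eqP => // sz; case: (ltnP _ N) => iN; rewrite ?andbF ?mulr0 //.
case: valid => _ _ _ _ ok; have {}ok := ok _ iN.
case E : (succ_gate D (num_of_bits (qi r))) Eu => [[[g a] b]|] Eu; rewrite ?mulr0 //.
have V := succ_valueE E ok.
rewrite (_ : violation _ _ _ _ _ _ _ _ = false) ?mulr0 //.
rewrite /violation Ev Eu /= -V.
apply/negbTE; rewrite !negb_or !negb_and !negbK; apply/and4P; split.
- by case: (_ =P num_of_bits (qj r)) => [->|_] //=; rewrite eqxx.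
- by case: (_ =P num_of_bits (qj r)) => [->|_] //=; rewrite eqxx.
- by case: (_ =P num_of_bits (qj r)) => [->|_] //=; rewrite eqxx.
- by case: (_ =P num_of_bits (qj r)) => [<-|_] //=.
Qed.

End Completeness.

(** * Tightness *)

Section Cheat.
Variable m : nat.
Hypothesis m0 : (0 < m)%N.
Let N := (2 ^ m.+1)%N.

(* Bob claims that a gate of layer h has value 1 with probability [layer_prob h];
   it doubles from each layer to the next and equals 1 on the top layer. *)
Definition layer_prob (h : nat) : R := (2^-1) ^+ ((2 ^ m).-1 - h).

Definition or_gate (i : nat) := (1 < i < N)%N.

(* For an OR gate Alice never claims that both inputs are 1, which lets the
   value of the gate be 1 twice as often as each input. *)
Definition cheat_alice (i : nat) (u : bool * bool) : R :=
  if or_gate i then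
    match u with
    | (true, true) => 0
    | (false, false) => 1 - layer_prob (i %/ 2)
    | _ => layer_prob (i %/ 2).-1
    end
  else (u == (true, true))%:R.

Definition cheat_bob (j : nat) (v : bool) : R :=
  if v then layer_prob (j %/ 2) else 1 - layer_prob (j %/ 2).

(** Whenever Bob's gate bears on Alice's OR gate, his bit is made a function of her pair, so that
    the comparison cannot fail; otherwise the two answers are independent. Both gates of the layer
    of [i] are tied to the disjunction. *)
Definition link (i j : nat) : option (bool * bool -> bool) :=
  if ~~ or_gate i then None
  else if (j %/ 2 == i %/ 2)%N then Some (fun u => u.1 || u.2)
  else if (j == 2 * (i %/ 2).-1)%N then Some fst
  else if (j == (2 * (i %/ 2).-1).+1)%N then Some snd
  else None.

Definition cheat_pair (i j : nat) (u : bool * bool) (v : bool) : R :=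
  cheat_alice i u * (if link i j is Some f then (v == f u)%:R else cheat_bob j v).

Definition cheat (s t : seq bool) := cheat_pair (num_of_bits (rev s)) (num_of_bits (rev t)).

Lemma layer_prob_ge0 h : 0 <= layer_prob h.
Proof. by rewrite exprn_ge0 // invr_ge0. Qed.

Lemma layer_prob_le1 h : layer_prob h <= 1.
Proof. by rewrite exprn_ile1 // ?invr_ge0 // invf_le1 // ler1n. Qed.

Lemma layer_probD i : or_gate i -> layer_prob (i %/ 2) = 2 * layer_prob (i %/ 2).-1.
Proof.
case/andP=> i1 iN; rewrite /layer_prob.
have h0 : (0 < i %/ 2)%N by rewrite divn_gt0.
have hm : (i %/ 2 < 2 ^ m)%N by rewrite ltn_divLR // mulnC -expnS.
have -> : ((2 ^ m).-1 - (i %/ 2).-1)%N = ((2 ^ m).-1 - i %/ 2).+1.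
  by move: h0 hm; clear; move: (i %/ 2)%N (2 ^ m)%N => *; lia.
by rewrite exprS mulrA mulfV ?mul1r // pnatr_eq0.
Qed.

Lemma sum_bool2 (f : bool * bool -> R) :
  \sum_u f u = f (true, true) + f (true, false) + (f (false, true) + f (false, false)).
Proof.
rewrite (eq_bigr (fun u => f (u.1, u.2))); last by case.
by rewrite -(pair_bigA _ (fun a b => f (a, b))) /= !big_bool.
Qed.

Lemma sum_cheat_alice i : \sum_u cheat_alice i u = 1.
Proof.
rewrite sum_bool2 /cheat_alice; case: ifP => [/layer_probD ->|_] /=; last by rewrite !addr0.
by lra.
Qed.

Lemma cheat_alice_ge0 i u : 0 <= cheat_alice i u.
Proof.
rewrite /cheat_alice; case: ifP => // _; case: u => [[] []] //; try exact: layer_prob_ge0.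
by rewrite subr_ge0 layer_prob_le1.
Qed.

Lemma cheat_bob_ge0 j v : 0 <= cheat_bob j v.
Proof.
by rewrite /cheat_bob; case: v; rewrite ?layer_prob_ge0 // subr_ge0 layer_prob_le1.
Qed.

Lemma sum_cheat_v i j u : \sum_v cheat_pair i j u v = cheat_alice i u.
Proof.
rewrite /cheat_pair -mulr_sumr big_bool /=; case: link => [f|].
  by case: (f u); rewrite /= ?addr0 ?add0r mulr1.
by rewrite /cheat_bob addrC subrK mulr1.
Qed.

(** Bob's marginal survives the coupling: either coordinate is 1 with the probability of the layer
    below, and since both are never 1 together the disjunction has twice that, the probability of
    the layer itself. *)
Lemma sum_cheat_u i j v : \sum_u cheat_pair i j u v = cheat_bob j v.
Proof.
rewrite /cheat_pair /link; case: (boolP (or_gate i)) => io /=; last first.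
  by rewrite -mulr_suml sum_cheat_alice mul1r.
have D := layer_probD io.
have d2 a : ((2 * a)%N %/ 2)%N = a by rewrite mulKn.
have d3 a : ((2 * a).+1 %/ 2)%N = a by rewrite -addn1 mulnC divnMDl // addn0.
case: eqP => [jh|_].
  by rewrite sum_bool2 /cheat_alice io /cheat_bob jh D; case: v => /=; lra.
case: eqP => [->|_].
  by rewrite sum_bool2 /cheat_alice io /cheat_bob d2 D; case: v => /=; lra.
case: eqP => [->|_].
  by rewrite sum_bool2 /cheat_alice io /cheat_bob d3 D; case: v => /=; lra.
by rewrite -mulr_suml sum_cheat_alice mul1r.
Qed.

Lemma cheat_pair_ge0 i j u v : 0 <= cheat_pair i j u v.
Proof.
rewrite /cheat_pair mulr_ge0 ?cheat_alice_ge0 //.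
by case: link => [f|]; [exact: ler0n|exact: cheat_bob_ge0].
Qed.

Lemma cheat_ns : ns_table cheat.
Proof.
split=> [s t u v|s t|s s' t v|s t t' u].
- exact: cheat_pair_ge0.
- by under eq_bigr => u _ do rewrite sum_cheat_v; rewrite sum_cheat_alice.
- by rewrite !sum_cheat_u.
- by rewrite !sum_cheat_v.
Qed.

Lemma cheat_bob_zero i j u : layer_prob (j %/ 2) = 1 -> cheat_pair i j u false = 0.
Proof.
move=> l1; have := sum_cheat_u i j false; rewrite /cheat_bob l1 subrr => S0.
apply/eqP; rewrite eq_le cheat_pair_ge0 andbT -S0 (bigD1 u) //= lerDl.
by apply: sumr_ge0 => u' _; apply: cheat_pair_ge0.
Qed.

Lemma layer_prob_top j : (N.-2 <= j)%N -> layer_prob (j %/ 2) = 1.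
Proof.
move=> jN; rewrite /layer_prob (_ : (_ - _)%N = 0%N) ?expr0 //.
apply/eqP; rewrite subn_eq0 leq_divRL //.
by move: jN; rewrite /N expnS; clear; move: (2 ^ m)%N => *; lia.
Qed.

(** On a ZERO gate Alice answers (1,1) because its index fields name the top gates, where Bob claims
    1 with certainty. The same certainty passes the test at the output gate. What remains is Bob
    claiming 1 on the ZERO gate itself. *)
Lemma cheat_caught i j g a b u v : (i < N)%N -> succ_gate (hcirc m) i = Some (g, a, b) ->
  violation (gk_val g u.1 u.2) u.1 u.2 v (i == j) (a == j) (b == j) (N.-1 == j) ->
  cheat_pair i j u v = 0 \/ v = true /\ (j < 2)%N.
Proof.
move=> iN; rewrite hsucc_gate //.
have p2 : (2 <= 2 ^ m)%N by rewrite -{1}(expn1 2) leq_pexp2l.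
have NE : N = (2 * 2 ^ m)%N by rewrite /N expnS.
have top j' : N.-1 = j' \/ N.-2 = j' -> cheat_pair i j' u false = 0.
  move=> H; apply: cheat_bob_zero; apply: layer_prob_top.
  by case: H => <-; rewrite -?subn1 ?leq_subr ?leqnn //; move: NE p2; clear; move: N (2 ^ m)%N => *; lia.
case: ltnP => i2 [<- <- <-] /=.
  have og : or_gate i = false by rewrite /or_gate ltnNge -ltnS i2.
  have E0 : u != (true, true) -> cheat_pair i j u v = 0.
    by rewrite /cheat_pair /cheat_alice og => /negbTE->; rewrite mul0r.
  have [uE|/E0] := eqVneq u (true, true); last by left.
  rewrite uE /=; case: v {E0} => [|H]; last first.
    left; rewrite -uE; apply: top; move: H; rewrite /violation /= !andbF /= !andbT => /or3P[]/eqP <-.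
    - by right; move: NE p2; clear; move: N (2 ^ m)%N => *; lia.
    - by left; move: NE p2; clear; move: N (2 ^ m)%N => *; lia.
    - by left.
  rewrite /violation /= !andbF !orbF andbT => /eqP <-.
  by right.
move=> H; left.
have og : or_gate i by rewrite /or_gate i2.
have h0 : (0 < i %/ 2)%N by rewrite divn_gt0.
have d2 a' : ((2 * a')%N %/ 2)%N = a' by rewrite mulKn.
have d3 a' : ((2 * a').+1 %/ 2)%N = a' by rewrite -addn1 mulnC divnMDl // addn0.
have nh : ((i %/ 2).-1 == i %/ 2)%N = false by apply/negbTE/eqP; move: h0; clear; lia.
case/or4P: H => /andP[/eqP jE nv].
- by rewrite /cheat_pair /link og -jE eqxx /= (negbTE nv) mulr0.
- by rewrite /cheat_pair /link og -jE d2 nh eqxx /= (negbTE nv) mulr0.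
- rewrite /cheat_pair /link og -jE d3 nh /= eqxx.
  by rewrite -[X in X == _]addn1 -[X in _ == X]addn0 eqn_add2l /= (negbTE nv) mulr0.
- by case: v nv => // _; apply: top; left.
Qed.

Lemma cheat_fail la lb (r : seq bool) : (1 < la)%N -> (0 < lb)%N ->
  pr (embed (la := la) (lb := lb) cheat) (rev (qi r)) (rev (qj r)) (rej N (hcirc m) N.-1 r)
  <= layer_prob 0.
Proof.
move=> la2 lb1; rewrite pr_embed /cheat !revK.
set i := num_of_bits (qi r); set j := num_of_bits (qj r).
apply: (@le_trans _ _ (\sum_u \sum_v cheat_pair i j u v * (v && (j < 2)%N)%:R)).
  apply: ler_sum => u _; apply: ler_sum => v _.
  rewrite /rej rejectE; last exact: hvalid.
  have [-> ->] := nth_embA la2 u; rewrite (nth_embB lb1) -/i -/j.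
  case: eqP => _ /=; last by rewrite mulr0 mulr_ge0 ?cheat_pair_ge0.
  case: ltnP => iN /=; last by rewrite mulr0 mulr_ge0 ?cheat_pair_ge0.
  case E : (succ_gate _ _) => [[[g a] b]|]; last by rewrite mulr0 mulr_ge0 ?cheat_pair_ge0.
  case: (boolP (violation _ _ _ _ _ _ _ _)) => [/(cheat_caught iN E)|_].
    by case=> [->|[-> ->]]; rewrite ?mul0r.
  by rewrite mulr0 mulr_ge0 ?cheat_pair_ge0.
under eq_bigr => u _ do rewrite big_bool /= mulr0 addr0.
rewrite -mulr_suml sum_cheat_u /cheat_bob.
case: ltnP => j2; last by rewrite mulr0 layer_prob_ge0.
by rewrite mulr1 divn_small.
Qed.

End Cheat.

(** * Numerical estimates and the final assembly *)

Lemma acc_prob_le1 V x P : no_signaling P -> acc_prob V x P <= 1.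
Proof.
move=> HP; rewrite /acc_prob ler_pdivrMl ?exprn_gt0 // mulr1.
apply: (@le_trans _ _ (\sum_(r : (v_m V (size x)).-tuple bool) 1)).
  apply: ler_sum => r _.
  have := @pr_le _ _ P HP (qA V x r) (qB V x r) (v_accepts V x r) (fun _ _ => true) (fun _ _ _ => isT).
  by rewrite pr_true.
by rewrite sumr_const card_tuple card_bool -mulr_natl mulr1 natrX.
Qed.

Lemma ns_value_ge V x P : no_signaling P -> acc_prob V x P <= ns_value V x.
Proof.
move=> HP; apply: ub_le_sup; last by exists P.
by exists 1 => _ [P' [HP' ->]]; exact: acc_prob_le1.
Qed.

(** The exponent 1/8 comes from (100 M)^2 <= M^8, which holds because 100 <= 7^3 <= M^3. Hence the
    eighth root of [n] is at most [M], and 2^M <= 2^(M+1) - 1, the exponent of the bottom layer. *)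
Lemma hard_bound M n : (7 <= M)%N -> (n <= (100 * M) * (100 * M))%N ->
  1 - 2 `^ (- 2 `^ (n%:R `^ 8^-1)) <= 1 - layer_prob M.+1 0 :> R.
Proof.
move=> M7 nM; rewrite lerD2l lerN2 /layer_prob subn0.
have nM8 : (n <= M ^ 8)%N.
  apply: leq_trans nM _.
  have : (100 * M <= M ^ 4)%N.
    rewrite (expnS M 3) mulnC leq_mul2l; apply/orP; right.
    by apply: (@leq_trans (7 ^ 3)) => //; rewrite leq_exp2r.
  by move=> h; apply: leq_trans (leq_mul h h) _; rewrite -expnD.
have H1 : n%:R `^ 8^-1 <= M%:R :> R.
  have -> : M%:R = (M ^ 8)%:R `^ 8^-1 :> R.
    rewrite natrX -powR_mulrn ?ler0n // -powRrM mulfV ?powRr1 ?ler0n //.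
    by rewrite pnatr_eq0.
  by apply: ge0_ler_powR; rewrite ?nnegrE ?ler0n ?invr_ge0 ?ler_nat.
have H2 : 2 `^ (n%:R `^ 8^-1) <= ((2 ^ M.+1).-1)%:R :> R.
  apply: (@le_trans _ _ (2 `^ M%:R)); first by apply: ler_powR; rewrite // ler1n.
  rewrite powR_mulrn // -natrX ler_nat.
  have : (0 < 2 ^ M)%N by rewrite expn_gt0.
  by rewrite expnS; move: (2 ^ M)%N => *; lia.
rewrite exprVn -powR_mulrn // -powRN; apply: ler_powR; first by rewrite ler1n.
by rewrite lerN2.
Qed.

Theorem theorem2 :
  exists (p : nat -> nat) (alpha : R) (V : verifier),
    [/\ [/\ is_poly p, 0 < alpha & good_verifier V],
      (* completeness *)
      (forall x, SCV_yes x ->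
         exists P : strategy (v_la V (size x)) (v_lb V (size x)),
           no_signaling P /\ acc_prob V x P = 1),
      (* soundness *)
      (forall x, SCV_no x ->
         forall P : strategy (v_la V (size x)) (v_lb V (size x)),
           no_signaling P -> acc_prob V x P <= 1 - (2^-1) ^+ (2 ^ p (size x))%N)
    & (* tightness: for infinitely many (no-instance) inputs x *)
      (forall n0 : nat, exists x, [/\ (n0 <= size x)%N, SCV_no x &
         1 - 2 `^ (- 2 `^ ((size x)%:R `^ alpha)) <= ns_value V x])].
Proof.
have [V [good [Vm Vla Vlb] VA VB Vacc]] := verifier_exists.
have lens x N D k : x = enc_inst N D k -> succ_valid N D k ->
    (1 < v_la V (size x))%N /\ (0 < v_lb V (size x))%N.
  move=> -> [_ so _ _ _]; rewrite Vla Vlb.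
  by have := size_enc_inst N k so; split; lia.
(* [v_m V] is pointwise the identity and already known to be polynomial. *)
exists (v_m V), 8^-1, V; split.
- by split=> //; [case: good|rewrite invr_gt0].
- move=> x [N [D [k [xE valid vk]]]]; have [la2 lb1] := lens _ _ _ _ xE valid.
  have ns := embed_ns (v_la V (size x)) (v_lb V (size x)) (honest_ns D).
  exists (embed (honest D)); split=> //; subst x.
  rewrite (acc_probE (Vm _) VA VB (Vacc N D k) ns).
  by rewrite big1 ?mulr0 ?subr0 // => r _; apply: honest_accepted.
- move=> x [N [D [k [-> valid vk]]]] P HP; rewrite Vm.
  exact: (soundness valid (Vm _) VA VB (Vacc N D k) vk HP).
(* The width, and with it the length of the instance, exceeds [n0]; the summand 7 meets the
   threshold of the size estimates. *)
- move=> n0; pose M := (n0 + 7)%N; pose m := M.+1.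
  pose N := (2 ^ m.+1)%N; pose x := enc_inst N (hcirc m) N.-1.
  have valid : succ_valid N (hcirc m) N.-1 by exact: hvalid.
  have [la2 lb1] := lens x _ _ _ erefl valid.
  have ns := embed_ns (v_la V (size x)) (v_lb V (size x)) (cheat_ns m).
  exists x; split.
  + have [_ so _ _ _] := valid; have := size_enc_inst N N.-1 so.
    by rewrite [dc_nin _]/= -/x /m /M; lia.
  + exists N, (hcirc m), N.-1; split=> //; apply: hvalue => //.
    by rewrite prednK ?expn_gt0.
  apply: le_trans (ns_value_ge ns); apply: le_trans (@hard_bound M _ _ _) _.
  * by rewrite /M leq_addl.
  * by apply: size_hard; rewrite /M leq_addl.
  rewrite (acc_probE (Vm _) VA VB (Vacc N (hcirc m) N.-1) ns).
  rewrite lerD2l lerN2 ler_pdivrMl ?exprn_gt0 //.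
  apply: (@le_trans _ _ (\sum_(r : (size x).-tuple bool) layer_prob m 0)).
    by apply: ler_sum => r _; apply: cheat_fail.
  by rewrite sumr_const card_tuple card_bool -[X in X <= _]mulr_natl natrX.
Qed.
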